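(* Let $A\hookrightarrow (S,O)$ be a reduced plane curve singularity and let $\Lambda$ be the lotus of an active constellation of crosses $\hat{\mathcal{C}}_A$ adapted to it, with underlying constellation $\mathcal{C}_A$. Decorate its edges by the multiplicities of $A$ at the infinitely near points of $\hat{\mathcal{C}}_A$ (the dual segment of the cross $X_P$ is decorated by $e_P(A)$, for $P\in\mathcal{C}_A$). Then the delta invariant $\delta(A)$ and the Milnor number $\mu(A)$ may be computed from those multiplicities by the formulae $$\delta(A)=\sum_{P\in\mathcal{C}_A}\frac{e_P(A)\,(e_P(A)-1)}{2},\qquad \mu(A)=2\,\delta(A)-r(A)+1,$$ where $r(A)$ denotes the number of branches of $A$.
   Context: **Infinitely near points and crosses.** $(S,O)$ is a germ of smooth complex analytic surface. A model is a composition of finitely many blowups of points above $O$. An infinitely near point of $O$ is $O$ or a point of the exceptional divisor of a model, points on two models being identified if the natural bimeromorphic map is a biholomorphism near them; $S^P$ is the minimal model containing $P$, and $E_P$ is the exceptional curve created by blowing up $P$ (also denoting its strict transforms). $P\preceq Q$ means that $Q$ is infinitely near $P$; then there is a morphism $\pi^Q_P:S^Q\to S^P$. A constellation is a set $\mathcal{C}$ of infinitely near points such that $Q\in\mathcal{C}$, $P\preceq Q$ imply $P\in\mathcal{C}$; it is active if one has chosen a subset of active points containing all non-maximal points; the others are inactive. A cross at $P$ is a reduced germ of normal crossings divisor with two branches at $P$. A constellation of crosses $\hat{\mathcal{C}}$ is a constellation $\mathcal{C}$ with a cross $X_P$ on $(S^P,P)$ for each $P\in\mathcal{C}$, such that the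 germ at $Q$ of $(\pi^Q_P)^{-1}(X_P)$ is contained in $X_Q$ whenever $P\preceq Q$. $S_{\mathcal{C}}$ is the model obtained by blowing up all active points, and $X_{\hat{\mathcal{C}}}$ is the reduced total transform on $S_{\mathcal{C}}$ of all the crosses. $\hat{\mathcal{C}}_A$ is adapted to $A$ if its underlying constellation $\mathcal{C}_A$ is the set of infinitely near points lying on the strict transforms of $A$ on the models between $S$ and an embedded resolution $\pi$ of $A$ (a model on which the total transform of $A$ has normal crossings), with exactly the maximal points declared inactive, and $\pi^{-1}(A)\subseteq X_{\hat{\mathcal{C}}_A}$. **Lotus.** The dual segment of a cross is a segment with vertices labeled by its two branches. The lotus is the simplicial complex built by starting from the dual segment of $X_O=L+L_1$ and going through the points of $\mathcal{C}$ in an order compatible with $\preceq$: (A) when $P$ is active, glue a triangle (petal) with vertices the branches of $X_P$ and $E_P$ along the dual segment of $X_P$, identifying vertices with the same label; (B) for a point $Q\neq O$, if the germ at $Q$ of the current total transform is a cross, this is $X_Q$, whose dual segment is already present; otherwise $X_Q=E+L_Q$ with $E$ the germ of the exceptional divisor and $L_Q$ smooth transversal to it, and one glues the dual segment of $X_Q$ at the vertex $E$. **Invariants.** $e_P(A)$ is the multiplicity at $P$ of the strict transform of $A$ on $S^P$. $\delta(A)=\dim_{\mathbb{C}}\mathcal{O}_{\tilde{A}}/\mathcal{O}_A$, where $\tilde{A}\to A$ is the normalization. $\mu(A)=\dim_{\mathbb{C}}\mathcal{O}_{S,O}/(\partial_xf,\partial_yf)$ for any defining function $f$ of $A$ and local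 coordinates $(x,y)$ (it is independent of these choices). *)

(* Defs.v *)
From HB Require Import structures.
From mathcomp Require Import all_boot all_order all_algebra generic_quotient.
From mathcomp Require Import complex ring.
From mathcomp Require Import finmap mathcomp_extra boolp classical_sets functions.
From mathcomp Require Import cardinality fsbigop reals.

Set Implicit Arguments.
Unset Strict Implicit.
Unset Printing Implicit Defensive.

Import Order.TTheory GRing.Theory Num.Theory.
Local Open Scope classical_set_scope.
Local Open Scope ring_scope.

Record fps (T : Type) := FPS { fcoef :> nat -> T }.

HB.instance Definition _ (T : Type) := [isNew for @fcoef T].
HB.instance Definition _ (T : choiceType) := [Choice of fps T by <:].

Section FormalPowerSeries.
Variable T : comNzRingType.
Implicit Types a b c : fps T.

Lemma fpsP a b : (forall n, a n = b n) <-> a = b.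
Proof.
by split=> [ab|-> //]; apply: val_inj; apply/funext => n; exact: ab.
Qed.

Definition fps_zero : fps T := FPS (fun=> 0).
Definition fps_opp a : fps T := FPS (fun n => - a n).
Definition fps_add a b : fps T := FPS (fun n => a n + b n).
Definition fps_one : fps T := FPS (fun n => (n == 0%N)%:R).
Definition fps_mul a b : fps T := FPS (fun n => \sum_(i < n.+1) a i * b (n - i)%N).

Fact fps_addA : associative fps_add.
Proof. by move=> a b c; apply/fpsP => n /=; rewrite addrA. Qed.
Fact fps_addC : commutative fps_add.
Proof. by move=> a b; apply/fpsP => n /=; rewrite addrC. Qed.
Fact fps_add0 : left_id fps_zero fps_add.
Proof. by move=> a; apply/fpsP => n /=; rewrite add0r. Qed.
Fact fps_addN : left_inverse fps_zero fps_opp fps_add.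
Proof. by move=> a; apply/fpsP => n /=; rewrite addNr. Qed.

HB.instance Definition _ :=
  GRing.isZmodule.Build (fps T) fps_addA fps_addC fps_add0 fps_addN.

Let trunc n a : {poly T} := \poly_(i < n.+1) a i.

Let truncE n a i : (i <= n)%N -> (trunc n a)`_i = a i.
Proof. by rewrite coef_poly ltnS => ->. Qed.

Let mul_trunc n a b i : (i <= n)%N ->
  fps_mul a b i = (trunc n a * trunc n b)`_i.
Proof.
move=> lein; rewrite coefM; apply: eq_bigr => j _.
rewrite !truncE //; first exact: leq_trans (leq_subr _ _) lein.
exact: leq_trans (leq_ord j) lein.
Qed.

Fact fps_mulA : associative fps_mul.
Proof.
move=> a b c; apply/fpsP => n.
transitivity ((trunc n a * (trunc n b * trunc n c))`_n).
  rewrite coefM; apply: eq_bigr => j _.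
  by rewrite truncE ?(leq_ord j) // (@mul_trunc n) // leq_subr.
rewrite mulrA coefM; apply: eq_bigr => j _.
by rewrite -mul_trunc ?(leq_ord j) // truncE // leq_subr.
Qed.

Fact fps_mulC : commutative fps_mul.
Proof. by move=> a b; apply/fpsP => n; rewrite !(@mul_trunc n) // mulrC. Qed.

Fact fps_mul1 : left_id fps_one fps_mul.
Proof.
move=> a; apply/fpsP => n /=; rewrite big_ord_recl /= mul1r subn0.
by rewrite big1 ?addr0 // => i _; rewrite mul0r.
Qed.

Fact fps_mulD : left_distributive fps_mul fps_add.
Proof.
move=> a b c; apply/fpsP => n /=; rewrite -big_split /=.
by apply: eq_bigr => i _; rewrite mulrDl.
Qed.

Fact fps_one_neq0 : fps_one != 0.
Proof. by apply/eqP => /fpsP /(_ 0%N) /= /eqP; rewrite oner_eq0. Qed.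

HB.instance Definition _ := GRing.Zmodule_isComNzRing.Build (fps T)
  fps_mulA fps_mulC fps_mul1 fps_mulD fps_one_neq0.

Definition fps_const (t : T) : fps T := FPS (fun n => if n == 0%N then t else 0).
Definition fps_var : fps T := FPS (fun n => (n == 1%N)%:R).

Lemma fps0E n : (0 : fps T) n = 0. Proof. by []. Qed.
Lemma fps1E n : (1 : fps T) n = (n == 0%N)%:R. Proof. by []. Qed.
Lemma fpsDE a b n : (a + b) n = a n + b n. Proof. by []. Qed.
Lemma fpsNE a n : (- a) n = - a n. Proof. by []. Qed.
Lemma fpsME a b n : (a * b) n = \sum_(i < n.+1) a i * b (n - i)%N.
Proof. by []. Qed.
Lemma fps_sumE (I : Type) (r : seq I) (P : pred I) (F : I -> fps T) n :
  (\sum_(i <- r | P i) F i) n = \sum_(i <- r | P i) F i n.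
Proof. by elim/big_rec2: _ => //= i _ y _ <-. Qed.

Lemma fps_const_is_zmod_morphism : zmod_morphism fps_const.
Proof.
by move=> s t; apply/fpsP => -[|n]; rewrite fpsDE fpsNE //= subr0.
Qed.

Lemma fps_constME t a n : (fps_const t * a) n = t * a n.
Proof.
rewrite fpsME big_ord_recl /= subn0 big1 ?addr0 // => i _.
by rewrite mul0r.
Qed.

Lemma fps_const_is_monoid_morphism : monoid_morphism fps_const.
Proof.
split=> [|s t]; apply/fpsP => -[|n] //.
  by rewrite fps_constME.
by rewrite fps_constME /= mulr0.
Qed.

HB.instance Definition _ := GRing.isZmodMorphism.Build T (fps T) fps_const
  fps_const_is_zmod_morphism.
HB.instance Definition _ := GRing.isMonoidMorphism.Build T (fps T) fps_const
  fps_const_is_monoid_morphism.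

End FormalPowerSeries.

(* The coefficient of [x^i y^j] in [f : fps (fps K)] is [f i j]. *)

Section ConvergentPowerSeries.
Variable K : numFieldType.
Local Notation fps2 := (fps (fps K)).
Implicit Types (f g u v : fps2) (r : K).

Definition partial_norm (N : nat) r f : K :=
  \sum_(i < N) \sum_(j < N) `|f i j| * r ^+ (i + j).

(* Absolute convergence on a polydisc of some positive radius [r]. *)
Definition convergent f : Prop :=
  exists2 r, 0 < r & exists M, forall N, partial_norm N r f <= M.

Local Notation pn := partial_norm.

Lemma fps2ME f g i j : (f * g) i j =
  \sum_(p < i.+1) \sum_(q < j.+1) f p q * g (i - p)%N (j - q)%N.
Proof. by rewrite fpsME fps_sumE. Qed.

Lemma pn_ge0 N r f : 0 <= r -> 0 <= pn N r f.
Proof.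
move=> r0; apply: sumr_ge0 => i _; apply: sumr_ge0 => j _.
by rewrite mulr_ge0 // exprn_ge0.
Qed.

Lemma pnD N r f g : 0 <= r -> pn N r (f + g) <= pn N r f + pn N r g.
Proof.
move=> r0; rewrite /pn -big_split /=; apply: ler_sum => i _.
rewrite -big_split /=; apply: ler_sum => j _.
by rewrite -mulrDl ler_wpM2r ?exprn_ge0 // ler_normD.
Qed.

Lemma pnN N r f : pn N r (- f) = pn N r f.
Proof.
by apply: eq_bigr => i _; apply: eq_bigr => j _; rewrite !fpsNE normrN.
Qed.

Lemma pn_sum (I : Type) (s : seq I) (F : I -> fps2) N r : 0 <= r ->
  pn N r (\sum_(i <- s) F i) <= \sum_(i <- s) pn N r (F i).
Proof.
move=> r0; elim: s => [|i s IH].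
  rewrite !big_nil /pn big1 // => i _; rewrite big1 // => j _.
  by rewrite !fps0E normr0 mul0r.
by rewrite !big_cons (le_trans (pnD _ _ _ r0)) // lerD2l.
Qed.

Lemma pn_mono N N' r s f : 0 <= r -> r <= s -> (N <= N')%N ->
  pn N r f <= pn N' s f.
Proof.
move=> r0 rs NN'; have s0 := le_trans r0 rs.
have t0 i j : 0 <= `|f i j| * s ^+ (i + j) by rewrite mulr_ge0 ?exprn_ge0.
rewrite /pn.
apply: (@le_trans _ _ (\sum_(i < N) \sum_(j < N) `|f i j| * s ^+ (i + j))).
  apply: ler_sum => i _; apply: ler_sum => j _.
  by rewrite ler_wpM2l // lerXn2r // nnegrE.
rewrite (big_ord_widen N' (fun i => \sum_(j < N) `|f i j| * s ^+ (i + j)) NN').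
rewrite big_mkcond /=; apply: ler_sum => i _.
case: ifP => _; last by apply: sumr_ge0 => j _.
rewrite (big_ord_widen N' (fun j => `|f i j| * s ^+ (i + j)) NN').
by rewrite big_mkcond /=; apply: ler_sum => j _; case: ifP.
Qed.



Let shift_le N (p : 'I_N) (F : nat -> K) : (forall q, 0 <= F q) ->
  \sum_(i < N | (p < i.+1)%N) F (i - p)%N <= \sum_(q < N) F q.
Proof.
move=> F0.
rewrite -(big_mkord (fun i => p < i.+1)%N (fun i => F (i - p)%N)).
rewrite -(big_mkord xpredT F).
have pN := ltnW (ltn_ord p).
rewrite (@big_cat_nat _ _ _ p 0 N) //= big_nat_cond big1 ?add0r; last first.
  by move=> i; rewrite ltnS; case: leqP => // _ /andP[].
rewrite -{1}[nat_of_ord p]add0n big_addn.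
rewrite (@big_cat_nat _ _ _ (N - p) 0 N) ?leq_subr //=.
rewrite big_mkcond /= ler_wpDr //; first exact: sumr_ge0.
apply: ler_sum_nat => i _; rewrite addnK; by case: ifP.
Qed.

Let conv_le N (F : nat -> nat -> K) : (forall p q, 0 <= F p q) ->
  \sum_(i < N) \sum_(p < i.+1) F p (i - p)%N <= \sum_(p < N) \sum_(q < N) F p q.
Proof.
move=> F0.
have -> : \sum_(i < N) \sum_(p < i.+1) F p (i - p)%N =
          \sum_(i < N) \sum_(p < N | (p < i.+1)%N) F p (i - p)%N.
  apply: eq_bigr => i _.
  by rewrite (big_ord_widen N (fun p => F p (i - p)%N)).
rewrite (exchange_big_dep xpredT) //=; apply: ler_sum => p _.
exact: (shift_le p (F0 p)).
Qed.

Lemma pnM N r f g : 0 <= r -> pn N r (f * g) <= pn N r f * pn N r g.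
Proof.
move=> r0.
pose H p q p' q' := (`|f p q| * r ^+ (p + q)) * (`|g p' q'| * r ^+ (p' + q')).
have H0 p q p' q' : 0 <= H p q p' q'.
  by rewrite !mulr_ge0 // exprn_ge0.
pose F p p' := \sum_(j < N) \sum_(q < j.+1) H p q p' (j - q)%N.
have F0 p p' : 0 <= F p p' by do 2!apply: sumr_ge0 => ? _.
apply: (@le_trans _ _ (\sum_(i < N) \sum_(p < i.+1) F p (i - p)%N)).
  apply: ler_sum => i _; rewrite exchange_big /=; apply: ler_sum => j _.
  rewrite fps2ME; apply: le_trans (_ : (\sum_(p < i.+1) \sum_(q < j.+1)
    `|f p q * g (i - p)%N (j - q)%N|) * r ^+ (i + j) <= _).
    rewrite ler_wpM2r ?exprn_ge0 // (le_trans (ler_norm_sum _ _ _)) //.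
    by apply: ler_sum => p _; exact: ler_norm_sum.
  rewrite mulr_suml; apply: ler_sum => p _.
  rewrite mulr_suml; apply: ler_sum => q _.
  rewrite /H normrM mulrACA -exprD addnACA subnKC ?(leq_ord p) //.
  by rewrite subnKC ?(leq_ord q).
apply: le_trans (conv_le _ F0) _.
apply: (@le_trans _ _ (\sum_(p < N) \sum_(p' < N) \sum_(q < N) \sum_(q' < N)
    H p q p' q')).
  apply: ler_sum => p _; apply: ler_sum => p' _.
  by apply: (@conv_le N (fun q q' => H p q p' q')) => q q'.
rewrite le_eqVlt; apply/orP; left; apply/eqP.
rewrite /pn mulr_suml; apply: eq_bigr => p _.
rewrite mulr_sumr; apply: eq_bigr => p' _.
rewrite mulr_suml; apply: eq_bigr => q _.
by rewrite mulr_sumr.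
Qed.

Lemma pn1 N r : pn N r 1 <= 1.
Proof.
case: N => [|N]; first by rewrite /pn big_ord0.
have -> : pn N.+1 r 1 = \sum_(i < N.+1) \sum_(j < N.+1)
    ((i == 0%N :> nat) && (j == 0%N :> nat))%:R * r ^+ (i + j).
  apply: eq_bigr => i _; apply: eq_bigr => j _; congr (_ * _).
  by case: i j => [[|i] ?] [[|j] ?]; rewrite ?normr1 ?normr0.
rewrite big_ord_recl big_ord_recl /= mul1r expr0.
rewrite big1 ?addr0 => [|j _]; last by rewrite mul0r.
by rewrite big1 ?addr0 // => i _; rewrite big1 // => j _; rewrite mul0r.
Qed.

Lemma pnX N r f n : 0 <= r -> pn N r (f ^+ n) <= pn N r f ^+ n.
Proof.
move=> r0; elim: n => [|n IH]; first by rewrite !expr0 pn1.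
by rewrite !exprS (le_trans (pnM _ _ _ r0)) // ler_wpM2l // pn_ge0.
Qed.

Lemma convergent2 f g : convergent f -> convergent g ->
  exists2 r, 0 < r & exists M, forall N, (pn N r f <= M) && (pn N r g <= M).
Proof.
move=> [r r0 [M fM]] [s s0 [L gL]].
have rs : r * s / (r + s) <= r.
  by rewrite ler_pdivrMr ?addr_gt0 // ler_pM2l // lerDr ltW.
have sr : r * s / (r + s) <= s.
  by rewrite ler_pdivrMr ?addr_gt0 // mulrC ler_pM2l // lerDl ltW.
have t0 : 0 < r * s / (r + s) by rewrite divr_gt0 ?mulr_gt0 ?addr_gt0.
have M0 : 0 <= M by apply: le_trans (fM 0%N); exact/pn_ge0/ltW.
have L0 : 0 <= L by apply: le_trans (gL 0%N); exact/pn_ge0/ltW.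
exists (r * s / (r + s)) => //; exists (M + L) => N; apply/andP; split.
  apply: le_trans (pn_mono f (ltW t0) rs (leqnn N)) _.
  by apply: le_trans (fM N) _; rewrite lerDl.
apply: le_trans (pn_mono g (ltW t0) sr (leqnn N)) _.
by apply: le_trans (gL N) _; rewrite lerDr.
Qed.

Definition conv_pred : {pred fps2} := fun f => `[< convergent f >].

Lemma convP f : reflect (convergent f) (f \in conv_pred).
Proof. exact: asboolP. Qed.

Fact conv_subring_closed : subring_closed conv_pred.
Proof.
split=> [|f g /convP cf /convP cg|f g /convP cf /convP cg]; apply/convP.
- by exists 1 => //; exists 1 => N; exact: pn1.
- have [r r0 [M FM]] := convergent2 cf cg; exists r => //; exists (M + M) => N.
  have /andP[fM gM] := FM N.
  by rewrite (le_trans (pnD _ _ _ (ltW r0))) // pnN lerD.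
have [r r0 [M FM]] := convergent2 cf cg; exists r => //; exists (M * M) => N.
have /andP[fM gM] := FM N.
by rewrite (le_trans (pnM _ _ _ (ltW r0))) // ler_pM // pn_ge0 ?ltW.
Qed.

HB.instance Definition _ := GRing.isSubringClosed.Build fps2 conv_pred
  conv_subring_closed.


Let convergent_monomial f a b :
  (forall i j, (i, j) != (a, b) -> f i j = 0) -> convergent f.
Proof.
move=> f0; exists 1 => //; exists `|f a b| => N.
have E i j : `|f i j| * 1 ^+ (i + j) = if (i == a) && (j == b) then `|f a b| else 0.
  rewrite expr1n mulr1; case: ifP => [/andP[/eqP-> /eqP->] //|ab].
  by rewrite f0 ?normr0 // xpair_eqE ab.
have [aN|aN] := ltnP a N; last first.
  rewrite /pn big1 // => i _; rewrite big1 // => j _; rewrite E.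
  by case: eqP => //= ia; move: (ltn_ord i); rewrite ia ltnNge aN.
rewrite /pn (bigD1 (Ordinal aN)) //= [X in _ + X]big1 ?addr0; last first.
  by move=> i ia; rewrite big1 // => j _; rewrite E -[(i == a :> nat)]/(i == Ordinal aN) (negPf ia).
have [bN|bN] := ltnP b N; last first.
  rewrite big1 // => j _; rewrite E.
  by case: (j =P b :> nat) => [jb|]; rewrite ?andbF //; move: (ltn_ord j); rewrite jb ltnNge bN.
rewrite (bigD1 (Ordinal bN)) //= [X in _ + X]big1 ?addr0 ?E ?eqxx //.
move=> j jb; rewrite E -[(j == b :> nat)]/(j == Ordinal bN) (negPf jb).
by rewrite andbF.
Qed.

Definition fps2_const (a : K) : fps2 := fps_const (fps_const a).

Fact convergent_const a : convergent (fps2_const a).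
Proof. by apply: (@convergent_monomial _ 0%N 0%N) => -[|i] [|j]. Qed.

Fact convergent_x : convergent (fps_var _).
Proof. by apply: (@convergent_monomial _ 1%N 0%N) => -[|[|i]] [|j]. Qed.

Fact convergent_y : convergent (fps_const (fps_var K)).
Proof. by apply: (@convergent_monomial _ 0%N 1%N) => -[|i] [|[|j]]. Qed.

Definition fps2_dx f : fps2 := FPS (fun i => FPS (fun j => f i.+1 j *+ i.+1)).
Definition fps2_dy f : fps2 := FPS (fun i => FPS (fun j => f i j.+1 *+ j.+1)).

Let half_expr n r : 0 <= r -> (r / 2) ^+ n *+ n.+1 <= r ^+ n.
Proof.
move=> r0; rewrite -mulr_natr exprMn exprVn -mulrA ler_piMr ?exprn_ge0 //.
rewrite mulrC ler_pdivrMr ?exprn_gt0 // mul1r -natrX ler_nat.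
exact: ltn_expl.
Qed.

Let half_le r : 0 <= r -> r / 2 <= r.
Proof. by move=> r0; rewrite ler_pdivrMr // ler_peMr // ler1n. Qed.

Fact convergent_dx f : convergent f -> convergent (fps2_dx f).
Proof.
move=> [r r0 [M fM]]; exists (r / 2); first by rewrite divr_gt0.
have r0' := ltW r0.
exists (M / r) => N; rewrite ler_pdivlMr //; apply: le_trans (fM N.+1).
rewrite /pn mulr_suml [leRHS]big_ord_recl ler_wpDl //.
  by apply: sumr_ge0 => j _; rewrite mulr_ge0 // exprn_ge0.
apply: ler_sum => i _; rewrite big_ord_recr /= mulr_suml ler_wpDr //.
  by rewrite mulr_ge0 // exprn_ge0.
apply: ler_sum => j _; rewrite /bump /= add1n normrMn mulrnAl -mulrnAr.
rewrite -mulrA ler_wpM2l // exprD -mulrnAl addSn exprSr ler_wpM2r // exprD.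
rewrite ler_pM ?half_expr ?mulrn_wge0 ?exprn_ge0 ?divr_ge0 //.
by rewrite lerXn2r ?nnegrE ?divr_ge0 ?half_le.
Qed.

Fact convergent_dy f : convergent f -> convergent (fps2_dy f).
Proof.
move=> [r r0 [M fM]]; exists (r / 2); first by rewrite divr_gt0.
have r0' := ltW r0.
exists (M / r) => N; rewrite ler_pdivlMr //; apply: le_trans (fM N.+1).
rewrite /pn mulr_suml big_ord_recr /= ler_wpDr //.
  by apply: sumr_ge0 => j _; rewrite mulr_ge0 // exprn_ge0.
apply: ler_sum => i _; rewrite big_ord_recl /= mulr_suml ler_wpDl //.
  by rewrite mulr_ge0 // exprn_ge0.
apply: ler_sum => j _; rewrite /bump /= add1n normrMn mulrnAl -mulrnAr.
rewrite -mulrA ler_wpM2l // exprD -mulrnAr addnS exprSr ler_wpM2r // exprD.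
rewrite ler_pM ?half_expr ?mulrn_wge0 ?exprn_ge0 ?divr_ge0 //.
by rewrite lerXn2r ?nnegrE ?divr_ge0 ?half_le.
Qed.

(* The composite [f(u, v)], for [u] and [v] without constant term: then     *)
(* [u^i v^j] has order at least [i + j], hence the truncation of the sum.   *)
Definition fps2_comp u v f : fps2 :=
  FPS (fun n => FPS (fun m =>
    (\sum_(i < (n + m).+1) \sum_(j < (n + m).+1)
      fps2_const (f i j) * u ^+ i * v ^+ j) n m)).

Let ordge k f := forall n m, (n + m < k)%N -> f n m = 0.

Let ordgeM k l f g : ordge k f -> ordge l g -> ordge (k + l) (f * g).
Proof.
move=> fk gl n m nm; rewrite fps2ME big1 // => p _; rewrite big1 // => q _.
have [pq|pq] := ltnP (p + q) k; first by rewrite fk ?mul0r.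
rewrite gl ?mulr0 // -(ltn_add2l k); apply: leq_ltn_trans nm.
apply: leq_trans (_ : (p + q) + (n - p + (m - q)) <= _)%N.
  by rewrite leq_add2r.
by rewrite addnACA !subnKC ?leq_ord.
Qed.

Let ordgeX f n : f 0%N 0%N = 0 -> ordge n (f ^+ n).
Proof.
move=> f0; have f1 : ordge 1 f by move=> [|?] [|?].
by elim: n => [//|n IH]; rewrite exprS -add1n; apply: ordgeM.
Qed.

Let fps2_sumE N (F : nat -> nat -> fps2) n m :
  (\sum_(i < N) \sum_(j < N) F i j) n m = \sum_(i < N) \sum_(j < N) F i j n m.
Proof.
rewrite !fps_sumE; apply: eq_bigr => i _.
by rewrite !fps_sumE.
Qed.

Let fps2_compE u v f N n m : u 0%N 0%N = 0 -> v 0%N 0%N = 0 -> (n + m < N)%N ->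
  fps2_comp u v f n m = (\sum_(i < N) \sum_(j < N)
      fps2_const (f i j) * u ^+ i * v ^+ j) n m.
Proof.
move=> u0 v0 nmN /=.
pose F i j : fps2 := fps2_const (f i j) * u ^+ i * v ^+ j.
have F0 i j : (n + m < i + j)%N -> F i j n m = 0.
  move=> nm; suff: ordge (i + j) (F i j) by apply.
  rewrite /F -mulrA -[(i + j)%N]add0n; apply: ordgeM => //.
  by apply: ordgeM; apply: ordgeX.
rewrite !(fps2_sumE _ F) (big_ord_widen N (fun i => \sum_(j < (n+m).+1) F i j n m)) //.
rewrite big_mkcond; apply: eq_bigr => i _ /=; case: ifP => inm; last first.
  rewrite big1 // => j _; apply: F0; rewrite (leq_trans _ (leq_addr _ _)) //.
  by rewrite ltnNge -ltnS inm.
rewrite (big_ord_widen N (fun j => F i j n m)) //.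
rewrite big_mkcond; apply: eq_bigr => j _ /=; case: ifP => // jnm.
rewrite F0 // (leq_trans _ (leq_addl _ _)) //.
by rewrite ltnNge -ltnS jnm.
Qed.

Let pn_small N r s f : 0 <= s -> s <= r -> 0 < r -> f 0%N 0%N = 0 ->
  pn N s f <= s / r * pn N r f.
Proof.
move=> s0 sr r0 f0; rewrite /pn mulr_sumr; apply: ler_sum => i _.
rewrite mulr_sumr; apply: ler_sum => j _.
have [ij|ij] := posnP (i + j).
  move/eqP: ij; rewrite addn_eq0 => /andP[/eqP-> /eqP->].
  by rewrite f0 normr0 !mul0r mulr0.
rewrite mulrCA ler_wpM2l // -(prednK ij) !exprS mulrA divfK ?gt_eqF //.
by rewrite ler_wpM2l // lerXn2r // nnegrE // ltW.
Qed.

Let pn_const N r a : 0 <= r -> pn N r (fps2_const a) <= `|a|.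
Proof.
move=> r0; have -> : fps2_const a = fps2_const a * 1 by rewrite mulr1.
have -> : pn N r (fps2_const a * 1) = `|a| * pn N r 1.
  rewrite /pn mulr_sumr; apply: eq_bigr => i _; rewrite mulr_sumr.
  by apply: eq_bigr => j _; rewrite !fps_constME normrM mulrA.
by rewrite ler_piMr ?pn1.
Qed.

Fact convergent_comp u v f : u 0%N 0%N = 0 -> v 0%N 0%N = 0 ->
  convergent u -> convergent v -> convergent f -> convergent (fps2_comp u v f).
Proof.
move=> u0 v0 cu cv [rho rho0 [L fL]].
have [r r0 [M uvM]] := convergent2 cu cv.
have M0 : 0 <= M.
  by have /andP[+ _] := uvM 0%N; apply: le_trans; exact/pn_ge0/ltW.
have d0 : 0 < rho + M by rewrite ltr_wpDr.
pose s := r * rho / (rho + M).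
have s0 : 0 < s by rewrite divr_gt0 ?mulr_gt0.
have sr : s <= r by rewrite ler_pdivrMr // ler_pM2l // lerDl.
have srho : s / r * M <= rho.
  have -> : s / r = rho / (rho + M).
    by rewrite /s (mulrC r) [LHS]mulrAC mulfK ?gt_eqF.
  rewrite mulrAC ler_pdivrMr //.
  by rewrite ler_pM2l // lerDr ltW.
have small (w : fps2) N : w 0%N 0%N = 0 -> pn N r w <= M -> pn N s w <= rho.
  move=> w0 wM; apply: le_trans (@pn_small N r s w (ltW s0) sr r0 w0) _.
  by apply: le_trans srho; rewrite ler_wpM2l // divr_ge0 // ltW.
exists s => //; exists L => N.
pose G : fps2 := \sum_(i < N + N) \sum_(j < N + N)
      fps2_const (f i j) * u ^+ i * v ^+ j.
have -> : pn N s (fps2_comp u v f) = pn N s G.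
  apply: eq_bigr => i _; apply: eq_bigr => j _; congr (`|_| * _).
  by apply: fps2_compE => //; rewrite -addSn leq_add // ltnW.
apply: le_trans (fL (N + N)%N).
apply: le_trans (pn_sum _ _ _ (ltW s0)) _; apply: ler_sum => i _.
apply: le_trans (pn_sum _ _ _ (ltW s0)) _; apply: ler_sum => j _.
have /andP[uM vM] := uvM N.
apply: le_trans (pnM _ _ _ (ltW s0)) _.
have e0 (w : fps2) k : 0 <= pn N s (w ^+ k) by exact/pn_ge0/ltW.
apply: (@le_trans _ _ (`|f i j| * rho ^+ i * rho ^+ j)); last by rewrite exprD mulrA.
have s0' := ltW s0; have rho0' := ltW rho0.
have X (w : fps2) k : w 0%N 0%N = 0 -> pn N r w <= M -> pn N s (w ^+ k) <= rho ^+ k.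
  move=> w0 wM; apply: le_trans (pnX _ _ _ (ltW s0)) _.
  by rewrite lerXn2r ?nnegrE ?pn_ge0 ?small.
rewrite ler_pM ?X //; first exact/pn_ge0/ltW.
apply: le_trans (pnM _ _ _ (ltW s0)) _.
by rewrite ler_pM ?X ?pn_const ?pn_ge0 // ltW.
Qed.

End ConvergentPowerSeries.

(* The ring of convergent power series in [x] and [y], i.e. the local ring *)
(* at [O] of a smooth surface germ with chosen local coordinates [(x, y)]. *)
Record cps (K : numFieldType) :=
  CPS { cps_val :> fps (fps K); _ : cps_val \in @conv_pred K }.

HB.instance Definition _ (K : numFieldType) := [isSub for @cps_val K].
HB.instance Definition _ (K : numFieldType) := [Choice of cps K by <:].
HB.instance Definition _ (K : numFieldType) :=
  [SubChoice_isSubComNzRing of cps K by <:].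

Section ConvergentRing.
Variable K : numFieldType.
Implicit Types (a : K) (f g u v : cps K).

Lemma cpsP f : convergent f.
Proof. by apply/convP; case: f. Qed.

Definition cps_of (f : fps (fps K)) (cf : convergent f) : cps K :=
  CPS (introT (convP f) cf).

Definition cps_const a : cps K := cps_of (convergent_const a).
Definition cps_x : cps K := cps_of (convergent_x K).
Definition cps_y : cps K := cps_of (convergent_y K).
Definition cps_dx f : cps K := cps_of (convergent_dx (cpsP f)).
Definition cps_dy f : cps K := cps_of (convergent_dy (cpsP f)).

Definition cps_comp u v (u0 : u 0%N 0%N = 0) (v0 : v 0%N 0%N = 0) f : cps K :=
  cps_of (convergent_comp u0 v0 (cpsP u) (cpsP v) (cpsP f)).

Lemma cps_const_is_zmod_morphism : zmod_morphism cps_const.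
Proof. by move=> a b; apply: val_inj; rewrite /= /fps2_const !raddfB. Qed.

Lemma cps_const_is_monoid_morphism : monoid_morphism cps_const.
Proof.
by split=> [|a b]; apply: val_inj; rewrite /= /fps2_const ?rmorphM ?rmorph1.
Qed.

HB.instance Definition _ := GRing.isZmodMorphism.Build K (cps K) cps_const
  cps_const_is_zmod_morphism.
HB.instance Definition _ := GRing.isMonoidMorphism.Build K (cps K) cps_const
  cps_const_is_monoid_morphism.

Definition cps_scale a f : cps K := cps_const a * f.

Fact cps_scaleA a b f : cps_scale a (cps_scale b f) = cps_scale (a * b) f.
Proof. by rewrite /cps_scale mulrA rmorphM. Qed.
Fact cps_scale1 : left_id 1 cps_scale.
Proof. by move=> f; rewrite /cps_scale rmorph1 mul1r. Qed.
Fact cps_scaleDr : right_distributive cps_scale +%R.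
Proof. by move=> a f g; rewrite /cps_scale mulrDr. Qed.
Fact cps_scaleDl f : {morph cps_scale^~ f : a b / a + b}.
Proof. by move=> a b; rewrite /cps_scale rmorphD mulrDl. Qed.

HB.instance Definition _ := GRing.Zmodule_isLmodule.Build K (cps K)
  cps_scaleA cps_scale1 cps_scaleDr cps_scaleDl.

Lemma cpsM00 f g : (f * g) 0%N 0%N = f 0%N 0%N * g 0%N 0%N.
Proof. by rewrite -[LHS]/((val f * val g) 0%N 0%N) fps2ME !big_ord1. Qed.

Lemma cps_x0 : cps_x 0%N 0%N = 0. Proof. by []. Qed.
Lemma cps_y0 : cps_y 0%N 0%N = 0. Proof. by []. Qed.

End ConvergentRing.
Arguments cps_x {K}.
Arguments cps_y {K}.

Section Divisibility.
Variable T : comNzRingType.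
Implicit Types p q g : T.

Definition divides p q : Prop := exists g, q = g * p.
Definition invertible p : Prop := divides p 1.
Definition associated p q : Prop := divides p q /\ divides q p.
Definition irreducible p : Prop := [/\ p <> 0, ~ invertible p &
  forall g h, p = g * h -> invertible g \/ invertible h].

End Divisibility.

(* [n] is the dimension of the quotient [U / W] of linear subspaces [W] of [U]: *)
(* the classes of [b 0, ..., b (n - 1)] are a basis of it.                      *)
Definition quotient_dim (K : fieldType) (V : lmodType K) (U W : set V)
    (n : nat) : Prop :=
  exists b : 'I_n -> V, (forall i, U (b i)) /\
    (forall v, U v -> exists! t : {ffun 'I_n -> K}, W (v - \sum_i t i *: b i)).

(* A reduced plane curve singularity, given by a defining function. *)
Record curve (K : numFieldType) := Curve {
  eqn :> cps K;
  eqn_neq0 : eqn <> 0;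
  eqn_origin : eqn 0%N 0%N = 0;
  eqn_reduced : forall (g : cps K) (n : nat),
    divides eqn (g ^+ n) -> divides eqn g }.

Section Normalization.
Variables (K : numFieldType) (A : curve K).
Implicit Types (f g h : cps K).

(* [g] is not a zero divisor of the local ring [cps K / (A)] *)
Definition regular g : Prop := forall h, divides (eqn A) (g * h) -> divides (eqn A) h.

(* The total ring of fractions of [cps K / (A)], as classes of pairs [(f, g)] *)
(* with [g] regular modulo [A].                                              *)
Record fraction := Fraction { frac_val : cps K * cps K;
  _ : `[< regular frac_val.2 >] }.
HB.instance Definition _ := [isSub for frac_val].
HB.instance Definition _ := [Choice of fraction by <:].
Implicit Types x y z : fraction.

Definition num x := (frac_val x).1.
Definition den x := (frac_val x).2.

Lemma regular_den x : regular (den x).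
Proof. by case: x => u ru; apply/asboolP. Qed.

Lemma regular1 : regular 1.
Proof. by move=> h; rewrite mul1r. Qed.

Lemma regularM g h : regular g -> regular h -> regular (g * h).
Proof. by move=> rg rh k; rewrite -mulrA => /rg /rh. Qed.

Definition mkfrac f g (rg : regular g) : fraction :=
  @Fraction (f, g) (introT (asboolP _) rg).

Let dvdD f g : divides (eqn A) f -> divides (eqn A) g -> divides (eqn A) (f + g).
Proof. by move=> [u ->] [v ->]; exists (u + v); rewrite mulrDl. Qed.
Let dvdN f : divides (eqn A) f -> divides (eqn A) (- f).
Proof. by move=> [u ->]; exists (- u); rewrite mulNr. Qed.
Let dvdMl g f : divides (eqn A) f -> divides (eqn A) (g * f).
Proof. by move=> [u ->]; exists (g * u); rewrite mulrA. Qed.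
Let dvd0 : divides (eqn A) 0.
Proof. by exists 0; rewrite mul0r. Qed.

Definition equiv_frac x y : bool :=
  `[< divides (eqn A) (num x * den y - num y * den x) >].

Let equivP x y : reflect (divides (eqn A) (num x * den y - num y * den x))
  (equiv_frac x y).
Proof. exact: asboolP. Qed.

Lemma equiv_frac_refl : reflexive equiv_frac.
Proof. by move=> x; apply/equivP; rewrite subrr. Qed.

Lemma equiv_frac_sym : symmetric equiv_frac.
Proof.
by move=> x y; apply/equivP/equivP => /dvdN; rewrite opprB.
Qed.

Lemma equiv_frac_trans : transitive equiv_frac.
Proof.
move=> y x z /equivP xy /equivP yz; apply/equivP.
apply: (@regular_den y).
have -> : den y * (num x * den z - num z * den x) =
  den z * (num x * den y - num y * den x) +
  den x * (num y * den z - num z * den y).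
  by ring.
by apply: dvdD; apply: dvdMl.
Qed.


Canonical equiv_frac_equiv :=
  EquivRel equiv_frac equiv_frac_refl equiv_frac_sym equiv_frac_trans.

Definition total_fractions := {eq_quot equiv_frac}%qT.
HB.instance Definition _ : EqQuotient _ equiv_frac total_fractions :=
  EqQuotient.on total_fractions.
HB.instance Definition _ := Choice.on total_fractions.

Local Notation Q := total_fractions.
Local Notation pi := (\pi_Q)%qT.
Implicit Types q : Q.

Let piP x y : divides (eqn A) (num x * den y - num y * den x) <-> pi x = pi y.
Proof.
by split=> [/equivP xy|/eqP]; [apply/eqP|]; rewrite eqmodE // => /equivP.
Qed.

Let repr_pi x : divides (eqn A)
  (num (repr (pi x)) * den x - num x * den (repr (pi x))).
Proof. by apply/piP; rewrite reprK. Qed.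

Let piW (P : Q -> Prop) : (forall x, P (pi x)) -> forall q, P q.
Proof. by move=> Pp q; rewrite -[q]reprK. Qed.

Definition frac_add x y := mkfrac (num x * den y + num y * den x)
  (regularM (@regular_den x) (@regular_den y)).
Definition frac_mul x y := mkfrac (num x * num y)
  (regularM (@regular_den x) (@regular_den y)).
Definition frac_opp x := mkfrac (- num x) (@regular_den x).
Definition frac_of f := mkfrac f regular1.

Definition tf_add q1 q2 : Q := pi (frac_add (repr q1) (repr q2)).
Definition tf_mul q1 q2 : Q := pi (frac_mul (repr q1) (repr q2)).
Definition tf_opp q : Q := pi (frac_opp (repr q)).
Definition tf_of f : Q := pi (frac_of f).

Let fracE := ((fun f g rg => erefl : num (@mkfrac f g rg) = f),
  (fun f g rg => erefl : den (@mkfrac f g rg) = g)).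

Let addE x y : tf_add (pi x) (pi y) = pi (frac_add x y).
Proof.
apply/piP; have := repr_pi x; have := repr_pi y.
set x' := repr (pi x); set y' := repr (pi y) => yy xx; rewrite /num /den /=.
rewrite -/(num x) -/(num y) -/(num x') -/(num y').
rewrite -/(den x) -/(den y) -/(den x') -/(den y').
have -> : (num x' * den y' + num y' * den x') * (den x * den y) -
  (num x * den y + num y * den x) * (den x' * den y') =
  (den y * den y') * (num x' * den x - num x * den x') +
  (den x * den x') * (num y' * den y - num y * den y') by ring.
by apply: dvdD; apply: dvdMl.
Qed.

Let mulE x y : tf_mul (pi x) (pi y) = pi (frac_mul x y).
Proof.
apply/piP; have := repr_pi x; have := repr_pi y.
set x' := repr (pi x); set y' := repr (pi y) => yy xx; rewrite /num /den /=.
rewrite -/(num x) -/(num y) -/(num x') -/(num y').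
rewrite -/(den x) -/(den y) -/(den x') -/(den y').
have -> : (num x' * num y') * (den x * den y) -
  (num x * num y) * (den x' * den y') =
  (num y' * den y) * (num x' * den x - num x * den x') +
  (num x * den x') * (num y' * den y - num y * den y') by ring.
by apply: dvdD; apply: dvdMl.
Qed.

Let oppE x : tf_opp (pi x) = pi (frac_opp x).
Proof.
apply/piP; rewrite /num /den /= -/(num _) -/(den _) -/(num x) -/(den x).
by rewrite !mulNr opprK addrC -opprB; apply: dvdN; apply: repr_pi.
Qed.

Let eqfrac x y : num x * den y = num y * den x -> pi x = pi y.
Proof. by move=> xy; apply/piP; rewrite xy subrr. Qed.

Fact tf_addA : associative tf_add.
Proof.
elim/piW=> x; elim/piW=> y; elim/piW=> z; rewrite !addE.
by apply: eqfrac; rewrite /= !fracE; ring.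
Qed.
Fact tf_addC : commutative tf_add.
Proof.
elim/piW=> x; elim/piW=> y; rewrite !addE.
by apply: eqfrac; rewrite /= !fracE; ring.
Qed.
Fact tf_add0 : left_id (tf_of 0) tf_add.
Proof.
elim/piW=> x; rewrite addE.
by apply: eqfrac; rewrite /= !fracE; ring.
Qed.
Fact tf_addN : left_inverse (tf_of 0) tf_opp tf_add.
Proof.
elim/piW=> x; rewrite oppE addE.
by apply: eqfrac; rewrite /= !fracE; ring.
Qed.
Fact tf_mulA : associative tf_mul.
Proof.
elim/piW=> x; elim/piW=> y; elim/piW=> z; rewrite !mulE.
by apply: eqfrac; rewrite /= !fracE; ring.
Qed.
Fact tf_mulC : commutative tf_mul.
Proof.
elim/piW=> x; elim/piW=> y; rewrite !mulE.
by apply: eqfrac; rewrite /= !fracE; ring.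
Qed.
Fact tf_mul1 : left_id (tf_of 1) tf_mul.
Proof.
elim/piW=> x; rewrite mulE.
by apply: eqfrac; rewrite /= !fracE; ring.
Qed.
Fact tf_mulD : left_distributive tf_mul tf_add.
Proof.
elim/piW=> x; elim/piW=> y; elim/piW=> z; rewrite addE !mulE addE.
by apply: eqfrac; rewrite /= !fracE; ring.
Qed.

Lemma eqn_dvd1 : ~ divides (eqn A) 1.
Proof.
move=> [g /(congr1 (fun f : cps K => f 0%N 0%N))].
by rewrite cpsM00 eqn_origin mulr0 => /eqP; rewrite oner_eq0.
Qed.

Fact tf_one_neq0 : tf_of 1 != tf_of 0.
Proof.
apply/eqP => /piP; rewrite /num /den /= mul0r subr0 mulr1.
exact: eqn_dvd1.
Qed.

HB.instance Definition _ :=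
  GRing.isZmodule.Build Q tf_addA tf_addC tf_add0 tf_addN.
HB.instance Definition _ := GRing.Zmodule_isComNzRing.Build Q
  tf_mulA tf_mulC tf_mul1 tf_mulD tf_one_neq0.

Lemma tf_of_is_zmod_morphism : zmod_morphism tf_of.
Proof.
move=> f g; rewrite -[RHS]/(tf_add (tf_of f) (tf_opp (tf_of g))) oppE addE.
by apply: eqfrac; rewrite /= !fracE; ring.
Qed.

Lemma tf_of_is_monoid_morphism : monoid_morphism tf_of.
Proof.
split=> // f g; rewrite -[RHS]/(tf_mul (tf_of f) (tf_of g)) mulE.
by apply: eqfrac; rewrite /= !fracE; ring.
Qed.

HB.instance Definition _ := GRing.isZmodMorphism.Build (cps K) Q tf_of
  tf_of_is_zmod_morphism.
HB.instance Definition _ := GRing.isMonoidMorphism.Build (cps K) Q tf_of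
  tf_of_is_monoid_morphism.

Definition tf_scale (a : K) q : Q := tf_of (cps_const a) * q.

Fact tf_scaleA a b q : tf_scale a (tf_scale b q) = tf_scale (a * b) q.
Proof. by rewrite /tf_scale mulrA !rmorphM. Qed.
Fact tf_scale1 : left_id 1 tf_scale.
Proof. by move=> q; rewrite /tf_scale !rmorph1 mul1r. Qed.
Fact tf_scaleDr : right_distributive tf_scale +%R.
Proof. by move=> a p q; rewrite /tf_scale mulrDr. Qed.
Fact tf_scaleDl q : {morph tf_scale^~ q : a b / a + b}.
Proof. by move=> a b; rewrite /tf_scale !rmorphD mulrDl. Qed.

HB.instance Definition _ := GRing.Zmodule_isLmodule.Build K Q
  tf_scaleA tf_scale1 tf_scaleDr tf_scaleDl.

End Normalization.

Section Invariants.
Variables (K : numFieldType) (A : curve K).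

Definition normalization : set (total_fractions A) :=
  [set q | integralOver (@tf_of K A) q].

Definition is_delta_invariant (d : nat) : Prop :=
  quotient_dim normalization (range (@tf_of K A)) d.

Definition jacobian_ideal : set (cps K) :=
  [set g | exists a b, g = a * cps_dx A + b * cps_dy A].

Definition is_milnor_number (m : nat) : Prop :=
  quotient_dim [set: cps K] jacobian_ideal m.

(* A branch is represented by its prime ideal. *)
Definition branches : set (set (cps K)) :=
  [set I | exists p, [/\ irreducible p, divides p (eqn A) & I = divides p]].

Definition branch_number : nat := #|` fset_set branches|.

End Invariants.

Section InfinitelyNearPoints.
Variable K : numFieldType.
Implicit Types (f g u v p : cps K) (c : option K).

(* The points of the exceptional curve of the blowup of a point with local  *)
(* coordinates [(x, y)] are the tangent directions at that point: [Some a]  *)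
(* is the direction of [y = a x], with coordinates [(x', y')] such that     *)
(* [(x, y) = (x', x' (y' + a))], and [None] is the direction of [x = 0],    *)
(* with coordinates such that [(x, y) = (x' y', y')].                       *)
Definition chart c : cps K * cps K :=
  if c is Some a then (cps_x, cps_x * (cps_y + cps_const a))
  else (cps_x * cps_y, cps_y).

Definition exceptional c : cps K := if c is Some _ then cps_x else cps_y.

Fact chart1_origin c : (chart c).1 0%N 0%N = 0.
Proof. by case: c => [a|] //; rewrite cpsM00 cps_x0 mul0r. Qed.

Fact chart2_origin c : (chart c).2 0%N 0%N = 0.
Proof. by case: c => [a|] //; rewrite cpsM00 cps_x0 mul0r. Qed.

Definition pullback1 f c : cps K :=
  cps_comp (chart1_origin c) (chart2_origin c) f.

(* The quotient of the pullback by the highest power of the equation of the *)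
(* exceptional curve dividing it.                                           *)
Definition strict1 f c : cps K :=
  xget 0 [set g | ~ divides (exceptional c) g /\
    exists k, pullback1 f c = exceptional c ^+ k * g].

(* An infinitely near point is given by the successive directions in which  *)
(* it lies, starting from [O = [::]]; the germ of [S^P] at [P] then has the *)
(* coordinates provided by [chart], and [P] precedes [Q] when [prefix P Q]. *)
Definition point := seq (option K).

Definition strictly_precedes (P Q : point) : Prop := prefix P Q /\ P <> Q.

(* For [prefix P Q], the pullback by the morphism of germs               *)
(* [(S^Q, Q) -> (S^P, P)] of a function at [P], and its strict transform. *)
Definition pullback (P Q : point) f : cps K :=
  foldl pullback1 f (drop (size P) Q).
Definition strict_transform (P Q : point) f : cps K :=
  foldl strict1 f (drop (size P) Q).

(* The germ at [Q] of the exceptional curve [E_P], for [P] strictly preceding [Q]. *)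
Definition exceptional_germ (P Q : point) : cps K :=
  if drop (size P) Q is c :: s then foldl strict1 (exceptional c) s else 1.

Definition order f : nat :=
  xget 0%N [set n | (forall i j, (i + j < n)%N -> f i j = 0) /\
    exists i j, (i + j)%N = n /\ f i j <> 0].

Definition passes (A : curve K) (P : point) : Prop :=
  strict_transform [::] P A 0%N 0%N = 0.

Definition multiplicity (A : curve K) (P : point) : nat :=
  order (strict_transform [::] P A).

Definition local_coordinates u v : Prop :=
  [/\ u 0%N 0%N = 0, v 0%N 0%N = 0 &
      u 1%N 0%N * v 0%N 1%N - u 0%N 1%N * v 1%N 0%N <> 0].

Definition normal_crossings f : Prop :=
  exists u v e a b, [/\ local_coordinates u v, invertible e &
    f = e * u ^+ a * v ^+ b].

(* Inclusion of the reduced divisors of [f] and [g]. *)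
Definition support_included f g : Prop :=
  forall p, irreducible p -> divides p f -> divides p g.

(* A model is given by the set of points which are blown up. *)
Definition is_model (B : set point) : Prop :=
  finite_set B /\ forall P Q, B Q -> prefix P Q -> B P.

(* The points of the exceptional divisor of the model (or [O] if nothing is *)
(* blown up); the germ of the model at such a [Q] is that of [S^Q].         *)
Definition model_points (B : set point) : set point :=
  [set Q | ~ B Q /\ forall P, strictly_precedes P Q -> B P].

Definition embedded_resolution (A : curve K) (B : set point) : Prop :=
  is_model B /\
  forall Q, model_points B Q -> normal_crossings (pullback [::] Q A).

Record constellation_of_crosses := ConstellationOfCrosses {
  pts : set point;
  active : set point;
  (* local equations at [P] of the two branches of the cross at [P] *)
  branch_eqn : point -> bool -> cps K;
  pts_closed : forall P Q, pts Q -> prefix P Q -> pts P;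
  active_pts : active `<=` pts;
  nonmaximal_active : forall P Q, pts Q -> strictly_precedes P Q -> active P;
  cross_coordinates : forall P, pts P ->
    local_coordinates (branch_eqn P false) (branch_eqn P true);
  cross_included : forall P Q, pts Q -> prefix P Q -> support_included
    (pullback P Q (branch_eqn P false * branch_eqn P true))
    (branch_eqn Q false * branch_eqn Q true) }.

Definition cross (C : constellation_of_crosses) (P : point) : cps K :=
  branch_eqn C P false * branch_eqn C P true.

Definition adapted (C : constellation_of_crosses) (A : curve K) : Prop :=
  exists B, [/\ embedded_resolution A B,
    pts C = [set P | passes A P /\
      exists B', [/\ is_model B', B' `<=` B & model_points B' P]],
    active C = [set P | pts C P /\ exists Q, pts C Q /\ strictly_precedes P Q] &
    forall Q, model_points (active C) Q -> forall p, irreducible p ->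
      divides p (pullback [::] Q A) ->
      exists P, [/\ pts C P, prefix P Q & divides p (pullback P Q (cross C P))]].

(* [Exc P] labels the strict transforms of [E_P] and [Br P b] those of the  *)
(* branch [b] of the cross at [P], which is used when that branch is new.   *)
Inductive label := Exc of point | Br of point & bool.

Definition new_branch (C : constellation_of_crosses) (P : point) (b : bool) : Prop :=
  forall P0, strictly_precedes P0 P ->
    ~ divides (branch_eqn C P b) (pullback P0 P (cross C P0)).

Definition has_label (C : constellation_of_crosses) (Q : point) (b : bool) (l : label) : Prop :=
  match l with
  | Exc P => strictly_precedes P Q /\
      associated (branch_eqn C Q b) (exceptional_germ P Q)
  | Br P b' => [/\ prefix P Q, new_branch C P b' &
      associated (branch_eqn C Q b) (strict_transform P Q (branch_eqn C P b'))]
  end.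

Definition dual_segment (C : constellation_of_crosses) (P : point) : set label :=
  [set l | exists b, has_label C P b l].

(* As cells with the same labels are identified, the gluing of the dual     *)
(* segments of the crosses and of the petals of the active points does not  *)
(* depend on the order, and a simplex is determined by its set of vertices. *)
Definition lotus (C : constellation_of_crosses) : set (set label) :=
  [set s | s !=set0 /\ exists P, pts C P /\
    (s `<=` dual_segment C P \/
     active C P /\ s `<=` dual_segment C P `|` [set Exc P])].

Definition multiplicity_decoration (C : constellation_of_crosses)
    (A : curve K) (Lambda : set (set label)) (m : set label -> nat) : Prop :=
  forall P, pts C P ->
    Lambda (dual_segment C P) /\ m (dual_segment C P) = multiplicity A P.

End InfinitelyNearPoints.

(* Main.v *)
(* At a point of multiplicity [e] of the curve, the local ring [O] of the curve has
   codimension [e (e - 1) / 2] in the product [O'] of the local rings of the strict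
   transform at the points of the exceptional curve [E], because [E^(e-1) O'] lies in
   [O]. Going along the tree of infinitely near points down to the smooth germs and
   nodes left by the embedded resolution, the local ring of [A] thus has codimension
   [sum_P e_P (e_P - 1) / 2] in a product of rings of convergent power series in one
   variable, one for each branch. That product is the normalization, as it is
   integrally closed and some power of [t] multiplies it into the local ring.

   The same induction shows that [dx / f_y] has poles of total order [2 delta] on the
   normalization. For [f] regular of order [n] in [y], this gives the intersection
   number [(f, f_y) = 2 delta + n - r]. On the other hand
   [(f, f_y) = (f_x, f_y) + (x, f_y) = mu + n - 1] (Teissier): the intersection numbers
   with [f_y] are orders of norms from [C{x,y} / (f_y)] to [C{x}], which are products
   over the Puiseux roots of [f_y], and there the derivative of [f] is [f_x x']. *)

Require Import Defs.
From HB Require Import structures.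
From mathcomp Require Import all_boot all_order all_algebra generic_quotient.
From mathcomp Require Import complex ring zify.
From mathcomp Require Import finmap boolp classical_sets functions.
From mathcomp Require Import cardinality fsbigop reals.

Set Implicit Arguments.
Unset Strict Implicit.
Unset Printing Implicit Defensive.

Import Order.TTheory GRing.Theory Num.Theory.
Local Open Scope classical_set_scope.
Local Open Scope ring_scope.

(** * Linear algebra of finite codimension *)

Section Codimension.
Variable K : fieldType.
Implicit Types V : lmodType K.

(** The constant [e (e - 1) / 2] is a difference. Seen from [O'], the submodule [E^(e-1) O'] has
    codimension [(e-1) e], because the strict transform meets [E] with total multiplicity [e]; seen
    from [O] it is the image of the power [m^(e-1)] of the maximal ideal, of codimension
    [e (e-1) / 2]. Its inclusion in [O] is Hermite interpolation by forms of degree [e - 1] at the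
    tangent directions, made exact by a determinant form of Nakayama's lemma. The pole order grows
    in step: [f_y] pulls back to [x^(e-1)] times the derivative of the strict transform, and [x] has
    total order [e] on the branches, which adds [e (e-1)], twice the contribution to delta. So a
    single inductive statement, [parametrized], carries the codimension, the branches, the conductor
    and the differential form. The analytic core is one fixed-point lemma, which yields inverses and
    Weierstrass division. Closedness of principal ideals, quotients by smooth germs, intersection
    numbers with [x] and Hensel's lemma then follow algebraically. A linear shear restores
    regularity in [y] where division needs it. *)

Definition subspace V (S : set V) : Prop :=
  S 0 /\ forall a u v, S u -> S v -> S (a *: u + v).

Lemma subspaceT V : subspace [set: V]. Proof. by []. Qed.

Lemma subspace0 V : subspace [set 0 : V].
Proof. by split=> // a u v /= -> ->; rewrite scaler0 addr0. Qed.

Section SubspaceTheory.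
Variables (V : lmodType K) (S : set V).
Hypothesis sS : subspace S.

Lemma subspaceD u v : S u -> S v -> S (u + v).
Proof. by move=> Su Sv; rewrite -[u]scale1r; apply: sS.2. Qed.

Lemma subspaceZ a u : S u -> S (a *: u).
Proof. by move=> Su; rewrite -[_ *: _]addr0; apply: sS.2 => //; exact: sS.1. Qed.

Lemma subspaceN u : S u -> S (- u).
Proof. by move=> Su; rewrite -scaleN1r; apply: subspaceZ. Qed.

Lemma subspaceB u v : S u -> S v -> S (u - v).
Proof. by move=> Su Sv; apply: subspaceD => //; apply: subspaceN. Qed.

Lemma subspace_sum (I : Type) (r : seq I) (P : pred I) (F : I -> V) :
  (forall i, P i -> S (F i)) -> S (\sum_(i <- r | P i) F i).
Proof.
by move=> SF; elim/big_ind: _ => //; [exact: sS.1|exact: subspaceD].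
Qed.

Lemma subspace_comb n (t : 'I_n -> K) (b : 'I_n -> V) :
  (forall i, S (b i)) -> S (\sum_i t i *: b i).
Proof. by move=> Sb; apply: subspace_sum => i _; apply: subspaceZ. Qed.

Lemma subspace_subr u v : S (u - v) -> S u <-> S v.
Proof.
move=> Suv; split=> [Su|Sv]; last by rewrite -(subrK v u); apply: subspaceD.
by rewrite -(subKr u v); apply: subspaceB.
Qed.

End SubspaceTheory.

Definition independent_mod V (W : set V) n (b : 'I_n -> V) : Prop :=
  forall t : 'I_n -> K, W (\sum_i t i *: b i) -> forall i, t i = 0.

Lemma combB V n (s t : 'I_n -> K) (b : 'I_n -> V) :
  \sum_i (s i - t i) *: b i = \sum_i s i *: b i - \sum_i t i *: b i.
Proof. by rewrite -sumrB; apply: eq_bigr => i _; rewrite scalerBl. Qed.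

(** Uniqueness of coordinates is independence, because two coordinate vectors of the same element
    differ by a relation modulo [W]. *)
Lemma quotient_dimP V (U W : set V) n : subspace U -> subspace W ->
  quotient_dim U W n <-> exists b : 'I_n -> V,
    [/\ forall i, U (b i),
        forall v, U v -> exists t : 'I_n -> K, W (v - \sum_i t i *: b i)
      & independent_mod W b].
Proof.
move=> sU sW; split=> -[b].
  case=> Ub H; exists b; split=> // [v /H[t [Wt _]]|t Wt i]; first by exists t.
  have [t0 [_ u0]] := H _ sU.1.
  have e1 : t0 = [ffun i => - t i].
    apply: u0; rewrite sub0r -sumrN.
    by under eq_bigr do rewrite ffunE scaleNr opprK.
  have /ffunP/(_ i) : t0 = [ffun => 0].
    apply: u0; rewrite big1 ?subr0 => [|j _]; first exact: sW.1.
    by rewrite ffunE scale0r.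
  by rewrite e1 !ffunE => /eqP; rewrite oppr_eq0 => /eqP.
move=> [Ub sp ind]; exists b; split=> // v /sp[t Wt].
exists [ffun i => t i]; split=> [|s Ws].
  by under eq_bigr do rewrite ffunE.
apply/ffunP => i; rewrite ffunE; apply/eqP; rewrite -subr_eq0; apply/eqP.
apply: (ind (fun i => t i - s i)); rewrite combB.
have := subspaceB sW Ws Wt.
by rewrite opprB [X in W X]addrC addrA subrK.
Qed.

Lemma quotient_dim_add V (U W Z : set V) n m :
  subspace U -> subspace W -> subspace Z -> Z `<=` W -> W `<=` U ->
  quotient_dim U W n -> quotient_dim W Z m -> quotient_dim U Z (n + m).
Proof.
move=> sU sW sZ ZW WU /(quotient_dimP _ sU sW)[b [Ub bs bi]].
move=> /(quotient_dimP _ sW sZ)[c [Wc cs ci]]; apply/quotient_dimP => //.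
exists (fun i : 'I_(n + m) => match fintype.split i with inl j => b j | inr j => c j end).
have E (t : 'I_(n + m) -> K) :
    \sum_i t i *: match fintype.split i with inl j => b j | inr j => c j end =
    \sum_i t (lshift m i) *: b i + \sum_i t (rshift n i) *: c i.
  by rewrite big_split_ord /=; congr (_ + _); apply: eq_bigr => i _;
    rewrite ?(unsplitK (inl _ i)) ?(unsplitK (inr _ i)).
split=> [i|v Uv|t].
- by case: (fintype.split i) => j //; apply: WU.
- have [t Wt] := bs _ Uv; have [s Zs] := cs _ Wt.
  exists (fun i : 'I_(n + m) => match fintype.split i with inl j => t j | inr j => s j end).
  rewrite E opprD addrA.
  under eq_bigr do rewrite (unsplitK (inl _ _)).
  by under [X in _ - X]eq_bigr do rewrite (unsplitK (inr _ _)).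
rewrite E => Zt.
have t1 : forall i, t (lshift m i) = 0.
  apply: (bi (fun i => t (lshift m i))).
  have := subspaceB sW (ZW _ Zt) (subspace_comb sW (fun i => t (rshift n i)) Wc).
  by rewrite addrK.
have t2 : forall i, t (rshift n i) = 0.
  apply: (ci (fun i => t (rshift n i))).
  by move: Zt; rewrite big1 ?add0r // => i _; rewrite t1 scale0r.
by move=> i; rewrite -(splitK i); case: (fintype.split i) => j; [exact: t1|exact: t2].
Qed.

(** The rows of [A] are the coordinates of the [c i]; a row vector killing [A] is a relation between
    the [c i] modulo [W], so [A] has full row rank. *)
Lemma independent_mod_le V (U W : set V) n m (c : 'I_m -> V) :
  subspace U -> subspace W -> quotient_dim U W n ->
  (forall i, U (c i)) -> independent_mod W c -> (m <= n)%N.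
Proof.
move=> sU sW /(quotient_dimP _ sU sW)[b [Ub bs bi]] Uc ci.
pose A := \matrix_(i < m, j < n) projT1 (cid (bs _ (Uc i))) j.
suff /eqP <- : \rank A == m by apply: rank_leq_col.
rewrite -[_ == _]/(row_free A) -kermx_eq0; apply/eqP/row_matrixP => k.
rewrite row0; set u := row k _.
have uA : u *m A = 0 by rewrite /u -row_mul mulmx_ker row0.
apply/rowP => i; rewrite [RHS]mxE; apply: (ci (fun i => u 0 i)).
suff: W (\sum_i u 0 i *: c i - \sum_i u 0 i *: \sum_j A i j *: b j).
  rewrite [X in _ - X](_ : _ = 0) ?subr0 //.
  under eq_bigr do rewrite scaler_sumr.
  rewrite exchange_big big1 //= => j _.
  under eq_bigr do rewrite scalerA.
  by rewrite -scaler_suml; move/rowP/(_ j): uA; rewrite !mxE => ->; rewrite scale0r.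
rewrite -sumrB; apply: subspace_sum => // j _; rewrite -scalerBr.
apply: subspaceZ => //; under eq_bigr do rewrite mxE.
by case: cid.
Qed.

Lemma quotient_dim_uniq V (U W : set V) n m : subspace U -> subspace W ->
  quotient_dim U W n -> quotient_dim U W m -> n = m.
Proof.
move=> sU sW hn hm; apply/eqP; rewrite eqn_leq.
have /(quotient_dimP _ sU sW)[b [Ub _ bi]] := hn.
have /(quotient_dimP _ sU sW)[c [Uc _ ci]] := hm.
by rewrite (independent_mod_le sU sW hm Ub bi) (independent_mod_le sU sW hn Uc ci).
Qed.

(** An independent family of maximal size spans, since a vector outside its span could be added to
    it. The bound [N] makes the maximum exist. *)
Lemma quotient_dim_bounded V (U W : set V) N : subspace U -> subspace W ->
  (forall m (c : 'I_m -> V), (forall i, U (c i)) -> independent_mod W c ->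
    (m <= N)%N) ->
  exists m, quotient_dim U W m.
Proof.
move=> sU sW bnd.
pose P m := `[< exists c : 'I_m -> V, (forall i, U (c i)) /\ independent_mod W c >].
have exP : exists m, P m.
  by exists 0%N; apply/asboolP; exists (fun=> 0); split=> [[]//|t _ []].
have Pb m : P m -> (m <= N)%N by move=> /asboolP[c [Uc ci]]; apply: (bnd _ c).
case: (ex_maxnP exP Pb) => m /asboolP[c [Uc ci]] mx; exists m.
apply/quotient_dimP => //; exists c; split=> // v Uv; apply: contrapT => nv.
suff /mx : P m.+1 by rewrite ltnn.
apply/asboolP.
exists (fun i : 'I_m.+1 => if unlift ord0 i is Some j then c j else v).
split=> [i|t]; first by case: unliftP.
rewrite big_ord_recl unlift_none; under eq_bigr do rewrite liftK.
move=> Wt; have [t0|t0] := eqVneq (t ord0) 0; last first.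
  case: nv; exists (fun i => - (t ord0)^-1 * t (lift ord0 i)).
  have -> : v - \sum_i (- (t ord0)^-1 * t (lift ord0 i)) *: c i =
      (t ord0)^-1 *: (t ord0 *: v + \sum_i t (lift ord0 i) *: c i).
    rewrite scalerDr scalerA mulVf // scale1r -sumrN; congr (_ + _).
    by rewrite scaler_sumr; apply: eq_bigr => i _; rewrite mulNr scaleNr opprK scalerA.
  exact: subspaceZ.
move: Wt; rewrite t0 scale0r add0r => /(ci (fun i => t (lift ord0 i))) tw i.
by case: (unliftP ord0 i) => [j ->|->].
Qed.

(** It yields the existence of both intermediate dimensions, so that two chains between the same
    subspaces can be compared and solved for an unknown term. *)
Lemma quotient_dim_split V (U U' W : set V) n :
  subspace U -> subspace U' -> subspace W -> W `<=` U' -> U' `<=` U ->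
  quotient_dim U W n ->
  exists m k, [/\ quotient_dim U U' m, quotient_dim U' W k & n = (m + k)%N].
Proof.
move=> sU sU' sW WU' U'U hn.
have [k hk] : exists k, quotient_dim U' W k.
  apply: (quotient_dim_bounded (N := n)) => // m c Uc ci.
  by apply: (independent_mod_le sU sW hn _ ci) => i; apply: U'U.
have [m hm] : exists m, quotient_dim U U' m.
  apply: (quotient_dim_bounded (N := n)) => // m c Uc ci.
  by apply: (independent_mod_le sU sW hn Uc) => t /WU'; apply: ci.
exists m, k; split=> //; apply: (quotient_dim_uniq sU sW hn).
exact: quotient_dim_add hm hk.
Qed.

(** [phi] induces an isomorphism from [U / W] to [U' / W']: the equivalence gives a well-defined
    injection, the last hypothesis surjectivity. *)
Lemma quotient_dim_map V V' (phi : V -> V') (U W : set V) (U' W' : set V') n :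
  linear phi -> subspace U -> subspace W -> subspace U' -> subspace W' ->
  (forall u, U u -> U' (phi u)) ->
  (forall u, U u -> W u <-> W' (phi u)) ->
  (forall u', U' u' -> exists2 u, U u & W' (u' - phi u)) ->
  quotient_dim U W n <-> quotient_dim U' W' n.
Proof.
move=> lphi sU sW sU' sW' UU' WW' srj.
pose pM := GRing.isLinear.Build K V V' _ phi lphi.
pose p : {linear V -> V'} := HB.pack phi pM.
have phiS m (t : 'I_m -> K) b : phi (\sum_i t i *: b i) = \sum_i t i *: phi (b i).
  rewrite -[phi]/(p : V -> V') raddf_sum; apply: eq_bigr => i _; exact: linearZ.
have phiB u v : phi (u - v) = phi u - phi v by rewrite -[phi]/(p : V -> V') raddfB.
rewrite !quotient_dimP //; split=> -[b [Ub bs bi]].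
  exists (phi \o b); split=> [i|v' /srj[u Uu W'u]|t]; first exact: UU'.
  - have [t Wt] := bs _ Uu; exists t; rewrite /= -phiS.
    have : W' (phi (u - \sum_i t i *: b i)).
      by apply/WW' => //; apply: subspaceB => //; apply: subspace_comb.
    by rewrite phiB => /(subspaceD sW' W'u); rewrite addrA subrK.
  by rewrite /= -phiS => /(WW' _ (subspace_comb sU t Ub)); apply: bi.
pose c i := projT1 (cid2 (srj _ (Ub i))).
have Uc i : U (c i) by rewrite /c; case: cid2.
have Wc i : W' (b i - phi (c i)) by rewrite /c; case: cid2.
have Wcs m : W' (\sum_i m i *: b i - \sum_i m i *: phi (c i)).
  rewrite -sumrB; apply: subspace_sum => // i _; rewrite -scalerBr.
  exact: subspaceZ.
exists c; split=> // [v Uv|t Wt].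
  have [t W't] := bs _ (UU' _ Uv); exists t.
  apply/(WW' _ (subspaceB sU Uv (subspace_comb sU t Uc))).
  by rewrite phiB phiS; have := subspaceD sW' W't (Wcs t); rewrite addrA subrK.
apply: bi; apply/(subspace_subr sW' (Wcs t)); rewrite -phiS.
by apply/(WW' _ (subspace_comb sU t Uc)).
Qed.

Lemma quotient_dim_refl V (U : set V) : subspace U -> quotient_dim U U 0.
Proof.
move=> sU; apply/quotient_dimP => //; exists (fun=> 0); split=> [[]//|v Uv|t _ []//].
by exists (fun=> 0); rewrite big_ord0 subr0.
Qed.

(** A Chinese remainder argument: every class of [U_ i / W_ i] is attained by an element whose other
    images lie in the [W_ j], so the conditions are imposed one at a time and codimensions add. *)
Lemma quotient_dim_joint V (I : eqType) (V_ : I -> lmodType K) (s : seq I)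
    (U : set V) (U_ W_ : forall i, set (V_ i)) (p : forall i, V -> V_ i)
    (n : I -> nat) :
  uniq s -> subspace U -> (forall i, subspace (U_ i)) ->
  (forall i, subspace (W_ i)) -> (forall i, linear (p i)) ->
  (forall i v, i \in s -> U v -> U_ i (p i v)) ->
  (forall i, i \in s -> quotient_dim (U_ i) (W_ i) (n i)) ->
  (forall i u, i \in s -> U_ i u -> exists v, [/\ U v, W_ i (u - p i v) &
    forall j, j \in s -> j != i -> W_ j (p j v)]) ->
  quotient_dim U [set v | U v /\ forall i, i \in s -> W_ i (p i v)]
    (\sum_(i <- s) n i).
Proof.
move=> us sU sU_ sW lp UU hn srj.
have sS (r : seq I) : subspace [set v | U v /\ forall i, i \in r -> W_ i (p i v)].
  split=> [|a u v [Uu Wu] [Uv Wv]]; split.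
  - exact: sU.1.
  - move=> i _; have := lp i (-1) 0 0.
    by rewrite scaler0 addr0 scaleN1r addNr => ->; exact: (sW i).1.
  - exact: sU.2.
  - by move=> i ri; rewrite lp; apply: (sW i).2; [apply: Wu|apply: Wv].
elim: s us UU hn srj => [|i s IH] /=.
  move=> *; rewrite big_nil [X in quotient_dim _ X](_ : _ = U); first exact: quotient_dim_refl.
  by apply/seteqP; split=> [v []|v].
move=> /andP[iNs us] UU hn srj; rewrite big_cons addnC.
apply: (@quotient_dim_add _ _ [set v | U v /\ forall i, i \in s -> W_ i (p i v)]) => //.
- by move=> v [Uv Wv]; split=> // j js; apply: Wv; rewrite inE js orbT.
- by move=> v [].
- apply: IH => // [j v js|j js|j u js Uu].
  + by apply: UU; rewrite inE js orbT.
  + by apply: hn; rewrite inE js orbT.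
  have [|v [Uv Wv vj]] := srj j u _ Uu; first by rewrite inE js orbT.
  by exists v; split=> // l ls; apply: vj; rewrite inE ls orbT.
have ii : i \in i :: s by rewrite inE eqxx.
apply: (iffRL (quotient_dim_map (n i) (lp i) (sS s) (sS (i :: s)) (sU_ i)
  (sW i) _ _ _)); last exact: hn.
- by move=> u [Uu _]; apply: UU.
- move=> u [Uu Wu]; split=> [[_]|Wiu]; first exact.
  by split=> // j; rewrite inE => /predU1P[->|/Wu].
move=> u Uu; have [v [Uv Wv vj]] := srj i u ii Uu; exists v => //; split=> // j js.
by apply: vj; rewrite ?inE ?js ?orbT //; apply: contraNneq iNs => <-.
Qed.

(** Dual vectors make the forms [p i] jointly surjective. Later the forms are coefficients and the
    dual vectors monomials. *)
Lemma quotient_dim_forms V (U W : set V) (I : eqType) (s : seq I)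
    (p : I -> V -> K) :
  uniq s -> subspace U -> (forall i a u v, p i (a *: u + v) = a * p i u + p i v) ->
  (forall i, i \in s -> exists2 v, U v & forall j, j \in s -> p j v = (j == i)%:R) ->
  (forall v, W v <-> U v /\ forall i, i \in s -> p i v = 0) ->
  quotient_dim U W (size s).
Proof.
move=> us sU lp srj WE.
have -> : W = [set v | U v /\ forall i, i \in s -> (p i v : K^o) \in [set 0 : K^o]].
  apply/seteqP; split=> v; rewrite WE => -[Uv pv]; split=> // i /pv; rewrite ?inE //.
have -> : size s = \sum_(i <- s) 1 by rewrite sum1_size.
have Q1 : quotient_dim [set: K^o] [set 0 : K^o] 1.
  apply/quotient_dimP => //; first exact: subspace0.
  exists (fun=> 1); split=> // [v _|t].
    by exists (fun=> v); rewrite big_ord1 /= /GRing.scale /= mulr1 subrr.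
  by rewrite /= big_ord1 /GRing.scale /= mulr1 => t0 i; rewrite ord1.
have := @quotient_dim_joint V I (fun=> K^o) s U (fun=> setT) (fun=> [set 0])
  p (fun=> 1%N) us sU (fun=> @subspaceT K^o) (fun=> @subspace0 K^o).
rewrite (_ : [set v | U v /\ forall i, i \in s -> [set 0 : K^o] (p i v)] =
  [set v | U v /\ forall i, i \in s -> (p i v : K^o) \in [set 0 : K^o]]); last first.
  by apply/seteqP; split=> v [Uv pv]; split=> // i /pv; rewrite ?inE.
have p0 j : p j 0 = 0.
  by have := lp j (-1) 0 0; rewrite scaler0 addr0 mulN1r addNr.
apply=> // i u is_ _; have [v Uv pv] := srj i is_.
exists (u *: v); split=> [||j js ji].
- exact: subspaceZ.
- by rewrite -[u *: v]addr0 lp p0 addr0 pv // eqxx mulr1 /= subrr.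
by rewrite -[u *: v]addr0 lp p0 addr0 pv // (negPf ji) mulr0.
Qed.

End Codimension.

(** * Orders of formal power series *)

Section PowerSeries.
Variable T : comNzRingType.
Implicit Types a b : fps T.

Lemma fps_low_mul a b n m k : (forall i, (i < n)%N -> a i = 0) ->
  (forall j, (j < m)%N -> b j = 0) -> (k < n + m)%N -> (a * b) k = 0.
Proof.
move=> a0 b0 kl; rewrite fpsME big1 // => -[i /= ik] _.
have [im|im] := ltnP i n; first by rewrite a0 ?mul0r.
by rewrite b0 ?mulr0 //; lia.
Qed.

Lemma fps_lead_mul a b n m : (forall i, (i < n)%N -> a i = 0) ->
  (forall j, (j < m)%N -> b j = 0) -> (a * b) (n + m)%N = a n * b m.
Proof.
move=> a0 b0; have nk : (n < (n + m).+1)%N by rewrite ltnS leq_addr.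
rewrite fpsME (bigD1 (Ordinal nk)) //= addKn big1 ?addr0 // => -[i /= ik] ni.
have [im|im] := ltnP i n; first by rewrite a0 ?mul0r.
rewrite b0 ?mulr0 //; move: ni; rewrite -val_eqE /= => ni; lia.
Qed.

Lemma fps_order_ex a : a != 0 -> exists2 n, a n != 0 & forall i, (i < n)%N -> a i = 0.
Proof.
move=> a0; have ex : exists n, a n != 0.
  apply: contrapT => na; case/eqP: a0; apply/fpsP => n; rewrite fps0E.
  by apply/eqP; apply: contrapT => an; apply: na; exists n; apply/negP.
exists (ex_minn ex); case: ex_minnP => // n an mn i ni.
by apply/eqP; apply: contraTT ni => /mn; rewrite -leqNgt.
Qed.

(** The lowest coefficients multiply. The coefficient ring is arbitrary so that the result can be
    iterated for two variables. *)
Lemma fps_integral : (forall s t : T, s * t = 0 -> s = 0 \/ t = 0) ->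
  forall a b, a * b = 0 -> a = 0 \/ b = 0.
Proof.
move=> dom a b ab; have [->|/fps_order_ex[n an a0]] := eqVneq a 0; first by left.
have [->|/fps_order_ex[m bm b0]] := eqVneq b 0; first by right.
have := fps_lead_mul a0 b0; rewrite ab fps0E => /esym /dom[] /eqP.
  by rewrite (negPf an).
by rewrite (negPf bm).
Qed.

Lemma fps_varXE n a k :
  (fps_var T ^+ n * a) k = if (k < n)%N then 0 else a (k - n)%N.
Proof.
elim: n a k => [|n IH] a k; first by rewrite expr0 mul1r subn0.
rewrite exprSr -mulrA IH; case: ltnP => kn; first by rewrite ltnW.
have -> (c : fps T) j : (fps_var T * c) j = if j is j'.+1 then c j' else 0.
  rewrite fpsME; case: j => [|j]; first by rewrite big_ord1 /= mul0r.
  rewrite big_ord_recl big_ord_recl /= mul0r mul1r add0r big1 ?addr0 //.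
    by rewrite /bump /= subSS subn0.
  by move=> i _; rewrite mul0r.
case: ltnP => kn'; first by have -> : (k - n = 0)%N by lia.
by have -> : (k - n = (k - n.+1).+1)%N by lia.
Qed.

Definition fps_shift n a : fps T := FPS (fun i => a (i + n)%N).

Lemma fps_shiftK n a : (forall i, (i < n)%N -> a i = 0) ->
  fps_var T ^+ n * fps_shift n a = a.
Proof.
move=> a0; apply/fpsP => k; rewrite fps_varXE; case: ltnP => kn; first by rewrite a0.
by rewrite /= subnK.
Qed.

End PowerSeries.

(** * Two variables: norms, inverses and Weierstrass division *)

Section DoubleSeries.
Variable K : numFieldType.
Local Notation fps2 := (fps (fps K)).
Implicit Types (f g h q r u v w : fps2).

Lemma fps1_integral (a b : fps K) : a * b = 0 -> a = 0 \/ b = 0.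
Proof.
by apply: fps_integral => s t /eqP; rewrite mulf_eq0 => /orP[]/eqP; [left|right].
Qed.

Lemma fps2_integral f g : f * g = 0 -> f = 0 \/ g = 0.
Proof. exact/fps_integral/fps1_integral. Qed.

Definition fps2_x : fps2 := fps_var _.
Definition fps2_y : fps2 := fps_const (fps_var K).

Lemma fps2P f g : (forall i j, f i j = g i j) -> f = g.
Proof. by move=> fg; apply/fpsP => i; apply/fpsP. Qed.

Lemma fps2BE f g i j : (f - g) i j = f i j - g i j.
Proof. by []. Qed.

Lemma fps2_xXE n f i j : (fps2_x ^+ n * f) i j = if (i < n)%N then 0 else f (i - n)%N j.
Proof. by rewrite fps_varXE; case: ifP. Qed.

Lemma fps2_yXE n f i j : (fps2_y ^+ n * f) i j = if (j < n)%N then 0 else f i (j - n)%N.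
Proof. by rewrite /fps2_y -rmorphXn fps_constME fps_varXE. Qed.

Lemma fps2_constME c f i j : (fps2_const c * f) i j = c * f i j.
Proof. by rewrite !fps_constME. Qed.

(** The [k]-th power of the maximal ideal, in terms of coefficients. *)
Definition vanish k f : Prop := forall i j, (i + j < k)%N -> f i j = 0.

Lemma vanishM k l f g : vanish k f -> vanish l g -> vanish (k + l) (f * g).
Proof.
move=> fk gl n m nm; rewrite fps2ME big1 // => -[p /= pn] _; rewrite big1 // => -[q /= qm] _.
have [pq|pq] := ltnP (p + q) k; first by rewrite fk ?mul0r.
by rewrite gl ?mulr0 //; lia.
Qed.

Lemma vanishD k f g : vanish k f -> vanish k g -> vanish k (f + g).
Proof. by move=> fk gk i j ij; rewrite !fpsDE fk // gk // addr0. Qed.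

Lemma vanishN k f : vanish k f -> vanish k (- f).
Proof. by move=> fk i j ij; rewrite !fpsNE fk // oppr0. Qed.

Lemma vanishMl k f g : vanish k g -> vanish k (f * g).
Proof. by rewrite -[k in X in _ -> X]add0n; apply: vanishM. Qed.

Lemma vanish_le k l f : (k <= l)%N -> vanish l f -> vanish k f.
Proof. by move=> kl fl i j ij; apply: fl; apply: leq_trans kl. Qed.

Lemma vanishX k f n : vanish k f -> vanish (n * k) (f ^+ n).
Proof.
by move=> fk; elim: n => [|n IH]; rewrite ?mul0n // exprS mulSn; apply: vanishM.
Qed.

Lemma vanish1 f : f 0%N 0%N = 0 -> vanish 1 f.
Proof. by move=> f0 [|i] [|j]. Qed.

Lemma vanish_eq0 f : (forall k, vanish k f) -> f = 0.
Proof. by move=> fk; apply: fps2P => i j; apply: (fk (i + j).+1). Qed.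

Definition rescale (a b : K) f : fps2 :=
  FPS (fun i => FPS (fun j => f i j * (a ^+ i * b ^+ j))).

Lemma rescaleM a b f g : rescale a b (f * g) = rescale a b f * rescale a b g.
Proof.
apply: fps2P => i j; rewrite fps2ME.
transitivity ((f * g) i j * (a ^+ i * b ^+ j)) => //.
rewrite fps2ME mulr_suml; apply: eq_bigr => -[p /= pi] _.
rewrite mulr_suml; apply: eq_bigr => -[q /= qj] _.
have -> : a ^+ i = a ^+ p * a ^+ (i - p) by rewrite -exprD subnKC.
have -> : b ^+ j = b ^+ q * b ^+ (j - q) by rewrite -exprD subnKC.
by rewrite /=; ring.
Qed.

Lemma rescaleD a b f g : rescale a b (f + g) = rescale a b f + rescale a b g.
Proof. by apply: fps2P => i j /=; rewrite mulrDl. Qed.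

(* The weighted norm [sum |f i j| a^i b^j] of [f] is at most [M]. *)
Definition norm_le (a b : K) f M : Prop := forall N, partial_norm N 1 (rescale a b f) <= M.

Lemma norm_le_ge0 a b f M : norm_le a b f M -> 0 <= M.
Proof. by move=> /(_ 0%N); apply: le_trans; apply: pn_ge0. Qed.

Lemma norm_leD a b f g M L : norm_le a b f M -> norm_le a b g L ->
  norm_le a b (f + g) (M + L).
Proof.
move=> fM gL N; rewrite rescaleD; apply: le_trans (pnD _ _ _ ler01) _.
exact: lerD.
Qed.

Lemma norm_leM a b f g M L : norm_le a b f M -> norm_le a b g L ->
  norm_le a b (f * g) (M * L).
Proof.
move=> fM gL N; rewrite rescaleM; apply: le_trans (pnM _ _ _ ler01) _.
by rewrite ler_pM // pn_ge0.
Qed.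

Lemma norm_leN a b f M : norm_le a b f M -> norm_le a b (- f) M.
Proof.
move=> fM N; rewrite (_ : rescale a b (- f) = - rescale a b f) ?pnN //.
by apply: fps2P => i j /=; rewrite mulNr.
Qed.

Lemma norm_le_coef a b a' b' c f g M : 0 <= c ->
  (forall i j, `|g i j * (a' ^+ i * b' ^+ j)| <= c * `|f i j * (a ^+ i * b ^+ j)|) ->
  norm_le a b f M -> norm_le a' b' g (c * M).
Proof.
move=> c0 gf fM N; apply: le_trans (ler_wpM2l c0 (fM N)).
rewrite /partial_norm mulr_sumr; apply: ler_sum => i _.
rewrite mulr_sumr; apply: ler_sum => j _.
by rewrite expr1n !mulr1; apply: gf.
Qed.

Lemma norm_le_radius a b a' b' f M : 0 <= a' -> 0 <= b' -> a' <= a -> b' <= b ->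
  norm_le a b f M -> norm_le a' b' f M.
Proof.
move=> a0 b0 aa bb fM; rewrite -[M]mul1r; apply: norm_le_coef fM => // i j.
have a1 := le_trans a0 aa; have b1 := le_trans b0 bb.
rewrite mul1r !normrM ler_wpM2l // !ger0_norm ?exprn_ge0 //.
by apply: ler_pM; rewrite ?exprn_ge0 // lerXn2r // nnegrE.
Qed.

(** Convergence is defined with one radius for both variables, but division has to shrink the radius
    in [x] alone. Conversely, [a * b / (a + b)] lies below both radii. *)
Lemma convergent_norm f : convergent f <->
  exists a b M, [/\ 0 < a, 0 < b & norm_le a b f M].
Proof.
split=> [[r r0 [M fM]]|[a [b [M [a0 b0 fM]]]]].
  exists r, r, M; split=> // N; apply: le_trans (fM N).
  rewrite le_eqVlt; apply/orP; left; apply/eqP.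
  apply: eq_bigr => i _; apply: eq_bigr => j _.
  by rewrite expr1n mulr1 normrM -exprD (ger0_norm (exprn_ge0 _ (ltW r0))).
have d0 : 0 < a + b by rewrite addr_gt0.
have ra : a * b / (a + b) <= a by rewrite ler_pdivrMr // ler_pM2l // lerDr ltW.
have rb : a * b / (a + b) <= b.
  by rewrite ler_pdivrMr // mulrC ler_pM2l // lerDl ltW.
have r0 : 0 < a * b / (a + b) by rewrite divr_gt0 ?mulr_gt0.
exists (a * b / (a + b)) => //; exists M => N.
have := norm_le_radius (ltW r0) (ltW r0) ra rb fM N; apply: le_trans.
rewrite le_eqVlt; apply/orP; left; apply/eqP.
apply: eq_bigr => i _; apply: eq_bigr => j _.
by rewrite expr1n mulr1 normrM -exprD (ger0_norm (exprn_ge0 _ (ltW r0))).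
Qed.

(** The iterates of [h -> g + S h] stabilize at the coefficient [(i, j)] after [wt i j] steps, since
    [S] raises the weight. When [S] halves a weighted norm, their norms stay below the geometric sum
    [2 M]. The weight is the total degree for inverses and the degree in [x] for division. *)
Lemma contraction (wt : nat -> nat -> nat) (S : fps2 -> fps2) g :
  (forall i j, wt i j <= i + j)%N ->
  (forall u v, S (u - v) = S u - S v) ->
  (forall k h, (forall i j, (wt i j < k)%N -> h i j = 0) ->
     forall i j, (wt i j < k.+1)%N -> S h i j = 0) ->
  exists2 q, q = g + S q &
  forall a b M, norm_le a b g M ->
    (forall h L, norm_le a b h L -> norm_le a b (S h) (L / 2)) ->
    norm_le a b q (M + M).
Proof.
move=> wtD SB SF; pose qs k := iter k (fun h => g + S h) g.
(* Stage [i + j] is late enough, because the weight is at most [i + j]. *)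
pose q : fps2 := FPS (fun i => FPS (fun j => qs (i + j)%N i j)).
have step k i j : (wt i j < k.+1)%N -> (qs k.+1 - qs k) i j = 0.
  elim: k i j => [|k IH] i j wk.
    by rewrite /qs /= addrC addKr; apply: (SF 0%N).
  rewrite (_ : qs k.+2 - qs k.+1 = S (qs k.+1 - qs k)); first exact: (SF k.+1).
  by rewrite SB /qs [in LHS]iterS [in X in _ - X = _]iterS opprD addrACA subrr add0r.
have stab k i j : (wt i j <= k)%N -> qs k i j = qs (wt i j) i j.
  elim: k => [|k IH]; first by rewrite leqn0 => /eqP ->.
  rewrite leq_eqVlt => /predU1P[->//|wk].
  by rewrite -IH //; apply/eqP; rewrite -subr_eq0; apply/eqP; apply: step.
have qE k i j : (wt i j <= k)%N -> q i j = qs k i j.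
  by move=> wk; rewrite /= stab // -(stab k).
exists q => [|a b M gM Sh N].
  apply: fps2P => i j.
  rewrite (qE (wt i j).+1) //; rewrite /qs iterS -/(qs _) !fpsDE; congr (_ + _).
  apply/eqP; rewrite -subr_eq0 -fps2BE -SB; apply/eqP.
  apply: (SF (wt i j)) => // k l kl.
  by rewrite fps2BE (qE (wt i j)) ?subrr // ltnW.
have qsM k : norm_le a b (qs k) (M + M).
  elim: k => [|k IH].
    move=> n; apply: le_trans (gM n) _; rewrite lerDl; exact: norm_le_ge0 gM.
  rewrite /qs iterS -/(qs k); apply: norm_leD => //.
  by have := Sh _ _ IH; rewrite (_ : (M + M) / 2 = M) //; field.
apply: le_trans (qsM (N + N)%N N).
rewrite le_eqVlt; apply/orP; left; apply/eqP.
apply: eq_bigr => i _; apply: eq_bigr => j _; congr (`|_ * _| * _).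
by apply: qE; apply: leq_trans (wtD _ _) _; rewrite leq_add // ltnW.
Qed.

Lemma half_ge0 (M c : K) : 0 <= M -> 0 < c -> M / (M + M + c) <= 2^-1.
Proof.
move=> M0 c0; have d0 : 0 < M + M + c by rewrite ltr_wpDl // addr_ge0.
rewrite ler_pdivrMr // mulrC ler_pdivlMr ?ltr0n // mulr_natr mulr2n lerDl.
exact: ltW.
Qed.

(** One has [u = c (1 - w)] with [w] of zero constant term, so the inverse comes from the geometric
    series, a fixed point of [h -> 1 + h w]. *)
Lemma fps2_inv u : u 0%N 0%N != 0 ->
  exists2 v, u * v = 1 & convergent u -> convergent v.
Proof.
move=> u0; pose c := u 0%N 0%N; pose w := 1 - fps2_const c^-1 * u.
have w0 : vanish 1 w.
  apply: vanish1; rewrite /w fps2BE fps2_constME /c mulVf //.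
  by rewrite !fps1E subrr.
have [|k h hk i j|q qE qn] := @contraction (fun i j => i + j)%N (fun h => h * w) 1 (fun _ _ => leqnn _).
- by move=> f g; rewrite mulrBl.
- by move=> ij; apply: (vanishM hk w0); rewrite addn1.
have qw : q * (1 - w) = 1 by rewrite mulrBr mulr1 {1}qE addrK.
exists (fps2_const c^-1 * q) => [|cu].
  by rewrite mulrA mulrC -qw /w opprB addrC subrK [u * _]mulrC.
have cC t : convergent (fps2_const t : fps2) := convergent_const t.
have cq : convergent q.
  have /convergent_norm[a [b [M [a0 b0 wM]]]] : convergent w.
    have := @conv_subring_closed K => -[s1 sB sM].
    by apply/convP; apply: (sB) => //; apply: (sM); apply/convP.
  have M0 := norm_le_ge0 wM.
  (* Multiplying both radii by [e] multiplies the norm of [w] by at most [e], as every term of [w]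
     has positive degree; the new bound [e M] is at most one half. *)
  pose e := (M + M + 1)^-1.
  have d0 : 0 < M + M + 1 by rewrite ltr_wpDl // addr_ge0.
  have e0 : 0 < e by rewrite invr_gt0.
  have e1 : e <= 1 by rewrite invf_le1 // lerDr addr_ge0.
  have weM : norm_le (e * a) (e * b) w (e * M).
    apply: norm_le_coef wM => [|i j]; first exact: ltW.
    case: (posnP (i + j)) => [/eqP|ij].
      by rewrite addn_eq0 => /andP[/eqP-> /eqP->]; rewrite w0 // !mul0r normr0 mulr0.
    have -> : w i j * ((e * a) ^+ i * (e * b) ^+ j) =
      e ^+ (i + j) * (w i j * (a ^+ i * b ^+ j)) by rewrite !exprMn exprD; ring.
    rewrite normrM ler_wpM2r //.
    rewrite ger0_norm ?exprn_ge0 ?(ltW e0) // -(prednK ij) exprS ger_pMr //.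
    by rewrite exprn_ile1 // ltW.
  have oneM : norm_le (e * a) (e * b) 1 1.
    move=> N; rewrite (_ : rescale _ _ 1 = 1) ?pn1 //.
    apply: fps2P => -[|i] [|j] /=; rewrite ?mul0r //.
    by rewrite !expr0 mulr1 mulr1.
  apply/convergent_norm; exists (e * a), (e * b), (1 + 1).
  rewrite !mulr_gt0 //; split=> //; apply: qn => // h L hL N.
  apply: le_trans (norm_leM hL weM N) _.
  rewrite ler_wpM2l ?(norm_le_ge0 hL) // /e mulrC half_ge0 //.
have := @conv_subring_closed K => -[s1 sB sM].
by apply/convP; apply: (sM); apply/convP.
Qed.

Definition yregular n f : Prop := (forall j, (j < n)%N -> f 0%N j = 0) /\ f 0%N n != 0.

Definition ylow n r : Prop := forall i j, (n <= j)%N -> r i j = 0.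

Definition yshift n f : fps2 := FPS (fun i => FPS (fun j => f i (j + n)%N)).

Lemma yshiftB n f g : yshift n (f - g) = yshift n f - yshift n g.
Proof. exact: fps2P. Qed.

Lemma yshift_ylow n f : ylow n (f - fps2_y ^+ n * yshift n f).
Proof.
by move=> i j nj; rewrite fps2BE fps2_yXE ltnNge nj /= subnK // subrr.
Qed.

Lemma norm_yshift a b n f M : 0 < a -> 0 < b -> norm_le a b f M ->
  norm_le a b (yshift n f) (M / b ^+ n).
Proof.
move=> a0 b0 fM N; rewrite ler_pdivlMr ?exprn_gt0 //; apply: le_trans (fM (N + n)%N).
rewrite /partial_norm mulr_suml (big_ord_widen (N + n) (fun i : nat =>
  (\sum_(j < N) `|rescale a b (yshift n f) i j| * 1 ^+ (i + j)) * b ^+ n)) ?leq_addr //.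
rewrite big_mkcond; apply: ler_sum => i _.
have t0 j : 0 <= `|rescale a b f i j| * 1 ^+ (i + j) by rewrite mulr_ge0 ?exprn_ge0.
case: ifP => _; last exact: sumr_ge0.
pose G j := `|rescale a b f i j| * 1 ^+ (i + j).
have -> : \sum_(j < N + n) `|rescale a b f i j| * 1 ^+ (i + j) = \sum_(j < n + N) G j.
  by rewrite -!(big_mkord xpredT G) addnC.
rewrite big_split_ord /= ler_wpDl //; first by apply: sumr_ge0 => j _; apply: t0.
rewrite mulr_suml; apply: ler_sum => j _; rewrite /G /= !expr1n !mulr1 [(n + j)%N]addnC.
have -> : f i (j + n)%N * (a ^+ i * b ^+ (j + n)) =
  f i (j + n)%N * (a ^+ i * b ^+ j) * b ^+ n by rewrite exprD; ring.
by rewrite [leRHS]normrM (ger0_norm (exprn_ge0 n (ltW b0))).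
Qed.

(** Write [f = p + y^n F] with [F] invertible. As [p] is divisible by [x], multiplying by
    [w = p / F] and then taking the quotient by [y^n] raises the degree in [x]; the fixed point [q']
    of the resulting equation gives the quotient [q' / F]. *)
Lemma weierstrass_division n f h : yregular n f ->
  exists q r, [/\ h = q * f + r, ylow n r &
    convergent f -> convergent h -> convergent q /\ convergent r].
Proof.
move=> [f0 fn]; have [|v uv cv] := @fps2_inv (yshift n f); first by [].
pose p := f - fps2_y ^+ n * yshift n f; pose w := p * v.
have w0 i j : (i < 1)%N -> w i j = 0.
  case: i => // _; have p0 i : (i < 1)%N -> p i = 0.
    case: i => // _; apply/fpsP => l; have [ln|nl] := ltnP l n; last exact: yshift_ylow.
    by rewrite /p fps2BE fps2_yXE ln f0 // subr0.
  by rewrite /w (@fps_low_mul _ p v 1 0).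
pose S h := - yshift n (h * w).
have [||k g gk i j ik|q' qE qn] := @contraction (fun i _ => i) S (yshift n h).
- by move=> i j; rewrite leq_addr.
- by move=> g1 g2; rewrite /S mulrBl yshiftB opprB opprK addrC.
- rewrite [S g i j](_ : _ = - ((g * w) i (j + n)%N)) // (_ : (g * w) i = 0) ?fps0E ?oppr0 //.
  apply: (@fps_low_mul _ g w k 1); last by rewrite addn1.
    by move=> l lk; apply/fpsP => m; apply: gk.
  by move=> l l0; apply/fpsP => m; apply: w0.
pose q := q' * v.
have E : h - q * f = h - q' * w - fps2_y ^+ n * q'.
  have fE : f = p + fps2_y ^+ n * yshift n f by rewrite /p subrK.
  rewrite /q /w {1}fE; have -> : q' * v * (p + fps2_y ^+ n * yshift n f) =
    q' * (p * v) + fps2_y ^+ n * q' * (yshift n f * v) by ring.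
  by rewrite uv mulr1 opprD addrA.
exists q, (h - q * f); split=> [|i j nj|cf ch]; first by rewrite addrC subrK.
  rewrite E (_ : h - q' * w - _ = (h - q' * w) - fps2_y ^+ n * yshift n (h - q' * w)).
    exact: yshift_ylow.
  by congr (_ - _ * _); rewrite {1}qE /S yshiftB.
have := @conv_subring_closed K => -[s1 sB sM].
have cM g1 g2 : convergent g1 -> convergent g2 -> convergent (g1 * g2).
  by move=> /convP c1 /convP c2; apply/convP; apply: sM.
have cB g1 g2 : convergent g1 -> convergent g2 -> convergent (g1 - g2).
  by move=> /convP c1 /convP c2; apply/convP; apply: sB.
have cs g : convergent g -> convergent (yshift n g).
  move=> /convergent_norm[a [b [M [a0 b0 gM]]]]; apply/convergent_norm.
  by exists a, b, (M / b ^+ n); split=> //; apply: norm_yshift.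
have cv' := cv (cs _ cf).
have cy m : convergent (fps2_y ^+ m).
  elim: m => [|m IH]; first by rewrite expr0; apply/convP.
  by rewrite exprS; apply: cM IH; apply: convergent_y.
have cw : convergent w by exact: (cM _ _ (cB _ _ cf (cM _ _ (cy n) (cs _ cf))) cv').
suff cq' : convergent q'.
  by have cq : convergent q := cM _ _ cq' cv'; split=> //; exact: (cB _ _ ch (cM _ _ cq cf)).
have /convergent_norm[a1 [b1 [M [a10 b10 wM]]]] := cw.
have /convergent_norm[a2 [b2 [L [a20 b20 hL]]]] := cs _ ch.
pose a := a1 * a2 / (a1 + a2); pose b := b1 * b2 / (b1 + b2).
have a0 : 0 < a by rewrite divr_gt0 ?mulr_gt0 ?addr_gt0.
have b0 : 0 < b by rewrite divr_gt0 ?mulr_gt0 ?addr_gt0.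
have aa1 : a <= a1 by rewrite ler_pdivrMr ?addr_gt0 // ler_pM2l // lerDr ltW.
have bb1 : b <= b1 by rewrite ler_pdivrMr ?addr_gt0 // ler_pM2l // lerDr ltW.
have aa2 : a <= a2.
  by rewrite ler_pdivrMr ?addr_gt0 // mulrC ler_pM2l // lerDl ltW.
have bb2 : b <= b2.
  by rewrite ler_pdivrMr ?addr_gt0 // mulrC ler_pM2l // lerDl ltW.
have {}wM := norm_le_radius (ltW a0) (ltW b0) aa1 bb1 wM.
have {}hL := norm_le_radius (ltW a0) (ltW b0) aa2 bb2 hL.
have M0 := norm_le_ge0 wM; have bn0 : 0 < b ^+ n by rewrite exprn_gt0.
have d0 : 0 < M + M + b ^+ n by rewrite ltr_wpDl // addr_ge0.
(* Only the radius in [x] shrinks: [w] is divisible by [x], so its norm gains the factor [e], while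
   [yshift n] costs [b^-n], which the factor [b^n] in [e] absorbs. *)
pose e := b ^+ n / (M + M + b ^+ n).
have e0 : 0 < e by rewrite divr_gt0.
have e1 : e <= 1 by rewrite ler_pdivrMr // mul1r lerDr addr_ge0.
have ea : e * a <= a by rewrite ler_piMl // ltW.
have {}wM : norm_le (e * a) b w (e * M).
  apply: norm_le_coef wM => [|i j]; first exact: ltW.
  case: i => [|i]; first by rewrite w0 // !mul0r normr0 mulr0.
  have -> : w i.+1 j * ((e * a) ^+ i.+1 * b ^+ j) =
    e ^+ i.+1 * (w i.+1 j * (a ^+ i.+1 * b ^+ j)) by rewrite !exprMn; ring.
  rewrite normrM ler_wpM2r //.
  rewrite ger0_norm ?exprn_ge0 ?(ltW e0) // exprS ger_pMr //.
  by rewrite exprn_ile1 // ltW.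
have ea0 : 0 < e * a by rewrite mulr_gt0.
have {}hL := norm_le_radius (ltW ea0) (ltW b0) ea (lexx _) hL.
apply/convergent_norm; exists (e * a), b, (L + L); split=> //.
apply: qn => // g G gG; rewrite /S; apply: norm_leN.
move=> N; apply: le_trans (norm_yshift n ea0 b0 (norm_leM gG wM) N) _.
rewrite -mulrA ler_wpM2l ?(norm_le_ge0 gG) //.
have -> : e * M / b ^+ n = M / (M + M + b ^+ n).
  by rewrite /e; field; rewrite !gt_eqF.
exact: half_ge0.
Qed.

(** At the lowest power [x^s] present in [q], the product [q f] is the coefficient of [x^s] in [q]
    times [f (0, y)]; its order in [y] is at least [n], so [r] cannot cancel it. *)
Lemma weierstrass_uniq n f q r : yregular n f -> ylow n r ->
  q * f + r = 0 -> q = 0 /\ r = 0.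
Proof.
move=> [f0 fn] rn E; have [q0|q0] := eqVneq q 0.
  by move: E; rewrite q0 mul0r add0r.
exfalso; have [s qs qlow] := fps_order_ex q0.
have [m qm qml] := fps_order_ex qs.
have Es : (q * f) s = q s * f 0%N.
  by rewrite -[s in LHS]addn0 (fps_lead_mul qlow (m := 0)).
have : (q * f) s (m + n)%N != 0.
  by rewrite Es fps_lead_mul // mulf_neq0.
have -> : q * f = - r by apply/eqP; rewrite -subr_eq0 opprK E.
by rewrite !fpsNE rn ?oppr0 ?eqxx // leq_addl.
Qed.

End DoubleSeries.

(** * Convergent series in one variable *)

Section OneVariable.
Variable K : numFieldType.
Local Notation fps2 := (fps (fps K)).

Definition fps2_ofx (a : fps K) : fps2 := FPS (fun i => fps_const (a i)).

Fact fps2_ofx_is_zmod_morphism : zmod_morphism fps2_ofx.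
Proof. by move=> a b; apply/fpsP => i; exact: (raddfB (@fps_const K)). Qed.

Fact fps2_ofx_is_monoid_morphism : monoid_morphism fps2_ofx.
Proof.
split=> [|a b]; apply/fpsP => i.
  rewrite -[LHS]/(fps_const ((i == 0%N)%:R)) fps1E.
  by case: eqP => _; rewrite ?rmorph1 ?rmorph0.
rewrite [RHS]fpsME -[LHS]/(fps_const ((a * b) i)) fpsME raddf_sum.
by apply: eq_bigr => j _; exact: rmorphM.
Qed.

HB.instance Definition _ := GRing.isZmodMorphism.Build (fps K) fps2 fps2_ofx
  fps2_ofx_is_zmod_morphism.
HB.instance Definition _ := GRing.isMonoidMorphism.Build (fps K) fps2 fps2_ofx
  fps2_ofx_is_monoid_morphism.

(** Convergence is that of the series viewed as independent of [y], so that the bounds in two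
    variables apply. *)
Definition conv1_pred : {pred fps K} := fun a => `[< convergent (fps2_ofx a) >].

Lemma conv1P a : reflect (convergent (fps2_ofx a)) (a \in conv1_pred).
Proof. exact: asboolP. Qed.

Fact conv1_subring_closed : subring_closed conv1_pred.
Proof.
have [s1 sB sM] := @conv_subring_closed K.
split=> [|a b /conv1P/convP ca /conv1P/convP cb|a b /conv1P/convP ca /conv1P/convP cb];
  apply/conv1P/convP; rewrite ?rmorph1 // ?rmorphB ?rmorphM; [exact: sB|exact: sM].
Qed.

HB.instance Definition _ := GRing.isSubringClosed.Build (fps K) conv1_pred
  conv1_subring_closed.

End OneVariable.

Record cps1 (K : numFieldType) :=
  CPS1 { cps1_val :> fps K; _ : cps1_val \in @conv1_pred K }.

HB.instance Definition _ (K : numFieldType) := [isSub for @cps1_val K].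
HB.instance Definition _ (K : numFieldType) := [Choice of cps1 K by <:].
HB.instance Definition _ (K : numFieldType) :=
  [SubChoice_isSubComNzRing of cps1 K by <:].

(** * The ring of convergent series and division by the coordinates *)

Section ConvergentTheory.
Variable K : numFieldType.
Local Notation fps2 := (fps (fps K)).
Implicit Types (f g h q r u v w : cps K) (a b c : cps1 K).

Lemma cps_eqP f g : (forall i j, f i j = g i j) -> f = g.
Proof. by move=> fg; apply/val_inj/fps2P. Qed.

Lemma cps1_eqP a b : (forall i, a i = b i) -> a = b.
Proof. by move=> ab; apply/val_inj/fpsP. Qed.

Lemma cps0E i j : (0 : cps K) i j = 0. Proof. by []. Qed.
Lemma cps1E i j : (1 : cps K) i j = ((i == 0%N) && (j == 0%N))%:R.
Proof. by case: i j => [|i] [|j]. Qed.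
Lemma cpsDE f g i j : (f + g) i j = f i j + g i j. Proof. by []. Qed.

Lemma cpsBE f g i j : (f - g) i j = f i j - g i j. Proof. by []. Qed.
Lemma cpsM_val f g : cps_val (f * g) = cps_val f * cps_val g. Proof. by []. Qed.

Lemma cpsX_val f n : cps_val (f ^+ n) = cps_val f ^+ n.
Proof. by elim: n => [|n IH] //; rewrite !exprS cpsM_val IH. Qed.
Lemma cps1M_val a b : cps1_val (a * b) = cps1_val a * cps1_val b. Proof. by []. Qed.
Lemma cps1X_val a n : cps1_val (a ^+ n) = cps1_val a ^+ n.
Proof. by elim: n => [|n IH] //; rewrite !exprS cps1M_val IH. Qed.
Lemma cps_constE t i j : (cps_const t : cps K) i j = if (i == 0%N) && (j == 0%N) then t else 0.
Proof. by case: i j => [|i] [|j]. Qed.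
Lemma cps_constME t f i j : (cps_const t * f) i j = t * f i j.
Proof. exact: fps2_constME. Qed.
Lemma cps_xXE n f i j : (cps_x ^+ n * f) i j = if (i < n)%N then 0 else f (i - n)%N j.
Proof. by rewrite cpsM_val cpsX_val fps2_xXE. Qed.
Lemma cps_yXE n f i j : (cps_y ^+ n * f) i j = if (j < n)%N then 0 else f i (j - n)%N.
Proof. by rewrite cpsM_val cpsX_val fps2_yXE. Qed.
Lemma cps_xyE t i j n m : (cps_const t * (cps_x ^+ i * cps_y ^+ j) : cps K) n m =
  if (n == i) && (m == j) then t else 0.
Proof.
rewrite cps_constME cps_xXE -[cps_y ^+ j]mulr1.
case: ltnP => [ni|ni]; first by rewrite mulr0; case: eqP => // e; lia.
rewrite cps_yXE; case: ltnP => [mj|mj].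
  by rewrite mulr0; case: (m =P j) => [e|_]; rewrite ?andbF //; lia.
rewrite cps1E !subn_eq0 !eqn_leq ni mj !andbT.
by case: ifP => _; rewrite ?mulr1 ?mulr0.
Qed.

Lemma cps_integral f g : f * g = 0 -> f = 0 \/ g = 0.
Proof.
move=> /(congr1 val) /fps2_integral[] fg; [left|right]; exact: val_inj.
Qed.

Lemma cps_mul_neq0 f g : f <> 0 -> g <> 0 -> f * g <> 0.
Proof. by move=> f0 g0 /cps_integral[]. Qed.

Lemma cps_expf_neq0 f n : f <> 0 -> f ^+ n <> 0.
Proof.
move=> f0; elim: n => [|n IH]; first by rewrite expr0; apply/eqP/oner_neq0.
by rewrite exprS; apply: cps_mul_neq0.
Qed.

Lemma cps_mulI f g h : f <> 0 -> f * g = f * h -> g = h.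
Proof.
move=> f0 /eqP; rewrite -subr_eq0 -mulrBr => /eqP /cps_integral[//|/eqP].
by rewrite subr_eq0 => /eqP.
Qed.

Lemma cps_invertible f : invertible f <-> f 0%N 0%N != 0.
Proof.
split=> [[g fg]|f0].
  have := congr1 (fun h : cps K => h 0%N 0%N) fg; rewrite cpsM00 cps1E /=.
  by move=> E; apply: contra_eq_neq E => ->; rewrite mulr0 oner_neq0.
have [v fv cv] := fps2_inv f0.
by exists (cps_of (cv (cpsP f))); apply: val_inj; rewrite /= -fv mulrC.
Qed.

Lemma cps_weierstrass n f h : yregular n f ->
  exists q r, h = q * f + r /\ ylow n r.
Proof.
move=> fn; have [q [r [E rn cv]]] := weierstrass_division h fn.
have [cq cr] := cv (cpsP f) (cpsP h).
by exists (cps_of cq), (cps_of cr); split=> //; apply: val_inj.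
Qed.

Lemma cps_weierstrass_uniq n f q r : yregular n f -> ylow n r ->
  q * f + r = 0 -> q = 0 /\ r = 0.
Proof.
move=> fn rn /(congr1 val) /(weierstrass_uniq fn rn)[q0 r0].
by split; apply: val_inj.
Qed.

Definition cps_ofx a : cps K := cps_of (elimT (conv1P a) (valP a)).

Fact cps_ofx_is_zmod_morphism : zmod_morphism cps_ofx.
Proof. by move=> a b; apply: val_inj; rewrite /= raddfB. Qed.
Fact cps_ofx_is_monoid_morphism : monoid_morphism cps_ofx.
Proof. by split=> [|a b]; apply: val_inj; rewrite /= ?rmorph1 ?rmorphM. Qed.

HB.instance Definition _ := GRing.isZmodMorphism.Build (cps1 K) (cps K) cps_ofx
  cps_ofx_is_zmod_morphism.
HB.instance Definition _ := GRing.isMonoidMorphism.Build (cps1 K) (cps K) cps_ofx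
  cps_ofx_is_monoid_morphism.

Lemma cps_ofxE a i j : cps_ofx a i j = if j == 0%N then a i else 0.
Proof. by []. Qed.

Fact conv1_const t : fps_const t \in @conv1_pred K.
Proof.
apply/conv1P; rewrite (_ : fps2_ofx _ = fps2_const t); first exact: convergent_const.
by apply: fps2P => -[|i] [|j].
Qed.
Definition cps1_const (t : K) : cps1 K := CPS1 (conv1_const t).

Fact conv1_var : fps_var K \in @conv1_pred K.
Proof.
apply/conv1P; rewrite (_ : fps2_ofx _ = fps_var _); first exact: convergent_x.
by apply: fps2P => -[|[|i]] [|j].
Qed.
Definition cps1_t : cps1 K := CPS1 conv1_var.

Fact conv1_col j h : FPS (fun i => h i j) \in @conv1_pred K.
Proof.
have /convergent_norm[A [B [M [A0 B0 hM]]]] := cpsP h.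
apply/conv1P/convergent_norm; exists A, B, (1 * (M / B ^+ j)); split=> //.
apply: norm_le_coef (norm_yshift j A0 B0 hM) => // i [|l]; rewrite mul1r //.
by rewrite /= mul0r normr0.
Qed.
Definition cps_col j h : cps1 K := CPS1 (conv1_col j h).

Fact cps1_const_is_zmod_morphism : zmod_morphism cps1_const.
Proof. by move=> s t; apply: val_inj; rewrite /= raddfB. Qed.
Fact cps1_const_is_monoid_morphism : monoid_morphism cps1_const.
Proof. by split=> [|s t]; apply: val_inj; rewrite /= ?rmorph1 ?rmorphM. Qed.

HB.instance Definition _ := GRing.isZmodMorphism.Build K (cps1 K) cps1_const
  cps1_const_is_zmod_morphism.
HB.instance Definition _ := GRing.isMonoidMorphism.Build K (cps1 K) cps1_const
  cps1_const_is_monoid_morphism.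

Definition cps1_scale (t : K) a : cps1 K := cps1_const t * a.

Fact cps1_scaleA s t a : cps1_scale s (cps1_scale t a) = cps1_scale (s * t) a.
Proof. by rewrite /cps1_scale mulrA rmorphM. Qed.
Fact cps1_scale1 : left_id 1 cps1_scale.
Proof. by move=> a; rewrite /cps1_scale rmorph1 mul1r. Qed.
Fact cps1_scaleDr : right_distributive cps1_scale +%R.
Proof. by move=> t a b; rewrite /cps1_scale mulrDr. Qed.
Fact cps1_scaleDl a : {morph cps1_scale^~ a : s t / s + t}.
Proof. by move=> s t; rewrite /cps1_scale rmorphD mulrDl. Qed.

HB.instance Definition _ := GRing.Zmodule_isLmodule.Build K (cps1 K)
  cps1_scaleA cps1_scale1 cps1_scaleDr cps1_scaleDl.

Lemma cps_sumE (I : Type) (s : seq I) (P : pred I) (F : I -> cps K) i j :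
  (\sum_(k <- s | P k) F k) i j = \sum_(k <- s | P k) F k i j.
Proof. by elim/big_rec2: _ => //= k _ y _ <-. Qed.

Lemma ylow_decomp n r : ylow n r ->
  r = \sum_(j < n) cps_ofx (cps_col j r) * cps_y ^+ j.
Proof.
move=> rn; apply: cps_eqP => i j.
rewrite cps_sumE; under eq_bigr do rewrite mulrC cps_yXE cps_ofxE.
have [nj|jn] := leqP n j.
  rewrite rn // big1 // => k _; case: ltnP => // kj.
  by rewrite subn_eq0 leqNgt (leq_trans (ltn_ord k) nj).
rewrite (bigD1 (Ordinal jn)) //= ltnn subnn eqxx big1 ?addr0 // => k.
rewrite -val_eqE /= => kj; case: ltnP => // jk; rewrite subn_eq0.
by rewrite leqNgt ltn_neqAle kj jk.
Qed.

Fact convergent_swap h : convergent (FPS (fun i => FPS (fun j => h j i))).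
Proof.
have [r r0 [M hM]] := cpsP h; exists r => //; exists M => N.
apply: le_trans (hM N); rewrite le_eqVlt; apply/orP; left; apply/eqP.
rewrite /partial_norm exchange_big; apply: eq_bigr => i _; apply: eq_bigr => j _.
by rewrite /= addnC.
Qed.

Definition cps_swap h : cps K := cps_of (convergent_swap h).

Lemma cps_swapE h i j : cps_swap h i j = h j i. Proof. by []. Qed.

Lemma cps_swapK : involutive cps_swap.
Proof. by move=> h; apply: cps_eqP. Qed.

Fact cps_swap_is_zmod_morphism : zmod_morphism cps_swap.
Proof. by move=> f g; apply: cps_eqP. Qed.
Fact cps_swap_is_monoid_morphism : monoid_morphism cps_swap.
Proof.
split=> [|f g]; apply: cps_eqP => i j; rewrite cps_swapE.
  by rewrite !cps1E andbC.
rewrite !cpsM_val !fps2ME exchange_big; by apply: eq_bigr => p _.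
Qed.

HB.instance Definition _ := GRing.isZmodMorphism.Build (cps K) (cps K) cps_swap
  cps_swap_is_zmod_morphism.
HB.instance Definition _ := GRing.isMonoidMorphism.Build (cps K) (cps K) cps_swap
  cps_swap_is_monoid_morphism.

Lemma cps_swap_x : cps_swap cps_x = cps_y.
Proof. by apply: cps_eqP => -[|i] [|[|j]]. Qed.

Lemma cps_swap_y : cps_swap cps_y = cps_x.
Proof. by rewrite -cps_swap_x cps_swapK. Qed.

Lemma cps_swap_const t : cps_swap (cps_const t) = cps_const t.
Proof. by apply: cps_eqP => -[|i] [|j]. Qed.

Lemma yregular_y : @yregular K 1 (cps_y : cps K).
Proof. by split=> [[]|] //; exact: oner_neq0. Qed.

(** Convergence of the quotient is free when the division by [y] is a Weierstrass division. *)
Lemma cps_divy h : (forall i, h i 0%N = 0) -> exists g, h = cps_y * g.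
Proof.
move=> h0; have [q [r [E rl]]] := cps_weierstrass h yregular_y.
exists q; rewrite E mulrC; suff -> : r = 0 by rewrite addr0.
apply: cps_eqP => i [|j]; last by rewrite rl.
by have := h0 i; rewrite E cpsDE mulrC -[cps_y]expr1 cps_yXE /= add0r.
Qed.

Lemma cps_divx h : (forall j, h 0%N j = 0) -> exists g, h = cps_x * g.
Proof.
move=> h0; have [|g E] := @cps_divy (cps_swap h); first by move=> i; rewrite cps_swapE.
by exists (cps_swap g); rewrite -(cps_swapK h) E rmorphM /= cps_swap_y.
Qed.

Lemma cps_divxX n h : (forall i j, (i < n)%N -> h i j = 0) ->
  exists g, h = cps_x ^+ n * g.
Proof.
elim: n h => [|n IH] h h0; first by exists h; rewrite expr0 mul1r.
have [|g hg] := @cps_divx h; first by move=> j; apply: h0.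
have [|g' gg'] := IH g; last by exists g'; rewrite exprS -mulrA -gg'.
move=> i j ni; have := h0 i.+1 j ni.
by rewrite hg -[cps_x]expr1 cps_xXE /= subn1.
Qed.

(** An element of order at least [N + 1] is [x f + y g] with convergent [f] and [g] of order at
    least [N], which allows induction along the powers of the maximal ideal. *)
Lemma vanish_ind (P : nat -> cps K -> Prop) : (forall h, P 0%N h) ->
  (forall N f g, P N f -> P N g -> P N.+1 (cps_x * f + cps_y * g)) ->
  forall N h, vanish N h -> P N h.
Proof.
move=> P0 PS; elim=> [|N IH] h hN; first exact: P0.
have [q [r [E rl]]] := cps_weierstrass h yregular_y.
have hE i j : h i j.+1 = q i j.
  rewrite E cpsDE rl // addr0 mulrC -[cps_y]expr1 cps_yXE /= subn1 //.
have hE0 i : h i 0%N = r i 0%N.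
  by rewrite E cpsDE mulrC -[cps_y]expr1 cps_yXE /= add0r.
have [[|j]|g rg] := @cps_divx r; first by rewrite -hE0 hN.
  by rewrite rl.
rewrite E addrC rg [q * _]mulrC; apply: PS; apply: IH => i j ij; last first.
  by rewrite -hE hN // addnS.
have -> : g i j = r i.+1 j by rewrite rg -[cps_x]expr1 cps_xXE /= subn1.
by case: j ij => [|j] ij; [rewrite -hE0 hN|rewrite rl].
Qed.

Definition cps_trunc N h : cps K :=
  \sum_(i < N) \sum_(j < N) cps_const (h i j) * (cps_x ^+ i * cps_y ^+ j).

Lemma cps_truncE N h n m :
  cps_trunc N h n m = if (n < N)%N && (m < N)%N then h n m else 0.
Proof.
rewrite cps_sumE; under eq_bigr do rewrite cps_sumE.
under eq_bigr do under eq_bigr do rewrite cps_xyE.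
have [nN|nN] /= := ltnP n N; last first.
  rewrite big1 // => i _; rewrite big1 // => j _.
  by have -> : (n == i) = false; [apply/negP => /eqP e; move: (ltn_ord i); lia|].
rewrite (bigD1 (Ordinal nN)) //= [X in _ + X]big1 ?addr0; last first.
  move=> i; rewrite -val_eqE eq_sym /= => ni; rewrite big1 // => j _.
  by rewrite (negPf ni).
rewrite eqxx /=; have [mN|mN] := ltnP m N; last first.
  rewrite big1 // => j _.
  by have -> : (m == j) = false; [apply/negP => /eqP e; move: (ltn_ord j); lia|].
rewrite (bigD1 (Ordinal mN)) //= [X in _ + X]big1 ?addr0 ?eqxx // => j.
by rewrite -val_eqE eq_sym /= => /negPf ->.
Qed.

Lemma cps_trunc_vanish N h : vanish N (h - cps_trunc N h : cps K).
Proof.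
move=> i j ij; rewrite cpsBE cps_truncE.
by rewrite !(leq_ltn_trans _ ij) ?leq_addl ?leq_addr ?subrr.
Qed.

End ConvergentTheory.
Arguments cps1_t {K}.

(** * Substitutions and initial forms *)

Section Composition.
Variable K : numFieldType.
Local Notation R := (cps K).
Implicit Types (f g h u v : cps K).

(** Density of polynomials: truncation leaves a remainder of high order, which both maps send to
    high order. The loss of one order accommodates derivations. *)
Lemma vanish_ext1 (S T : R -> R) : zmod_morphism S -> zmod_morphism T ->
  (forall k f, vanish k.+1 f -> vanish k (S f)) ->
  (forall k f, vanish k.+1 f -> vanish k (T f)) ->
  (forall t i j, S (cps_const t * (cps_x ^+ i * cps_y ^+ j)) =
                 T (cps_const t * (cps_x ^+ i * cps_y ^+ j))) -> S =1 T.
Proof.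
move=> Sm Tm Sv Tv ST f.
pose sM := GRing.isZmodMorphism.Build _ _ S Sm.
pose tM := GRing.isZmodMorphism.Build _ _ T Tm.
pose s : {additive R -> R} := HB.pack S sM.
pose t : {additive R -> R} := HB.pack T tM.
rewrite -[S]/(s : R -> R) -[T]/(t : R -> R); apply/eqP; rewrite -subr_eq0; apply/eqP.
apply: val_inj; apply: vanish_eq0 => k.
have E : s (cps_trunc k.+1 f) = t (cps_trunc k.+1 f).
  rewrite /cps_trunc !raddf_sum; apply: eq_bigr => i _.
  by rewrite !raddf_sum; apply: eq_bigr => j _; exact: ST.
have -> : s f - t f = s (f - cps_trunc k.+1 f) - t (f - cps_trunc k.+1 f).
  by rewrite (raddfB s) (raddfB t) E; ring.
by apply: vanishD; [|apply: vanishN]; [apply: Sv|apply: Tv]; apply: cps_trunc_vanish.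
Qed.

Lemma vanish_ext (S T : R -> R) : zmod_morphism S -> zmod_morphism T ->
  (forall k f, vanish k f -> vanish k (S f)) ->
  (forall k f, vanish k f -> vanish k (T f)) ->
  (forall t i j, S (cps_const t * (cps_x ^+ i * cps_y ^+ j)) =
                 T (cps_const t * (cps_x ^+ i * cps_y ^+ j))) -> S =1 T.
Proof.
move=> Sm Tm Sv Tv; apply: vanish_ext1 => // k f fk.
  exact/(vanish_le (leqnSn k))/Sv.
exact/(vanish_le (leqnSn k))/Tv.
Qed.

Section Comp.
Variables (u v : R) (u0 : u 0%N 0%N = 0) (v0 : v 0%N 0%N = 0).

Let vanish_mono i j : vanish (i + j) (u ^+ i * v ^+ j : R).
Proof.
have vX (w : R) n : w 0%N 0%N = 0 -> vanish n (w ^+ n : R).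
  by move=> w0; rewrite cpsX_val -[n in vanish n]muln1; apply/vanishX/vanish1.
by apply: vanishM; apply: vX.
Qed.

Lemma cps_compE f n m : cps_comp u0 v0 f n m =
  \sum_(i < (n + m).+1) \sum_(j < (n + m).+1) f i j * (u ^+ i * v ^+ j : R) n m.
Proof.
rewrite /= !fps_sumE; apply: eq_bigr => i _; rewrite !fps_sumE; apply: eq_bigr => j _.
by rewrite -mulrA fps2_constME -!cpsX_val.
Qed.

Lemma cps_comp_vanish k f : vanish k f -> vanish k (cps_comp u0 v0 f).
Proof.
move=> fk n m nm; rewrite cps_compE big1 // => i _; rewrite big1 // => j _.
have [ij|ij] := ltnP (i + j) k; first by rewrite fk ?mul0r.
by rewrite vanish_mono ?mulr0 // (leq_trans nm).
Qed.

Fact cps_comp_is_zmod_morphism : zmod_morphism (cps_comp u0 v0).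
Proof.
move=> f g; apply: cps_eqP => n m; apply: etrans (cps_compE _ n m) _.
apply: etrans _ (esym (congr2 (fun a b : K => a - b) (cps_compE f n m) (cps_compE g n m))).
rewrite -sumrB.
apply: eq_bigr => i _; rewrite -sumrB; apply: eq_bigr => j _.
by rewrite cpsBE mulrBl.
Qed.

HB.instance Definition _ := GRing.isZmodMorphism.Build R R (cps_comp u0 v0)
  cps_comp_is_zmod_morphism.

Lemma cps_comp_mono t i j : cps_comp u0 v0 (cps_const t * (cps_x ^+ i * cps_y ^+ j)) =
  cps_const t * (u ^+ i * v ^+ j).
Proof.
apply: cps_eqP => n m; rewrite cps_compE cps_constME.
under eq_bigr do under eq_bigr do rewrite cps_xyE.
have [ijN|ijN] := boolP ((i < (n + m).+1) && (j < (n + m).+1))%N.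
  case/andP: ijN => iN jN.
  rewrite (bigD1 (Ordinal iN)) //= (bigD1 (Ordinal jN)) //= !eqxx /=.
  rewrite [X in _ + X + _]big1 ?[X in _ + _ + X]big1 ?addr0 // => k.
    by rewrite -val_eqE /= => /negPf ki; rewrite big1 // => l _; rewrite ki mul0r.
  by rewrite -val_eqE /= => /negPf ->; rewrite mul0r.
rewrite big1 => [|k _]; last first.
  rewrite big1 // => l _; case: ifP => [/andP[/eqP kE /eqP lE]|_]; last by rewrite mul0r.
  by case/negP: ijN; rewrite -kE -lE !ltn_ord.
rewrite vanish_mono ?mulr0 //; move: ijN; rewrite negb_and -!leqNgt; lia.
Qed.

(** Multiplicativity is extended from monomials by density, in one argument at a time. *)
Fact cps_comp_is_monoid_morphism : monoid_morphism (cps_comp u0 v0).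
Proof.
have monoM t i j s k l : cps_const t * (cps_x ^+ i * cps_y ^+ j) *
    (cps_const s * (cps_x ^+ k * cps_y ^+ l)) =
    cps_const (t * s) * (cps_x ^+ (i + k) * cps_y ^+ (j + l)) :> R.
  by rewrite rmorphM !exprD; ring.
have compM1 t i j g : cps_comp u0 v0 (cps_const t * (cps_x ^+ i * cps_y ^+ j) * g) =
    cps_const t * (u ^+ i * v ^+ j) * cps_comp u0 v0 g.
  move: g; apply: vanish_ext.
  - by move=> f g; rewrite mulrBr raddfB.
  - by move=> f g; rewrite raddfB mulrBr.
  - by move=> k f fk; apply: cps_comp_vanish; apply: vanishMl.
  - by move=> k f fk; apply: vanishMl; apply: cps_comp_vanish.
  - move=> s k l; rewrite monoM !cps_comp_mono rmorphM !exprD; ring.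
split=> [|f g].
  by have := cps_comp_mono 1 0 0; rewrite !expr0 !mulr1 rmorph1.
move: f; apply: vanish_ext.
- by move=> f f'; rewrite mulrBl raddfB.
- by move=> f f'; rewrite raddfB mulrBl.
- by move=> k f fk; apply: cps_comp_vanish; rewrite mulrC; apply: vanishMl.
- by move=> k f fk; rewrite mulrC; apply: vanishMl; apply: cps_comp_vanish.
- by move=> s k l; rewrite compM1 cps_comp_mono.
Qed.

HB.instance Definition _ := GRing.isMonoidMorphism.Build R R (cps_comp u0 v0)
  cps_comp_is_monoid_morphism.

Lemma cps_comp_const t : cps_comp u0 v0 (cps_const t) = cps_const t.
Proof. by have := cps_comp_mono t 0 0; rewrite !expr0 !mulr1. Qed.

Lemma cps_comp_x : cps_comp u0 v0 cps_x = u.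
Proof. by have := cps_comp_mono 1 1 0; rewrite !rmorph1 !mulr1 !mul1r !expr1. Qed.

Lemma cps_comp_y : cps_comp u0 v0 cps_y = v.
Proof. by have := cps_comp_mono 1 0 1; rewrite !rmorph1 !mul1r !expr1. Qed.

End Comp.

Lemma cps_swap_vanish k f : vanish k f -> vanish k (cps_swap f).
Proof. by move=> fk i j ij; rewrite cps_swapE fk // addnC. Qed.

Definition pb c : R -> R := cps_comp (chart1_origin (K := K) c) (chart2_origin c).
HB.instance Definition _ c := GRing.RMorphism.on (pb c).

Lemma pullback1E f c : pullback1 f c = pb c f. Proof. by []. Qed.

Lemma pb_const c t : pb c (cps_const t) = cps_const t.
Proof. exact: cps_comp_const. Qed.
Lemma pb_x c : pb c cps_x = (chart c).1. Proof. exact: cps_comp_x. Qed.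

Lemma pb_None f : pb None f = cps_swap (pb (Some 0) (cps_swap f)).
Proof.
move: f; apply: vanish_ext.
- exact: raddfB.
- by move=> f g; rewrite !raddfB.
- exact: cps_comp_vanish.
- by move=> k f fk; apply/cps_swap_vanish/cps_comp_vanish/cps_swap_vanish.
- move=> t i j; rewrite /pb cps_comp_mono !rmorphM !rmorphXn /=.
  rewrite cps_swap_x cps_swap_y cps_swap_const cps_comp_const cps_comp_x cps_comp_y.
  rewrite /= rmorphM rmorphD /= cps_swap_x cps_swap_y !cps_swap_const rmorph0 addr0.
  by rewrite !exprMn_comm; [ring|apply: mulrC|apply: mulrC].
Qed.

Definition ypoly (p : {poly K}) : R := (map_poly (@cps_const K) p).[cps_y].

Fact ypoly_is_zmod_morphism : zmod_morphism ypoly.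
Proof. by move=> p q; rewrite /ypoly rmorphB hornerD hornerN. Qed.
Fact ypoly_is_monoid_morphism : monoid_morphism ypoly.
Proof. by split=> [|p q]; rewrite /ypoly ?rmorph1 ?hornerC // rmorphM hornerM. Qed.
HB.instance Definition _ := GRing.isZmodMorphism.Build {poly K} R ypoly
  ypoly_is_zmod_morphism.
HB.instance Definition _ := GRing.isMonoidMorphism.Build {poly K} R ypoly
  ypoly_is_monoid_morphism.

Lemma ypolyX : ypoly 'X = cps_y. Proof. by rewrite /ypoly map_polyX hornerX. Qed.
Lemma ypolyC t : ypoly t%:P = cps_const t. Proof. by rewrite /ypoly map_polyC hornerC. Qed.

Lemma ypolyE p i j : ypoly p i j = if i == 0%N then p`_j else 0.
Proof.
elim/poly_ind: p i j => [|p t IH] i j; first by rewrite raddf0 coef0 cps0E; case: ifP.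
have -> : ypoly (p * 'X + t%:P) = ypoly p * cps_y + cps_const t.
  by rewrite rmorphD rmorphM /= ypolyX ypolyC.
rewrite cpsDE mulrC -[cps_y]expr1 cps_yXE IH cps_constE.
rewrite coefD coefMX coefC; case: (i == 0%N); case: j => [|j] //=; rewrite ?subn1 ?addr0 //.
Qed.

(* The homogeneous component of degree [n] of [h], evaluated at [(1, Y)]. *)
Definition hform n h : {poly K} := \poly_(j < n.+1) h (n - j)%N j.

(** A monomial of degree [n] acquires exactly the factor [x^n] under [y := x (y + a)], so the powers
    of [x] on the blowup separate the homogeneous components. *)
Lemma pbE a f n m : pb (Some a) f n m = (hform n f \Po ('X + a%:P))`_m.
Proof.
rewrite cps_compE exchange_big /=.
have term i j : (cps_x ^+ i * (cps_x * (cps_y + cps_const a)) ^+ j : R) n m =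
    if (n == i + j)%N then (('X + a%:P) ^+ j)`_m else 0.
  rewrite exprMn_comm; last exact: mulrC.
  rewrite mulrA -exprD -ypolyX -ypolyC -rmorphD -rmorphXn cps_xXE /= ypolyE.
  case: ltnP => nij; first by case: eqP => // e; lia.
  by rewrite subn_eq0 eqn_leq nij andbT.
under eq_bigr do under eq_bigr do rewrite term.
have -> : (hform n f \Po ('X + a%:P))`_m =
    \sum_(j < (n + m).+1) (if (j < n.+1)%N then f (n - j)%N j * (('X + a%:P) ^+ j)`_m else 0).
  rewrite -big_mkcond /= -(big_ord_widen _ (fun j => f (n - j)%N j * (('X + a%:P) ^+ j)`_m)).
    rewrite /hform poly_def linear_sum /= coef_sum; apply: eq_bigr => j _.
    by rewrite linearZ /= comp_Xn_poly coefZ.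
  by rewrite ltnS leq_addr.
apply: eq_bigr => j _; rewrite ltnS; case: leqP => jn; last first.
  by rewrite big1 // => i _; case: eqP => [e|_]; [lia|rewrite mulr0].
have iN : (n - j < (n + m).+1)%N by lia.
rewrite (bigD1 (Ordinal iN)) //= subnK // eqxx big1 ?addr0 // => i.
by rewrite -val_eqE /= => ij; case: eqP => [e|_]; [lia|rewrite mulr0].
Qed.

Lemma hform_coef n h j : (hform n h)`_j = if (j <= n)%N then h (n - j)%N j else 0.
Proof. by rewrite coef_poly ltnS. Qed.

Lemma hform_eq0 k h : vanish k h -> forall n, (n < k)%N -> hform n h = 0.
Proof.
move=> hk n nk; apply/polyP => j; rewrite hform_coef coef0; case: leqP => // jn.
by rewrite hk // subnK.
Qed.

Lemma vanishS k h : vanish k h -> hform k h = 0 -> vanish k.+1 h.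
Proof.
move=> hk h0 i j; rewrite ltnS leq_eqVlt => /predU1P[ij|]; last exact: hk.
by have /polyP/(_ j) := h0; rewrite hform_coef coef0 -ij leq_addl addnK.
Qed.

Lemma hformB n f g : hform n (f - g : R) = hform n f - hform n g.
Proof.
apply/polyP => j; rewrite coefB !hform_coef; case: leqP => //; by rewrite subr0.
Qed.

Lemma hform_lead k l f g : vanish k f -> vanish l g ->
  hform (k + l) (f * g : R) = hform k f * hform l g.
Proof.
move=> fk gl; apply/polyP => j; rewrite hform_coef coefM cpsM_val fps2ME.
have [jkl|jkl] := leqP j (k + l); last first.
  rewrite big1 // => -[i /= ij] _; rewrite !hform_coef.
  case: leqP => [ik|]; last by rewrite mul0r.
  by case: leqP => [il|]; [lia|rewrite mulr0].
rewrite exchange_big; apply: eq_bigr => -[q /= qj] _; rewrite !hform_coef.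
have Z p : (p <= k + l - j)%N -> p != (k - q)%N ->
    f p q * g (k + l - j - p)%N (j - q)%N = 0.
  move=> pn pk; have [pq|pq] := ltnP (p + q) k; first by rewrite fk ?mul0r.
  by rewrite gl ?mulr0 //; lia.
case: leqP => qk; last first.
  rewrite mul0r big1 // => -[p /= pn] _; have [pq|pq] := ltnP (p + q) k; first by rewrite fk ?mul0r.
  by rewrite gl ?mulr0 //; lia.
case: leqP => jql; last first.
  rewrite mulr0 big1 // => -[p /= pn] _; apply: Z => //; lia.
have pN : (k - q < (k + l - j).+1)%N by lia.
rewrite (bigD1 (Ordinal pN)) //= big1 ?addr0 => [|[p /= pn]]; last first.
  by rewrite -val_eqE /= => /Z; apply.
by congr (_ * g _ _); lia.
Qed.

End Composition.

(** * Derivations and the chain rule *)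

Section Derivations.

Definition fps_der (T : comNzRingType) (a : fps T) : fps T := FPS (fun i => a i.+1 *+ i.+1).

Lemma fps_derB (T : comNzRingType) (a b : fps T) : fps_der (a - b) = fps_der a - fps_der b.
Proof. by apply/fpsP => i; rewrite fpsDE fpsNE /= -mulNrn -mulrnDl. Qed.

Lemma fps_derM (T : comNzRingType) (a b : fps T) :
  fps_der (a * b) = fps_der a * b + a * fps_der b.
Proof.
apply/fpsP => n; rewrite fpsDE [LHS](_ : _ = (a * b) n.+1 *+ n.+1) // !fpsME -sumrMnl.
have -> : \sum_(i < n.+2) a i * b (n.+1 - i)%N *+ n.+1 =
    \sum_(i < n.+2) a i * b (n.+1 - i)%N *+ i +
    \sum_(i < n.+2) a i * b (n.+1 - i)%N *+ (n.+1 - i)%N.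
  rewrite -big_split; apply: eq_bigr => i _ /=; rewrite -mulrnDr subnKC //.
  by rewrite -ltnS.
congr (_ + _).
  rewrite big_ord_recl mulr0n add0r; apply: eq_bigr => i _.
  by rewrite /= /bump /= add1n subSS mulrnAl.
rewrite big_ord_recr /= subnn mulr0n addr0; apply: eq_bigr => i _.
have -> : (n.+1 - i = (n - i).+1)%N by rewrite subSn // -ltnS.
by rewrite mulrnAr.
Qed.

Lemma fps_der_const (T : comNzRingType) (t : T) : fps_der (fps_const t) = 0.
Proof. by apply/fpsP => i; rewrite fps0E /= mul0rn. Qed.

Variable K : numFieldType.
Local Notation R := (cps K).
Implicit Types (f g h : cps K).

Lemma cps_dx_val f : cps_val (cps_dx f) = fps_der (cps_val f).
Proof.
have E (a : fps K) n j : (a *+ n) j = a j *+ n.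
  by elim: n => [|n IH]; rewrite ?mulr0n // !mulrSr fpsDE IH.
by apply: fps2P => i j; rewrite /= E.
Qed.

Lemma cps_dxB f g : cps_dx (f - g) = cps_dx f - cps_dx g.
Proof.
apply: val_inj; rewrite [LHS]cps_dx_val [RHS](_ : _ = cps_val (cps_dx f) - cps_val (cps_dx g)) //.
by rewrite !cps_dx_val -fps_derB.
Qed.

Lemma cps_dxM f g : cps_dx (f * g) = cps_dx f * g + f * cps_dx g.
Proof.
apply: val_inj; rewrite [LHS]cps_dx_val.
rewrite [RHS](_ : _ = cps_val (cps_dx f) * cps_val g + cps_val f * cps_val (cps_dx g)) //.
by rewrite !cps_dx_val -fps_derM.
Qed.

Lemma cps_dy_swap f : cps_dy f = cps_swap (cps_dx (cps_swap f)).
Proof. exact: cps_eqP. Qed.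

Lemma cps_dx_swap f : cps_dx (cps_swap f) = cps_swap (cps_dy f).
Proof. exact: cps_eqP. Qed.

Lemma cps_dy_swap' f : cps_dy (cps_swap f) = cps_swap (cps_dx f).
Proof. exact: cps_eqP. Qed.

Lemma cps_dyB f g : cps_dy (f - g) = cps_dy f - cps_dy g.
Proof. by rewrite !cps_dy_swap raddfB cps_dxB raddfB. Qed.

Lemma cps_dyM f g : cps_dy (f * g) = cps_dy f * g + f * cps_dy g.
Proof. by rewrite !cps_dy_swap rmorphM cps_dxM rmorphD !rmorphM /= !cps_swapK. Qed.

Lemma cps_dx_const t : cps_dx (cps_const t : R) = 0.
Proof. by apply: cps_eqP => i j; rewrite [LHS]/= mul0rn. Qed.
Lemma cps_dy_const t : cps_dy (cps_const t : R) = 0.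
Proof. by apply: cps_eqP => -[|i] j; rewrite [LHS]/= mul0rn. Qed.
Lemma cps_dx_x : cps_dx (cps_x : R) = 1.
Proof. by apply: cps_eqP => -[|i] [|j]; rewrite cps1E [LHS]/= ?mul0rn. Qed.
Lemma cps_dx_y : cps_dx (cps_y : R) = 0.
Proof. by apply: cps_eqP => i j; rewrite [LHS]/= mul0rn. Qed.
Lemma cps_dy_x : cps_dy (cps_x : R) = 0.
Proof. by apply: cps_eqP => -[|[|i]] j; rewrite [LHS]/= mul0rn. Qed.
Lemma cps_dy_y : cps_dy (cps_y : R) = 1.
Proof. by rewrite cps_dy_swap cps_swap_y cps_dx_x rmorph1. Qed.

Lemma cps_dy_xX n f : cps_dy (cps_x ^+ n * f) = cps_x ^+ n * cps_dy f.
Proof.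
elim: n f => [|n IH] f; first by rewrite expr0 !mul1r.
by rewrite exprS -!mulrA cps_dyM cps_dy_x mul0r add0r IH.
Qed.

(** The chain rule for [(x, x (y + a))]. This factor [x] is what lowers the exponent of the
    exceptional curve from [e] to [e - 1] in [resolved_blowup]. *)
Lemma cps_dy_pb a f : cps_dy (pb (Some a) f) = cps_x * pb (Some a) (cps_dy f).
Proof.
apply: cps_eqP => n m; rewrite -[cps_x]expr1 cps_xXE.
rewrite -[LHS]/(pb (Some a) f n m.+1 *+ m.+1) pbE -coef_deriv deriv_comp derivD derivX derivC.
rewrite addr0 mulr1; case: n => [|n].
  rewrite (_ : (hform 0 f)^`() = 0) ?comp_poly0 ?coef0 //.
  by apply/polyP => j; rewrite coef_deriv hform_coef coef0 mul0rn.
rewrite (_ : (n.+1 < 1)%N = false) // subn1 -[n.+1.-1]/n pbE; congr (_ \Po _)`_m; apply/polyP => j.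
by rewrite coef_deriv !hform_coef ltnS; case: ifP => _; rewrite ?mul0rn // subSS.
Qed.

(** If [phi h] had a nonzero constant term [c], then [h - c] would be invertible, while its image
    has zero constant term. *)
Lemma morph_local (phi : {rmorphism R -> fps K}) :
  (forall t, phi (cps_const t) = fps_const t) ->
  forall h, h 0%N 0%N = 0 -> phi h 0%N = 0.
Proof.
move=> phiC h h0; apply/eqP; apply: contraT => p0.
have /cps_invertible[g E] : (h - cps_const (phi h 0%N)) 0%N 0%N != 0.
  by rewrite cpsBE h0 sub0r oppr_eq0.
have := congr1 (fun a : fps K => a 0%N) (congr1 phi E).
rewrite rmorph1 rmorphM rmorphB phiC fpsME big_ord1 fpsDE fpsNE /= subrr mulr0.
by move/eqP; rewrite oner_eq0.
Qed.

Lemma fps_ge_eq0 (a : fps K) : (forall N i, (i < N)%N -> a i = 0) -> a = 0.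
Proof. by move=> a0; apply/fpsP => i; apply: (a0 i.+1). Qed.

(** The defect [D] of the formula is a derivation along [phi] which vanishes on constants, [x] and
    [y], hence on polynomials. As [phi] is local, [D] sends elements of order at least [N] to series
    of order at least [N], and so is zero. *)
Lemma chain_rule (phi : {rmorphism R -> fps K}) :
  (forall t, phi (cps_const t) = fps_const t) -> forall h,
  fps_der (phi h) = phi (cps_dx h) * fps_der (phi cps_x) + phi (cps_dy h) * fps_der (phi cps_y).
Proof.
move=> phiC h; pose D f := fps_der (phi f) - (phi (cps_dx f) * fps_der (phi cps_x) +
  phi (cps_dy f) * fps_der (phi cps_y)).
suff : D h = 0 by move/eqP; rewrite subr_eq0 => /eqP.
have DM f g : D (f * g) = D f * phi g + phi f * D g.
  rewrite /D cps_dxM cps_dyM !rmorphD !rmorphM fps_derM; ring.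
have DB : zmod_morphism D.
  by move=> f g; rewrite /D cps_dxB cps_dyB !rmorphB /= fps_derB; ring.
pose dM := GRing.isZmodMorphism.Build _ _ D DB.
pose d : {additive R -> fps K} := HB.pack D dM.
have DD f g : D (f + g) = D f + D g by exact: (raddfD d).
have DS n (F : 'I_n -> R) : D (\sum_i F i) = \sum_i D (F i) by exact: (raddf_sum d).
have Dx : D cps_x = 0 by rewrite /D cps_dx_x cps_dy_x rmorph1 rmorph0; ring.
have Dy : D cps_y = 0 by rewrite /D cps_dx_y cps_dy_y rmorph1 rmorph0; ring.
have Dc t : D (cps_const t) = 0.
  by rewrite /D cps_dx_const cps_dy_const rmorph0 phiC fps_der_const; ring.
have DX f n : D f = 0 -> D (f ^+ n) = 0.
  move=> f0; elim: n => [|n IH]; first by rewrite expr0 -(rmorph1 (@cps_const K)) Dc.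
  by rewrite exprS DM f0 IH mul0r mulr0 addr0.
have Dv : forall N f, vanish N f -> forall i, (i < N)%N -> D f i = 0.
  apply: vanish_ind => // N f g fN gN i iN.
  rewrite DD !DM Dx Dy !mul0r !add0r fpsDE.
  rewrite !(@fps_low_mul _ _ _ 1 N) ?addr0 // => -[] // _; exact: morph_local.
apply: fps_ge_eq0 => N i iN; rewrite -(subrK (cps_trunc N h) h).
rewrite DD fpsDE (Dv N) //; last exact: cps_trunc_vanish.
rewrite add0r /cps_trunc DS big1 // => j _; rewrite DS big1 // => k _.
have -> : D (cps_const (h j k) * (cps_x ^+ j * cps_y ^+ k)) =
    D (cps_const (h j k)) * phi (cps_x ^+ j * cps_y ^+ k) + phi (cps_const (h j k)) *
    (D (cps_x ^+ j) * phi (cps_y ^+ k) + phi (cps_x ^+ j) * D (cps_y ^+ k)).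
  by rewrite DM DM.
by rewrite Dc (DX _ _ Dx) (DX _ _ Dy); ring.
Qed.

End Derivations.

(** * Tangent directions *)

Section Directions.
Variable K : numClosedFieldType.
Local Notation R := (cps K).
Implicit Types (f g h : cps K) (c : option K) (p q : {poly K}).

(* Coordinates at the point [c] of the blowup in which the exceptional curve  *)
(* has equation [x]: those of [chart c], exchanged when [c] is [None].        *)
Definition pc c : R -> R :=
  if c is Some a then pb (Some a) else fun h => pb (Some 0) (cps_swap h).

Fact pc_is_zmod_morphism c : zmod_morphism (pc c).
Proof. by case: c => [a|] f g; rewrite /pc !raddfB. Qed.
Fact pc_is_monoid_morphism c : monoid_morphism (pc c).
Proof. by case: c => [a|]; split=> [|f g]; rewrite /pc ?rmorph1 ?rmorphM. Qed.
HB.instance Definition _ c := GRing.isZmodMorphism.Build R R (pc c) (@pc_is_zmod_morphism c).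
HB.instance Definition _ c := GRing.isMonoidMorphism.Build R R (pc c) (@pc_is_monoid_morphism c).

Lemma pc_const c t : pc c (cps_const t) = cps_const t.
Proof. by case: c => [a|] /=; rewrite ?cps_swap_const pb_const. Qed.

Lemma pc_exceptional c : pc c (exceptional c) = cps_x.
Proof. by case: c => [a|] /=; rewrite ?cps_swap_y pb_x. Qed.

(** A binary form of degree [k], given by its values [p] on [(1, Y)], in the local coordinate of the
    projective line at [c]: a translate, or the reversed polynomial at infinity. *)
Definition dform c k p : {poly K} :=
  if c is Some a then p \Po ('X + a%:P) else \poly_(j < k.+1) p`_(k - j).

Lemma pcE c h n m : pc c h n m = (dform c n (hform n h))`_m.
Proof.
case: c => [a|]; first exact: pbE.
rewrite [LHS](_ : _ = pb (Some 0) (cps_swap h) n m) // pbE polyC0 addr0 comp_polyXr.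
apply: (congr1 (fun p : {poly K} => p`_m)); apply/polyP => j.
rewrite hform_coef coef_poly ltnS; case: leqP => // jn.
by rewrite hform_coef leq_subr [cps_swap _ _ _]cps_swapE subKn.
Qed.

Lemma dform_linear c k a p q : dform c k (a *: p + q) = a *: dform c k p + dform c k q.
Proof.
case: c => [b|] /=; first exact: linearP.
apply/polyP => j; rewrite coefD coefZ !coef_poly; case: ifP => _; last by rewrite mulr0 addr0.
by rewrite coefD coefZ.
Qed.

Lemma dform0 c k : dform c k 0 = 0.
Proof. by have := dform_linear c k (-1) 0 0; rewrite scaler0 addr0 scaleN1r addNr. Qed.

Lemma pc_vanish c k h : vanish k h -> exists g, pc c h = cps_x ^+ k * g /\
  forall m, g 0%N m = (dform c k (hform k h))`_m.
Proof.
move=> hk; have [|g E] := @cps_divxX K k (pc c h).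
  by move=> i j ik; rewrite pcE (hform_eq0 hk) // dform0 coef0.
by exists g; split=> // m; rewrite -pcE E cps_xXE ltnn subnn.
Qed.

Definition homog d p : R := \sum_(j < d.+1) cps_const p`_j * (cps_x ^+ (d - j) * cps_y ^+ j).

Lemma homogE d p i j : homog d p i j = if (i + j == d)%N then p`_j else 0.
Proof.
rewrite /homog cps_sumE; under eq_bigr do rewrite cps_xyE.
case: eqP => [<-|ijd].
  have jd : (j < (i + j).+1)%N by rewrite ltnS leq_addl.
  rewrite (bigD1 (Ordinal jd)) //= addnK !eqxx /= big1 ?addr0 // => k.
  by rewrite -val_eqE eq_sym /= => /negPf ->; rewrite andbF.
rewrite big1 // => -[k /= kd] _; case: ifP => // /andP[/eqP ik /eqP jk].
by case: ijd; lia.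
Qed.

Lemma vanish_homog d p : vanish d (homog d p).
Proof. by move=> i j ij; rewrite homogE ltn_eqF. Qed.

Lemma hform_homog d p : (size p <= d.+1)%N -> hform d (homog d p) = p.
Proof.
move=> pd; apply/polyP => j; rewrite hform_coef homogE; case: leqP => jd.
  by rewrite subnK // eqxx.
by rewrite nth_default // (leq_trans pd).
Qed.

Lemma dvdp_prod_XsubC_count (rs : seq K) p :
  (forall a, ('X - a%:P) ^+ count_mem a rs %| p) -> \prod_(z <- rs) ('X - z%:P) %| p.
Proof.
elim: rs p => [|z rs IH] p H; first by rewrite big_nil dvd1p.
have /dvdpP[p1 E] : 'X - z%:P %| p.
  by apply: dvdp_trans (H z); rewrite /= eqxx exprS dvdp_mulr.
rewrite big_cons E mulrC dvdp_mul2r ?polyXsubC_eq0 //; apply: IH => a.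
have := H a; rewrite /= E; have [->|za] := eqVneq z a.
  by rewrite exprSr dvdp_mul2r // polyXsubC_eq0.
by rewrite add0n Gauss_dvdpl // coprimep_expl // coprimep_XsubC root_XsubC.
Qed.

Lemma comp_shift_dvd a m p :
  (forall j, (j < m)%N -> (p \Po ('X + a%:P))`_j = 0) -> ('X - a%:P) ^+ m %| p.
Proof.
set q := p \Po _ => q0.
have /dvdpP[g E] : 'X^m %| q.
  rewrite -(poly_take_drop m q) dvdp_addr ?dvdp_mull //.
  rewrite (_ : take_poly m q = 0) ?dvdp0 //; apply/polyP => j.
  by rewrite coef_take_poly coef0; case: ifP => // /q0.
have <- : q \Po ('X - a%:P) = p.
  by rewrite /q -comp_polyA comp_polyD comp_polyX comp_polyC subrK comp_polyXr.
by rewrite E comp_polyM comp_Xn_poly dvdp_mull.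
Qed.

Lemma comp_shift_prod (rs : seq K) a : exists2 g : {poly K}, g`_0 != 0 &
  (\prod_(z <- rs) ('X - z%:P)) \Po ('X + a%:P) = 'X^(count_mem a rs) * g.
Proof.
elim: rs => [|z rs [g g0 E]].
  by exists 1; rewrite ?big_nil ?comp_polyC ?expr0 ?mulr1 // coef1 oner_neq0.
rewrite big_cons comp_polyM E comp_polyB comp_polyX comp_polyC /=.
have [->|za] := eqVneq z a; first by exists g => //; rewrite addrK exprS mulrA.
exists (('X + (a - z)%:P) * g); last by rewrite add0n rmorphB; ring.
by rewrite coef0M coefD coefX coefC add0r mulf_neq0 // subr_eq0 eq_sym.
Qed.

(* [T] is the set of roots of [F] on the projective line. *)
Lemma directions (e : nat) (F : {poly K}) : F != 0 -> (size F <= e.+1)%N ->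
  exists (T : seq (option K)) (ml : option K -> nat),
  [/\ uniq T, forall c, (c \in T) = (0 < ml c)%N, (\sum_(c <- T) ml c = e)%N,
    forall c, (forall j, (j < ml c)%N -> (dform c e F)`_j = 0) /\ (dform c e F)`_(ml c) != 0 &
    forall k p, (size p <= k.+1)%N ->
      (forall c, c \in T -> forall j, (j < ml c)%N -> (dform c k p)`_j = 0) ->
      exists2 q, p = F * q & q = 0 \/ (size q + e <= k.+1)%N].
Proof.
move=> F0 Fe; have [rs FE] := closed_field_poly_normal F.
have lF : lead_coef F != 0 by rewrite lead_coef_eq0.
have sF : size F = (size rs).+1 by rewrite FE size_scale // size_prod_XsubC.
(* The defect of degree of [F] is the multiplicity of its root at infinity, the direction of
   [x = 0]. *)
have [mN mNE] : {mN | mN = (e - size rs)%N} by eexists.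
pose ml c := if c is Some a then count_mem a rs else mN.
pose T := map Some (undup rs) ++ (if (0 < mN)%N then [:: None] else [::]).
have TE c : (c \in T) = (0 < ml c)%N.
  rewrite mem_cat; case: c => [a|] /=.
    rewrite mem_map; last by move=> ? ? [].
    rewrite mem_undup -has_pred1 has_count; case: ifP; by rewrite ?inE ?in_nil ?orbF.
  rewrite (_ : None \in map Some _ = false) //=; last by apply/negP => /mapP[].
  by rewrite /ml; case: (0 < mN)%N; rewrite ?inE.
exists T, ml; split=> //.
- rewrite cat_uniq map_inj_uniq ?undup_uniq /=; last by move=> ? ? [].
  case: ifP => _ //=; rewrite orbF andbT; by apply/negP => /mapP[].
- rewrite big_cat /= big_map.
  have -> : (\sum_(a <- undup rs) ml (Some a) = size rs)%N.
    rewrite -[RHS]sum1_size -[RHS]big_undup_iterop_count; apply: eq_bigr => a _.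
    by rewrite Monoid.iteropE iter_addn_0 mul1n.
  by case: ifP => mN0; rewrite ?big_seq1 ?big_nil /ml; move: Fe; rewrite sF; lia.
- case=> [a|] /=; rewrite /ml.
    have [g g0 E] := comp_shift_prod rs a.
    rewrite FE comp_polyZ E; split=> [j jm|]; rewrite coefZ coefXnM.
      by rewrite jm mulr0.
    by rewrite ltnn subnn mulf_neq0.
  split=> [j jm|]; rewrite coef_poly.
    case: ifP => // _; rewrite nth_default // sF.
    by have {}jm : (j < mN)%N := jm; lia.
  rewrite mNE ltnS leq_subr subKn; last by move: Fe; rewrite sF ltnS.
  by move: lF; rewrite lead_coefE sF.
move=> k p pk H; have [->|p0] := eqVneq p 0.
  by exists 0; rewrite ?mulr0 //; left.
have /dvdpP[q' E'] : F %| p.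
  rewrite FE dvdpZl //; apply: dvdp_prod_XsubC_count => a.
  have [m0|] := posnP (count_mem a rs); first by rewrite m0 expr0 dvd1p.
  rewrite -[X in (0 < X)%N]/(ml (Some a)) -TE => aT.
  by apply: comp_shift_dvd => j jm; apply: (H _ aT).
have [q E] : exists q : {poly K}, p = q * F by exists q'.
exists q; first by rewrite mulrC.
right; have q0 : q != 0 by apply: contraNneq p0 => q0; rewrite E q0 mul0r.
have sp : size p = (size q + size rs)%N.
  by rewrite E size_mul // sF addnS.
have [mN0|mN0] := posnP mN; first by move: pk; rewrite sp; lia.
(* The finite roots gave divisibility by [F]; vanishing at infinity lowers the degree of [p], and
   this bounds the degree of the quotient. *)
have NT : None \in T by rewrite TE.
have : (size p + mN <= k.+1)%N; last first.
  by rewrite sp; lia.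
rewrite leqNgt; apply/negP => hp.
have : lead_coef p = 0.
  have sp0 : (0 < size p)%N by rewrite size_poly_gt0.
  have spk : ((size p).-1 <= k)%N by lia.
  have sm : (k - (size p).-1 < ml None)%N by rewrite /ml; lia.
  by have := H _ NT _ sm; rewrite /= coef_poly ltnS leq_subr subKn.
by move/eqP; rewrite lead_coef_eq0 (negPf p0).
Qed.

End Directions.

(** * Local algebra of one blowup *)

Section Blowup.
Variable K : numClosedFieldType.
Local Notation R := (cps K).
Implicit Types (f g h u : cps K) (c : option K) (p : {poly K}).

Lemma divides_mulr (T : comNzRingType) (d a b : T) : divides d a -> divides d (b * a).
Proof. by move=> [g ->]; exists (b * g); rewrite mulrA. Qed.
Lemma dividesD (T : comNzRingType) (d a b : T) : divides d a -> divides d b -> divides d (a + b).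
Proof. by move=> [g ->] [h ->]; exists (g + h); rewrite mulrDl. Qed.
Lemma dividesN (T : comNzRingType) (d a : T) : divides d a -> divides d (- a).
Proof. by move=> [g ->]; exists (- g); rewrite mulNr. Qed.
Lemma dividesB (T : comNzRingType) (d a b : T) : divides d a -> divides d b -> divides d (a - b).
Proof. by move=> da db; apply: dividesD => //; apply: dividesN. Qed.
Lemma divides_eq (T : comNzRingType) (d a b : T) : a = b -> divides d a -> divides d b.
Proof. by move=> ->. Qed.
Lemma divides_sum (T : comNzRingType) (d : T) (I : Type) (s : seq I) (P : pred I) (F : I -> T) :
  (forall i, P i -> divides d (F i)) -> divides d (\sum_(i <- s | P i) F i).
Proof.
move=> dF; elim/big_ind: _ => //; last exact: dividesD.
by exists 0; rewrite mul0r.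
Qed.

Lemma divides_xX_regular n m a b u : yregular m u -> cps_x ^+ n * b = a * u ->
  exists a', a = cps_x ^+ n * a'.
Proof.
move=> [u0 um] E; have [a0|/eqP a0] := pselect (a = 0).
  by exists 0; rewrite mulr0.
apply: cps_divxX => i j ilt.
have [|s as_ alow] := @fps_order_ex _ (cps_val a).
  by apply: contra_neq a0 => a0; apply: val_inj.
have [ns|sn] := leqP n s; first by rewrite alow ?fps0E // (leq_trans ilt).
have : cps_val (a * u) s != 0.
  rewrite -[s]addn0 cpsM_val (fps_lead_mul alow (m := 0)) //.
  apply/eqP => /fps1_integral[/eqP|/(congr1 (fun v : fps K => v m))/eqP].
    by rewrite (negPf as_).
  by rewrite fps0E (negPf um).
by rewrite -E => /eqP[]; apply/fpsP => l; rewrite cps_xXE sn.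
Qed.

Lemma regular_remainder_x m u h : yregular m u -> (forall j, (j < m)%N -> h 0%N j = 0) ->
  exists a b, h = a * u + cps_x * b.
Proof.
move=> um h0; have [q [r [E rl]]] := cps_weierstrass h um.
have [|b rb] := @cps_divx K r; last by exists q, b; rewrite -rb.
move=> j; have [mj|jm] := leqP m j; first exact: rl.
have := h0 j jm; rewrite E cpsDE cpsM_val fps2ME big_ord1 big1 ?add0r // => -[i /= ij] _.
by rewrite subn0 (um.1 (j - i)%N) ?mulr0 //; lia.
Qed.

(** Weierstrass remainders modulo [u], truncated at [x^n], have the basis [x^i y^j] with [i < n] and
    [j < m]. It is the intersection number of [u] with [x^n]. *)
Lemma quotient_dim_weierstrass m n u : yregular m u ->
  quotient_dim [set: R] [set g | exists a b, g = a * u + cps_x ^+ n * b] (n * m).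
Proof.
move=> um.
have ex h : exists r : R, ylow m r /\ exists q : R, h = q * u + r.
  by have [q [r [E rl]]] := cps_weierstrass h um; exists r; split=> //; exists q.
pose rem h := projT1 (cid (ex h)).
have remP h : ylow m (rem h) /\ exists q, h = q * u + rem h by rewrite /rem; case: cid.
have remE h (q r : R) : ylow m r -> h = q * u + r -> rem h = r.
  move=> rl E; have [sl [q' E']] := remP h.
  have [||_ /eqP] := @cps_weierstrass_uniq K m u (q' - q) (rem h - r) um.
  - by move=> i j mj; rewrite cpsBE sl // rl // subrr.
  - by rewrite mulrBl addrACA -opprD -E' -E subrr.
  - by rewrite subr_eq0 => /eqP.
pose s := [seq (i, j) | i <- iota 0 n, j <- iota 0 m].
have -> : (n * m = size s)%N by rewrite size_allpairs !size_iota.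
have sP i j : ((i, j) \in s) = (i < n)%N && (j < m)%N.
  apply/allpairsP/andP => [[[a b] /= []]|[il jl]].
    by rewrite !mem_iota /= => an bm [-> ->].
  by exists (i, j); split=> //; rewrite mem_iota.
apply: (@quotient_dim_forms _ _ _ _ _ _ (fun ij h => rem h ij.1 ij.2)).
- by apply: allpairs_uniq; rewrite ?iota_uniq // => -[a b] [a' b'] _ _ [-> ->].
- exact: subspaceT.
- move=> [i j] a g h /=; have [gl [q gE]] := remP g; have [hl [q' hE]] := remP h.
  have -> : rem (a *: g + h) = cps_const a * rem g + rem h.
    apply: (remE _ (cps_const a * q + q')).
      by move=> k l ml; rewrite cpsDE cps_constME gl // hl // mulr0 addr0.
    rewrite {1}gE {1}hE -[a *: _]/(cps_const a * _); ring.
  by rewrite cpsDE cps_constME.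
- move=> [i j]; rewrite sP => /andP[il jl]; exists (cps_x ^+ i * cps_y ^+ j) => //.
  move=> [k l] _ /=; rewrite (remE _ 0 (cps_x ^+ i * cps_y ^+ j)) ?mul0r ?add0r //.
    rewrite -[cps_x ^+ i * _]mul1r -(rmorph1 (@cps_const K)) cps_xyE xpair_eqE.
    by case: ifP.
  move=> k' l' ml'; rewrite -[cps_x ^+ i * _]mul1r -(rmorph1 (@cps_const K)) cps_xyE.
  by have -> : (l' == j) = false; [apply/eqP; lia|rewrite andbF].
move=> g; have [gl [q gE]] := remP g; split=> [[a [b E]]|[_ H]].
  split=> // -[i j]; rewrite sP => /andP[il jl] /=.
  have [bl [q' bE]] := remP b.
  rewrite (remE _ (a + cps_x ^+ n * q') (cps_x ^+ n * rem b)).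
  - by rewrite cps_xXE il.
  - by move=> k l ml; rewrite cps_xXE; case: ifP => // _; rewrite bl.
  - by rewrite E {1}bE; ring.
have [|b rb] := @cps_divxX K n (rem g); last by exists q, b; rewrite -rb.
move=> i j il; have [mj|jm] := leqP m j; first exact: gl.
by apply: (H (i, j)); rewrite sP il jm.
Qed.

Lemma subspace_ideal2 u w : subspace [set g : R | exists a b, g = a * u + w * b].
Proof.
split=> [|t g h [a [b ->]] [a' [b' ->]]]; first by exists 0, 0; rewrite mul0r mulr0 addr0.
exists (cps_const t * a + a'), (cps_const t * b + b').
rewrite -[t *: _]/(cps_const t * _); ring.
Qed.

Lemma subspace_vanish n : subspace [set h : R | vanish n h].
Proof.
split=> // a u v un vn i j ij.
by rewrite cpsDE -[a *: u]/(cps_const a * u) cps_constME un // vn // mulr0 addr0.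
Qed.

Lemma quotient_dim_vanish n : quotient_dim [set: R] [set h : R | vanish n h] 'C(n.+1, 2).
Proof.
pose s := [seq (i, j) | i <- iota 0 n, j <- iota 0 (n - i)].
have -> : 'C(n.+1, 2) = size s.
  have E (G : nat -> nat) : (\sum_(i <- iota 0 n) G i = \sum_(i < n) G i)%N.
    by rewrite -(big_mkord xpredT) /index_iota subn0.
  rewrite size_allpairs_dep sumnE big_map E -bin2_sum big_mkord big_ord_recl add0n.
  rewrite (reindex_inj rev_ord_inj) /=; apply: eq_bigr => i _.
  by rewrite size_iota /bump /= add1n subnSK.
have sP i j : ((i, j) \in s) = (i + j < n)%N.
  apply/allpairsPdep/idP => [[a [b []]]|ij].
    by rewrite !mem_iota /= => an bn [-> ->]; lia.
  by exists i, j; split=> //; rewrite mem_iota; lia.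
apply: (@quotient_dim_forms _ _ _ _ _ _ (fun ij (h : R) => h ij.1 ij.2)).
- by apply: allpairs_uniq_dep => [|i _|[a b] [a' b'] _ _ /= [-> ->]] //; apply: iota_uniq.
- exact: subspaceT.
- move=> [i j] a g h; rewrite -[LHS]/((cps_const a * g + h) i j) cpsDE.
  by rewrite cps_constME.
- move=> [i j] _; exists (cps_x ^+ i * cps_y ^+ j) => // -[k l] _.
  rewrite -[LHS]/((cps_x ^+ i * cps_y ^+ j : R) k l) -[cps_x ^+ i * _]mul1r -(rmorph1 (@cps_const K)) cps_xyE xpair_eqE.
  by case: ifP.
move=> h; split=> [hn|[_ H] i j ij]; last by apply: (H (i, j)); rewrite sP.
by split=> // -[i j]; rewrite sP; apply: hn.
Qed.

Definition ev00 (h : R) : K := h 0%N 0%N.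
Fact ev00_is_zmod_morphism : zmod_morphism ev00. Proof. by []. Qed.
Fact ev00_is_monoid_morphism : monoid_morphism ev00.
Proof. by split=> [|f g]; [rewrite /ev00 cps1E|exact: cpsM00]. Qed.
HB.instance Definition _ := GRing.isZmodMorphism.Build R K ev00 ev00_is_zmod_morphism.
HB.instance Definition _ := GRing.isMonoidMorphism.Build R K ev00 ev00_is_monoid_morphism.

(** The exceptional equation at [c] is [x] or [y], so a series in it comes from the base ring;
    coefficients in [C{x}] on the blowup can thus be taken downstairs. *)
Definition lift_ofx c (a : cps1 K) : R := if c is Some _ then cps_ofx a else cps_swap (cps_ofx a).

Lemma pc_lift_ofx c a : pc c (lift_ofx c a) = cps_ofx a.
Proof.
have E b : pb (Some b) (cps_ofx a) = cps_ofx a.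
  apply: cps_eqP => n m; rewrite pbE.
  rewrite (_ : hform n (cps_ofx a) = (a n)%:P).
    by rewrite comp_polyC coefC cps_ofxE.
  apply/polyP => j; rewrite hform_coef coefC cps_ofxE; case: j => [|j] //=.
    by rewrite subn0.
  by case: ifP.
by case: c => [b|] /=; rewrite ?cps_swapK.
Qed.

Section Centre.
Variables (f : R) (e : nat) (T : seq (option K)) (ml : option K -> nat) (fc : option K -> R).
Let F := hform e f.
Hypotheses (vf : vanish e f) (uT : uniq T) (sT : (\sum_(c <- T) ml c = e)%N).
Hypothesis fcE : forall c, pc c f = cps_x ^+ e * fc c.
Hypothesis fcr : forall c, yregular (ml c) (fc c).
Hypothesis divF : forall k p, (size p <= k.+1)%N ->
      (forall c, c \in T -> forall j, (j < ml c)%N -> (dform c k p)`_j = 0) ->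
      exists2 q, p = F * q & q = 0 \/ (size q + e <= k.+1)%N.

(** The relation can be divided by [x^k], as [x] is regular modulo [fc c]. On [x = 0] it then makes
    the initial form of [h] a multiple of [fc c], of order [ml c]. *)
Lemma blowup_leading k h c a b : vanish k h -> pc c h = a * fc c + cps_x ^+ k.+1 * b ->
  forall j, (j < ml c)%N -> (dform c k (hform k h))`_j = 0.
Proof.
move=> hk E j jm; have [g [gE g0]] := pc_vanish c hk.
have [|a' aE] := @divides_xX_regular k (ml c) a (g - cps_x * b) (fc c) (fcr c).
  by rewrite mulrBr mulrA -exprSr -gE E addrK.
have xk0 : (cps_x : R) ^+ k <> 0.
  apply: cps_expf_neq0 => /(congr1 (fun h : R => h 1%N 0%N))/eqP.
  by rewrite /= oner_eq0.
have : g = a' * fc c + cps_x * b.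
  by apply: (cps_mulI xk0); rewrite -gE E aE exprSr; ring.
rewrite -g0 => ->; rewrite cpsDE -[cps_x]expr1 cps_xXE ltn0Sn addr0 cpsM_val fps2ME big_ord1.
rewrite big1 // => -[i /= ij] _; rewrite subn0 (fcr c).1 ?mulr0 //; lia.
Qed.

Lemma hform_size k h : (size (hform k h) <= k.+1)%N.
Proof. exact: size_poly. Qed.

(** The initial form of the current remainder vanishes at all tangent directions with their
    multiplicities, so it is a multiple of [F] and is cancelled by a multiple of [f]. *)
Lemma blowup_separates h : (forall c, c \in T -> divides (fc c) (pc c h)) ->
  forall k, exists q, vanish k (h - q * f : R).
Proof.
move=> hT; elim=> [|k [q hq]]; first by exists 0.
set h' := h - q * f in hq.
have [|q' qE q'e] := divF (hform_size k h').
  move=> c cT; have [a hE] := hT c cT.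
  apply: (@blowup_leading k h' c (a - pc c q * cps_x ^+ e) 0 hq).
  by rewrite /h' rmorphB rmorphM /= hE fcE; ring.
have [q0|qe] := q'e; first by exists q; apply: vanishS => //; rewrite qE q0 mulr0.
have [q'0|q'0] := eqVneq q' 0; first by exists q; apply: vanishS => //; rewrite qE q'0 mulr0.
have sq' : (0 < size q')%N by rewrite size_poly_gt0.
have ek : (e <= k)%N by lia.
have H : hform k (homog (k - e) q' * f : R) = q' * F.
  rewrite -{1}(subnK ek) hform_lead ?hform_homog //; last exact: vanish_homog.
  by rewrite -(subSn ek) leq_subRL; [rewrite addnC|lia].
have Hv : vanish k (homog (k - e) q' * f : R).
  by rewrite -[k in vanish k](subnK ek); apply: vanishM => //; apply: vanish_homog.
exists (q + homog (k - e) q').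
have -> : h - (q + homog (k - e) q') * f = h' - homog (k - e) q' * f.
  by rewrite /h'; ring.
apply: vanishS; first by apply: vanishD => //; apply: vanishN.
by rewrite hformB H qE mulrC subrr.
Qed.

Let J := [seq (c, j) | c <- T, j <- iota 0 (ml c)].

Let sJ : size J = e.
Proof.
rewrite -sT size_allpairs_dep sumnE big_map; apply: eq_bigr => c _; exact: size_iota.
Qed.

Let uJ : uniq J.
Proof.
by apply: allpairs_uniq_dep => [//|c _|[a b] [a' b'] _ _ /= [-> ->]] //; apply: iota_uniq.
Qed.

Let JP c j : ((c, j) \in J) = (c \in T) && (j < ml c)%N.
Proof.
apply/allpairsPdep/andP => [[a [b []]]|[cT jm]].
  by rewrite mem_iota /= => aT bm [-> ->].
by exists c, j; split=> //; rewrite mem_iota.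
Qed.

Let JO (l : 'I_e) : option K * nat := nth (None, 0%N) J l.

Let JOsurj c j : c \in T -> (j < ml c)%N -> exists l, JO l = (c, j).
Proof.
move=> cT jm; have cJ : (c, j) \in J by rewrite JP cT.
have lt : (index (c, j) J < e)%N by rewrite -sJ index_mem.
by exists (Ordinal lt); rewrite /JO /= nth_index.
Qed.

Let JOinj l l' : JO l = JO l' -> l = l'.
Proof. by move/eqP; rewrite nth_uniq ?sJ // => /eqP; apply: val_inj. Qed.

(** Hermite interpolation at the tangent directions, a square linear system of size [e]. It is
    invertible, since a form of degree [e - 1] divisible by the form [F] of degree [e] is zero. *)
Let interpolation (l : 'I_e) : exists p : {poly K}, (size p <= e)%N /\
  forall c j, c \in T -> (j < ml c)%N -> (dform c e.-1 p)`_j = ((c, j) == JO l)%:R.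
Proof.
pose M := \matrix_(i < e, m < e) (dform (JO m).1 e.-1 'X^i)`_(JO m).2.
have e0 : (0 < e)%N := leq_ltn_trans (leq0n l) (ltn_ord l).
have dM (v : 'rV_e) m : (v *m M) 0 m = (dform (JO m).1 e.-1 (rVpoly v))`_(JO m).2.
  rewrite mxE; have -> : rVpoly v = \sum_(i < e) v 0 i *: 'X^i.
    rewrite /rVpoly poly_def; apply: eq_bigr => i _.
    by case: insubP => [k _ kE|/negP[]//]; congr (v 0 _ *: _); apply: val_inj.
  elim/big_rec2: _ => [|i p q _ IH]; first by rewrite dform0 coef0.
  by rewrite dform_linear coefD coefZ -IH !mxE.
have Mu : M \in unitmx.
  rewrite -row_free_unit; apply: inj_row_free => v vM.
  suff : rVpoly v = 0 by move=> v0; rewrite -[v]rVpolyK v0 raddf0.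
  have [||q E [q0|qe]] := @divF e.-1 (rVpoly v).
  - by rewrite prednK // size_poly.
  - move=> c cT j jm; have [m mE] := JOsurj cT jm.
    by have := dM v m; rewrite vM mxE mE.
  - by rewrite E q0 mulr0.
  rewrite prednK // in qe; rewrite E (_ : q = 0) ?mulr0 //; apply/eqP; rewrite -size_poly_eq0; lia.
exists (rVpoly (delta_mx 0 l *m invmx M)); split; first exact: size_poly.
move=> c j cT jm; have [m mE] := JOsurj cT jm.
have := dM (delta_mx 0 l *m invmx M) m; rewrite mulmxKV // mE !mxE eqxx => <-.
by rewrite -mE (inj_eq (f := JO)) //; apply: JOinj.
Qed.

(** These elements, each supported at one point, generate [E^(e-1) O'] over the base ring. *)
Let v (l : 'I_e) c : R := if (JO l).1 == c then cps_x ^+ e.-1 * cps_y ^+ (JO l).2 else 0.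

(** Modulo [fc c], a component is a polynomial in [y] over [C{x}], whose coefficients lift by
    [lift_ofx]; at the other points the lifts multiply zero entries of [v]. *)
Let expand (b : option K -> R) : exists s : 'I_e -> R, forall c, c \in T ->
  divides (fc c) (cps_x ^+ e.-1 * b c - \sum_l pc c (s l) * v l c).
Proof.
have ex c : exists r : R, ylow (ml c) r /\ divides (fc c) (b c - r).
  have [q [r [E rl]]] := cps_weierstrass (b c) (fcr c).
  by exists r; split=> //; exists q; rewrite E addrK.
pose r c := projT1 (cid (ex c)).
have rP c : ylow (ml c) (r c) /\ divides (fc c) (b c - r c) by rewrite /r; case: cid.
exists (fun l => lift_ofx (JO l).1 (cps_col (JO l).2 (r (JO l).1))) => c cT.
have [rl rd] := rP c.
have -> : \sum_l pc c (lift_ofx (JO l).1 (cps_col (JO l).2 (r (JO l).1))) * v l c =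
    cps_x ^+ e.-1 * r c; last by rewrite -mulrBr; apply: divides_mulr.
transitivity (\sum_(i <- J) if i.1 == c then
    cps_ofx (cps_col i.2 (r c)) * (cps_x ^+ e.-1 * cps_y ^+ i.2) else 0).
  rewrite (big_nth (None, 0%N)) sJ big_mkord; apply: eq_bigr => l _.
  rewrite /v -/(JO l); case: eqP => [<-|_]; last by rewrite mulr0.
  by rewrite pc_lift_ofx.
rewrite [in RHS](ylow_decomp rl) mulr_sumr /J big_allpairs_dep (bigD1_seq c) //=.
rewrite [X in _ + X]big1 ?addr0 => [|c' /negPf c'c]; last first.
  by rewrite big1 // => i _; rewrite c'c.
have E (G : nat -> R) n : \sum_(i <- iota 0 n) G i = \sum_(i < n) G i.
  by rewrite -(big_mkord xpredT) /index_iota subn0.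
by rewrite E; apply: eq_bigr => i _; rewrite eqxx mulrCA.
Qed.

(** Nakayama's lemma through a determinant: the interpolating forms [w] agree with [v] modulo
    [E^e O'], so [w = (1 + S) v] with [S] zero at the origin, and [1 + S] is inverted by its
    adjugate. *)
Let generators : exists W : 'I_e -> R, forall l c, c \in T ->
  divides (fc c) (v l c - pc c (W l)).
Proof.
pose P l := projT1 (cid (interpolation l)).
have PP l : (size (P l) <= e)%N /\ forall c j, c \in T -> (j < ml c)%N ->
    (dform c e.-1 (P l))`_j = ((c, j) == JO l)%:R.
  by rewrite /P; case: cid.
pose w l := homog e.-1 (P l).
have exb l c : exists b, c \in T ->
    divides (fc c) (pc c (w l) - v l c - cps_x ^+ e.-1 * (cps_x * b)).
  have [cT|] := boolP (c \in T); last by exists 0.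
  have [Ps Pi] := PP l; have [g [gE g0]] := pc_vanish c (@vanish_homog _ e.-1 (P l)).
  have e0 : (0 < e)%N := leq_ltn_trans (leq0n l) (ltn_ord l).
  rewrite hform_homog ?prednK // in g0.
  pose d : R := if (JO l).1 == c then cps_y ^+ (JO l).2 else 0.
  have [|a [b E]] := @regular_remainder_x (ml c) (fc c) (g - d) (fcr c).
    move=> j jm; rewrite cpsBE g0 Pi // /d.
    have -> : ((c, j) == JO l) = ((JO l).1 == c) && (j == (JO l).2).
      by case: (JO l) => k i; rewrite xpair_eqE eq_sym.
    case: eqP => _; last exact: subrr.
    rewrite -[cps_y ^+ _]mulr1 cps_yXE cps1E andTb.
    case: ltnP => [jl|lj]; first by rewrite ltn_eqF // subrr.
    by rewrite andTb subn_eq0 eqn_leq lj andbT subrr.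
  exists b => _; rewrite gE /v; have -> : (if (JO l).1 == c then cps_x ^+ e.-1 * cps_y ^+ (JO l).2 else 0) =
     cps_x ^+ e.-1 * d by rewrite /d; case: ifP => _; rewrite ?mulr0.
  rewrite -!mulrBr E; exists (cps_x ^+ e.-1 * a); ring.
pose b l c := projT1 (cid (exb l c)).
have bP l c : c \in T -> divides (fc c) (pc c (w l) - v l c - cps_x ^+ e.-1 * (cps_x * b l c)).
  by rewrite /b; case: cid.
pose s l := projT1 (cid (expand (b l))).
have sP l c : c \in T -> divides (fc c) (cps_x ^+ e.-1 * b l c - \sum_l' pc c (s l l') * v l' c).
  by rewrite /s; case: cid => s' /= H /H.
(* The factor [x] at the point carrying [v l'] is the pullback of its exceptional equation, so the
   error has coefficients in the maximal ideal of the base ring. *)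
pose S := \matrix_(l < e, l' < e) (exceptional (JO l').1 * s l l').
pose M := 1%:M + S.
have Mv l c : c \in T -> divides (fc c) (pc c (w l) - \sum_l' pc c (M l l') * v l' c).
  move=> cT; have H1 := bP l c cT; have H2 := divides_mulr cps_x (sP l c cT).
  have := dividesD H1 H2.
  have -> : \sum_l' pc c (M l l') * v l' c =
      v l c + cps_x * \sum_l' pc c (s l l') * v l' c; last first.
    by apply: divides_eq; ring.
  rewrite mulr_sumr -[X in X + _]mul1r.
  transitivity (\sum_l' ((l == l')%:R * v l' c + cps_x * (pc c (s l l') * v l' c))).
    apply: eq_bigr => l' _; rewrite !mxE rmorphD rmorph_nat mulrDl rmorphM; congr (_ + _).
    by rewrite /v; case: eqP => [->|_]; [rewrite /= pc_exceptional -mulrA|rewrite !mulr0].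
  rewrite big_split /=; congr (_ + _).
  rewrite (bigD1 l) //= eqxx big1 ?addr0 // => l' /negPf; rewrite eq_sym => ->.
  by rewrite mul0r.
have /cps_invertible[D DM] : (\det M) 0%N 0%N != 0.
  change (ev00 (\det M) != 0); rewrite -det_map_mx.
  rewrite (_ : map_mx _ M = 1%:M) ?det1 ?oner_neq0 //; apply/matrixP => l l'.
  rewrite !mxE rmorphD rmorph_nat rmorphM /= (_ : ev00 (exceptional _) = 0) ?mul0r ?addr0 //.
  by case: (JO l').1.
exists (fun l => D * \sum_l' \adj M l l' * w l') => l c cT.
have : divides (fc c) (pc c D * \sum_l' pc c (\adj M l l') *
    (pc c (w l') - \sum_l'' pc c (M l' l'') * v l'' c)).
  by apply/divides_mulr/divides_sum => l' _; apply/divides_mulr/Mv.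
move/dividesN; apply: divides_eq.
under eq_bigr do rewrite mulrBr.
rewrite sumrB mulrBr opprB; congr (_ - _); last first.
  rewrite rmorphM rmorph_sum; congr (_ * _); apply: eq_bigr => l' _; by rewrite rmorphM.
under eq_bigr do rewrite mulr_sumr.
rewrite exchange_big /=.
transitivity (pc c D * \sum_l'' pc c ((\adj M *m M) l l'') * v l'' c).
  congr (_ * _); apply: eq_bigr => l'' _; rewrite mxE rmorph_sum mulr_suml.
  by apply: eq_bigr => l' _; rewrite rmorphM mulrA.
rewrite mul_adj_mx (bigD1 l) //= !mxE eqxx big1 ?addr0 => [|l' l'l]; last first.
  by rewrite !mxE eq_sym (negPf l'l) mulr0n rmorph0 mul0r.
by rewrite mulr1n mulrA -rmorphM -DM rmorph1 mul1r.
Qed.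

(* [E^(e-1) O'] is contained in the image of [O], where [O'] is the product  *)
(* of the local rings of the blown up curve: by [interpolation], this holds  *)
(* modulo [E^e O'], whence the claim by Nakayama's lemma.                    *)
Lemma blowup_surjective (g : option K -> R) : exists h, forall c, c \in T ->
  divides (fc c) (cps_x ^+ e.-1 * g c - pc c h).
Proof.
have [W WP] := generators; have [s sP] := expand g.
exists (\sum_l s l * W l) => c cT; have := sP c cT.
have : divides (fc c) (\sum_l pc c (s l) * (v l c - pc c (W l))).
  by apply: divides_sum => l _; apply/divides_mulr/WP.
move=> H1 H2; have := dividesD H2 H1; apply: divides_eq.
under [X in _ + X]eq_bigr do rewrite mulrBr.
rewrite sumrB addrA subrK rmorph_sum; congr (_ - _).
by apply: eq_bigr => l _; rewrite rmorphM.
Qed.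

Let V := option K -> R.
Let U1 := [set g : V | forall c, c \in T -> exists a b, g c = a * fc c + cps_x ^+ e.-1 * b].
Let U2 := [set g : V | exists h, forall c, c \in T -> divides (fc c) (g c - pc c h)].

(** Here [U1] is [E^(e-1) O'] and [U2] the image of the base ring; the codimensions of [U1] in the
    whole and in [U2] are known, and the chain is solved for that of [U2]. *)
Lemma blowup_quotient_dim : quotient_dim [set: V] U2 'C(e, 2).
Proof.
have sU1 : subspace U1.
  split=> [c _|a g h g1 h1 c cT]; first by exists 0, 0; rewrite mul0r mulr0 addr0.
  exact: (subspace_ideal2 (fc c) (cps_x ^+ e.-1)).2 (g1 c cT) (h1 c cT).
have sU2 : subspace U2.
  split=> [|a g h [g' gg'] [h' hh']].
    by exists 0 => c _; rewrite rmorph0 subr0; exists 0; rewrite mul0r.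
  exists (cps_const a * g' + h') => c cT.
  have := dividesD (divides_mulr (cps_const a) (gg' c cT)) (hh' c cT).
  apply: divides_eq; rewrite rmorphD rmorphM /= pc_const.
  by rewrite -[(a *: g + h) c]/(cps_const a * g c + h c); ring.
have U12 : U1 `<=` U2.
  move=> g g1; have exb c : exists b, c \in T -> divides (fc c) (g c - cps_x ^+ e.-1 * b).
    have [cT|] := boolP (c \in T); last by exists 0.
    by have [a [b E]] := g1 c cT; exists b => _; exists a; rewrite E addrK.
  have [h hP] := blowup_surjective (fun c => projT1 (cid (exb c))).
  exists h => c cT; have := hP c cT; case: (cid (exb c)) => b /= /(_ cT) H1 H2.
  by have := dividesD H1 H2; rewrite addrA subrK.
have q1 : quotient_dim [set: V] U1 (e.-1 * e).
  rewrite -[X in (_ * X)%N]sT big_distrr /=.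
  have := @quotient_dim_joint K V _ (fun=> R) T [set: V] (fun=> setT)
    (fun c => [set g | exists a b, g = a * fc c + cps_x ^+ e.-1 * b]) (fun c (g : option K -> R) => g c)
    (fun c => (e.-1 * ml c)%N) uT (@subspaceT _ V) (fun=> @subspaceT _ _)
    (fun c => subspace_ideal2 (fc c) (cps_x ^+ e.-1)).
  rewrite (_ : [set v : V | setT v /\ _] = U1); last first.
    by apply/seteqP; split=> [g [_ gP]//|g gP]; split.
  apply=> // [c cT|c u cT _]; first exact: quotient_dim_weierstrass.
  exists (fun c' => if c' == c then u else 0); split=> //.
    by rewrite eqxx subrr /=; exists 0, 0; rewrite mul0r mulr0 addr0.
  by move=> c' _ /negPf -> /=; exists 0, 0; rewrite mul0r mulr0 addr0.
have [||||m [k [hm hk mk]]] := quotient_dim_split (U' := U2) _ _ _ U12 _ q1 => //.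
suff <- : m = 'C(e, 2) by [].
suff kE : k = 'C(e, 2).
  have E := mul_bin_diag e 1; rewrite bin1 in E.
  by move: mk; rewrite kE mulnC E; lia.
have q2 : quotient_dim [set: R] [set h : R | vanish e.-1 h] 'C(e, 2).
  by have := quotient_dim_vanish e.-1; case: (e).
have lpc : linear (fun h c => pc c h : R).
  move=> a g h; apply/funext => c; rewrite -[a *: g]/(cps_const a * g) rmorphD rmorphM /= pc_const.
  by [].
apply: (quotient_dim_uniq sU2 sU1 hk).
apply/(quotient_dim_map _ lpc (@subspaceT _ _) (@subspace_vanish e.-1) sU2 sU1) => //.
- by move=> h _; exists h => c _; rewrite subrr; exists 0; rewrite mul0r.
- move=> h _; split=> [hv c cT|hU].
    by have [g [gE _]] := pc_vanish c hv; exists 0, g; rewrite mul0r add0r.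
  (* An element whose pullback lies in [E^(e-1) O'] has order at least [e - 1]: an initial form of
     lower degree would be a multiple of [F], hence zero. *)
  suff : forall k, (k <= e.-1)%N -> vanish k h by apply.
  elim=> // k' IH ke; apply: vanishS; first exact/IH/ltnW.
  have [|q E [q0|qe]] := divF (hform_size k' h); last 2 first.
  - by rewrite E q0 mulr0.
  - by rewrite E (_ : q = 0) ?mulr0 //; apply/eqP; rewrite -size_poly_eq0; lia.
  move=> c cT; have [a [b E]] := hU c cT.
  apply: (@blowup_leading k' h c a (cps_x ^+ (e.-1 - k'.+1) * b)); first exact/IH/ltnW.
  by rewrite E mulrA -exprD subnKC.
move=> g [h hP]; exists h => // c cT; have [a E] := hP c cT.
by exists a, 0; rewrite mulr0 addr0 -E.
Qed.

End Centre.
End Blowup.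

(** * Linear changes of coordinates and closed ideals *)

Section CoordinateChange.
Variable K : numClosedFieldType.
Local Notation R := (cps K).
Implicit Types (f g h : cps K) (s t : K).

Fact shear_origin t : (cps_x + cps_const t * cps_y : R) 0%N 0%N = 0.
Proof. by rewrite cpsDE cps_constME cps_x0 cps_y0 mulr0 addr0. Qed.

Definition shear t : R -> R := cps_comp (shear_origin t) (cps_y0 K).
HB.instance Definition _ t := GRing.RMorphism.on (shear t).

Lemma shear_x t : shear t cps_x = cps_x + cps_const t * cps_y.
Proof. exact: cps_comp_x. Qed.
Lemma shear_y t : shear t cps_y = cps_y. Proof. exact: cps_comp_y. Qed.
Lemma shear_const t s : shear t (cps_const s) = cps_const s.
Proof. exact: cps_comp_const. Qed.

Lemma shearK t : cancel (shear (- t)) (shear t).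
Proof.
apply: (@vanish_ext _ (fun h => shear t (shear (- t) h)) id).
- by move=> f g; rewrite !raddfB.
- by [].
- by move=> k f fk; do 2!apply: cps_comp_vanish.
- by [].
move=> s i j; rewrite !rmorphM !rmorphXn /= !shear_const shear_y shear_x.
rewrite rmorphD rmorphM /= shear_x shear_const shear_y -addrA -mulrDl -rmorphD subrr.
by rewrite rmorph0 mul0r addr0.
Qed.

Lemma shearNK t : cancel (shear t) (shear (- t)).
Proof. by move=> f; have := shearK (- t) f; rewrite opprK. Qed.

Lemma shear_row0 t f m : shear t f 0%N m = \sum_(i < m.+1) f i (m - i)%N * t ^+ i.
Proof.
rewrite cps_compE add0n; apply: eq_bigr => i _.
have E (j : nat) : ((cps_x + cps_const t * cps_y) ^+ i * cps_y ^+ j : R) 0%N m =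
    if m == (i + j)%N then t ^+ i else 0.
  have H (g : R) n : g 0%N = fps_const t * fps_var K -> (g ^+ n) 0%N = fps_const (t ^+ n) * fps_var K ^+ n.
    move=> g0; elim: n => [|n IH].
      by rewrite !expr0 mulr1; apply/fpsP => -[|l].
    by rewrite exprS cpsM_val fpsME big_ord1 subn0 IH g0 !exprS rmorphM /=; ring.
  rewrite cpsM_val fpsME big_ord1 subn0 H; last first.
    apply/fpsP => l; apply: etrans (cpsDE cps_x (cps_const t * cps_y) 0%N l) _.
    by rewrite cps_constME fps_constME [cps_x _ _](_ : _ = 0) ?add0r.
  have -> : cps_val (cps_y ^+ j) 0%N = fps_var K ^+ j.
    by apply/fpsP => l; rewrite -[cps_y ^+ j]mulr1 -[fps_var K ^+ j]mulr1 cps_yXE fps_varXE.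
  rewrite -mulrA -exprD fps_constME -[fps_var K ^+ _]mulr1 fps_varXE fps1E.
  case: ltnP => mij; first by rewrite mulr0 ltn_eqF.
  by rewrite subn_eq0 eqn_leq mij andbT; case: ifP; rewrite ?mulr1 ?mulr0.
under eq_bigr do rewrite E.
have ji : (m - i < m.+1)%N by rewrite ltnS leq_subr.
rewrite (bigD1 (Ordinal ji)) //= subnKC -1?ltnS // eqxx big1 ?addr0 // => j.
rewrite -val_eqE /= => /eqP jn; case: eqP => [mij|_]; last by rewrite mulr0.
by case: jn; lia.
Qed.

Lemma poly_nonroot (p : {poly K}) : p != 0 -> exists t, p.[t] != 0.
Proof.
move=> p0; have [/eqP/size_poly1P[c c0 ->]|p1] := eqVneq (size p) 1%N.
  by exists 0; rewrite hornerC.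
have /closed_rootP[t /rootP] : size (p - 1) != 1%N.
  rewrite size_polyDl // size_polyN size_poly1.
  by rewrite ltn_neqAle eq_sym p1 size_poly_gt0.
rewrite hornerD hornerN hornerC => /eqP; rewrite subr_eq0 => /eqP pt.
by exists t; rewrite pt oner_neq0.
Qed.

(** The leading coefficient of [f (t y, y)] is the initial form at [(t, 1)], nonzero for some
    [t]. *)
Lemma shear_regular e f : vanish e f -> hform e f != 0 ->
  exists t, yregular e (shear t f).
Proof.
move=> fv f0; have [|t pt] := @poly_nonroot (\poly_(i < e.+1) f i (e - i)%N).
  apply: contra_neq f0 => /polyP p0; apply/polyP => j; rewrite hform_coef coef0.
  case: leqP => // je; have := p0 (e - j)%N.
  by rewrite coef_poly ltnS leq_subr subKn // coef0.
exists t; split=> [j je|].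
  by rewrite shear_row0 big1 // => i _; rewrite fv ?mul0r //; have := ltn_ord i; lia.
by rewrite shear_row0; move: pt; rewrite horner_poly.
Qed.

Lemma vanish_ideal N h : vanish N h -> forall Z : R -> Prop,
  (forall f g, Z f -> Z g -> Z (f + g)) -> (forall f g, Z g -> Z (f * g)) ->
  (forall l, (l <= N)%N -> Z (cps_x ^+ l * cps_y ^+ (N - l))) -> Z h.
Proof.
move: N h; apply: vanish_ind => [h Z ZD ZM Z1|N f g Pf Pg Z ZD ZM Z1].
  by rewrite -[h]mulr1; apply: ZM; have := Z1 0%N (leqnn 0); rewrite !expr0 mulr1.
apply: (ZD).
  apply: (Pf (fun u => Z (cps_x * u))) => [u w|u w Zw|l lN].
  - by rewrite mulrDr; apply: ZD.
  - by rewrite mulrCA; apply: ZM.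
  - by rewrite mulrA -exprS -subSS; apply: (Z1 l.+1).
apply: (Pg (fun u => Z (cps_y * u))) => [u w|u w Zw|l lN].
- by rewrite mulrDr; apply: ZD.
- by rewrite mulrCA; apply: ZM.
- by rewrite mulrCA -exprS -subSn //; apply: Z1; apply: leqW.
Qed.

(** [y^m] lies in the ideal of [f] and [x], so [y^(m n)] lies in that of [f] and [x^n]; a monomial
    of degree [m k] has enough [x] or enough [y]. *)
Lemma regular_vanish_ideal m f k h : yregular m f -> vanish (m * k) h ->
  exists a b, h = a * f + cps_x ^+ k * b.
Proof.
move=> fm hv; apply: (@vanish_ideal _ _ hv (fun h => exists a b, h = a * f + cps_x ^+ k * b)) => [u w [a [b ->]] [a' [b' ->]]|u w [a [b ->]]|l lN].
- by exists (a + a'), (b + b'); ring.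
- by exists (u * a), (u * b); ring.
have ym n : exists a b, (cps_y : R) ^+ (m * n) = a * f + cps_x ^+ n * b.
  elim: n => [|n [a [b E]]]; first by rewrite muln0; exists 0, 1; rewrite !expr0; ring.
  have [|a' [b' E']] := @regular_remainder_x K m f (cps_y ^+ m) fm.
    by move=> j jm; rewrite -[cps_y ^+ m]mulr1 cps_yXE jm.
  exists (a * cps_y ^+ m + cps_x ^+ n * b * a'), (b * b').
  by rewrite mulnS addnC exprD E E' exprS; ring.
have [kl|lk] := leqP k l.
  by exists 0, (cps_x ^+ (l - k) * cps_y ^+ (m * k - l)); rewrite mul0r add0r mulrA -exprD subnKC.
have mkl : (m * (k - l) <= m * k - l)%N by case: (m) lN => [|n] lN; lia.
have [a [b E]] := ym (k - l)%N.
exists (cps_x ^+ l * a * cps_y ^+ (m * k - l - m * (k - l))),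
  (b * cps_y ^+ (m * k - l - m * (k - l))).
rewrite -[in LHS](subnKC mkl) exprD E.
have -> : (cps_x : R) ^+ k = cps_x ^+ l * cps_x ^+ (k - l) by rewrite -exprD subnKC // ltnW.
ring.
Qed.

(** Krull's intersection theorem: by uniqueness of division, the remainder of [h] is divisible by
    every power of [x]. *)
Lemma closed_regular m f h : yregular m f ->
  (forall k, exists q, vanish k (h - q * f : R)) -> divides f h.
Proof.
move=> fm H; have [q [r [E rl]]] := cps_weierstrass h fm.
suff r0 : r = 0 by exists q; rewrite E r0 addr0.
apply: cps_eqP => i j; rewrite cps0E.
have [q' /(regular_vanish_ideal fm)[a [b E']]] := H (m * i.+1)%N.
have [q2 [r2 [E2 rl2]]] := cps_weierstrass b fm.
have [||_ /eqP] := @cps_weierstrass_uniq K m f (q - q' - a - cps_x ^+ i.+1 * q2)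
    (r - cps_x ^+ i.+1 * r2) fm.
- move=> k l ml; rewrite cpsBE rl // cps_xXE sub0r.
  by case: ifP => _; rewrite ?oppr0 // rl2 ?oppr0.
- have : h - q' * f - (a * f + cps_x ^+ i.+1 * b) = 0 by rewrite E' subrr.
  rewrite E E2 => <-; ring.
by rewrite subr_eq0 => /eqP ->; rewrite cps_xXE ltnSn.
Qed.

Lemma closed_ideal e f h : vanish e f -> hform e f != 0 ->
  (forall k, exists q, vanish k (h - q * f : R)) -> divides f h.
Proof.
move=> fv f0 H; have [t ft] := shear_regular fv f0.
have [k|g E] := @closed_regular e (shear t f) (shear t h) ft.
  have [q hq] := H k; exists (shear t q).
  by rewrite -rmorphM -rmorphB; apply: cps_comp_vanish.
exists (shear (- t) g); apply: etrans (esym (shearNK t h)) _.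
apply: etrans (congr1 (shear (- t)) E) _; apply: etrans (rmorphM _ _ _) _.
by congr (_ * _); apply: shearNK.
Qed.

(* The blowup of [f], of order [e]: [fc c] is the strict transform in the     *)
(* direction [c], [T] is the set of tangent directions.                       *)
Theorem blowup e f : vanish e f -> hform e f != 0 ->
  exists (T : seq (option K)) (ml : option K -> nat) (fc : option K -> R),
  [/\ [/\ uniq T, forall c, (c \in T) = (0 < ml c)%N & (\sum_(c <- T) ml c = e)%N],
    forall c, pc c f = cps_x ^+ e * fc c /\ yregular (ml c) (fc c),
    forall h, (forall c, c \in T -> divides (fc c) (pc c h)) -> divides f h,
    forall g : option K -> R, exists h, forall c, c \in T ->
      divides (fc c) (cps_x ^+ e.-1 * g c - pc c h) &
    quotient_dim [set: option K -> R]
      [set g : option K -> R | exists h, forall c, c \in T -> divides (fc c) (g c - pc c h)]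
      'C(e, 2)].
Proof.
move=> fv f0.
have [T [ml [uT TE sT mlP divF]]] := directions f0 (hform_size e f).
have exf c : exists g, pc c f = cps_x ^+ e * g /\ forall m, g 0%N m = (dform c e (hform e f))`_m.
  exact: pc_vanish.
pose fc c := projT1 (cid (exf c)).
have fcP c : pc c f = cps_x ^+ e * fc c /\ yregular (ml c) (fc c).
  rewrite /fc; case: cid => g /= [E g0]; split=> //; have [z nz] := mlP c.
  by split=> [j jm|]; rewrite g0 //; apply: z.
have fcE c := (fcP c).1; have fcr c := (fcP c).2.
exists T, ml, fc; split=> // [h hT|g|].
- by apply: (closed_ideal fv f0); apply: (blowup_separates fv uT sT fcE fcr divF hT).
- exact: (blowup_surjective uT sT fcr divF g).
- exact: (blowup_quotient_dim uT sT fcr divF).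
Qed.

End CoordinateChange.

(** * The order of a series in one variable *)

Section Valuation.
Variable K : numClosedFieldType.
Implicit Types (a b : fps K).

(** The zero series gets the default order [0], whence the nonvanishing hypotheses that follow. *)
Definition ford a : nat :=
  if pselect (exists n, a n != 0) is left ex then ex_minn ex else 0%N.

Lemma fordP a : a != 0 -> a (ford a) != 0 /\ forall i, (i < ford a)%N -> a i = 0.
Proof.
move=> /fps_order_ex[n an a0]; rewrite /ford.
case: pselect => [ex|[]]; last by exists n.
case: ex_minnP => m am mn; split=> // i im; apply/eqP; apply: contraTT im => /mn.
by rewrite -leqNgt.
Qed.

Lemma ford_eq a n : a n != 0 -> (forall i, (i < n)%N -> a i = 0) -> ford a = n.
Proof.
move=> an a0; have anz : a != 0 by apply: contraNneq an => ->.
have [ao al] := fordP anz; apply/eqP; rewrite eqn_leq; apply/andP; split.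
  by rewrite leqNgt; apply: contra an => /al ->.
by rewrite leqNgt; apply: contra ao => /a0 ->.
Qed.

Lemma ford_neq0 a n : a n != 0 -> a != 0.
Proof. by apply: contraNneq => ->. Qed.

Lemma fps1_mul_neq0 a b : a != 0 -> b != 0 -> a * b != 0.
Proof. by move=> a0 b0; apply/eqP => /fps1_integral[]/eqP; apply/negP. Qed.

Lemma fps1_mulI a b c : a != 0 -> a * b = a * c -> b = c.
Proof.
move=> a0 /eqP; rewrite -subr_eq0 -mulrBr => /eqP/fps1_integral[/eqP|/eqP].
  by rewrite (negPf a0).
by rewrite subr_eq0 => /eqP.
Qed.

Lemma fordM a b : a != 0 -> b != 0 -> ford (a * b) = (ford a + ford b)%N.
Proof.
move=> a0 b0; have [ao al] := fordP a0; have [bo bl] := fordP b0.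
apply: ford_eq; first by rewrite fps_lead_mul // mulf_neq0.
by move=> i; apply: fps_low_mul.
Qed.

Lemma fps1_expf_neq0 a n : a != 0 -> a ^+ n != 0.
Proof.
move=> a0; elim: n => [|n IH]; first by rewrite expr0 oner_neq0.
by rewrite exprS fps1_mul_neq0.
Qed.

Lemma ford_0 a : a 0%N != 0 -> ford a = 0%N.
Proof. by move=> a0; apply: ford_eq. Qed.

Lemma fordX a n : a != 0 -> ford (a ^+ n) = (n * ford a)%N.
Proof.
move=> a0; elim: n => [|n IH]; first by rewrite expr0 mul0n ford_0 // fps1E oner_neq0.
by rewrite exprS fordM ?fps1_expf_neq0 // IH mulSn.
Qed.

Lemma fordN a : ford (- a) = ford a.
Proof.
have [->|a0] := eqVneq a 0; first by rewrite oppr0.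
have [ao al] := fordP a0; apply: ford_eq; first by rewrite fpsNE oppr_eq0.
by move=> i il; rewrite fpsNE al // oppr0.
Qed.

Lemma ford_der a : a != 0 -> a 0%N = 0 -> fps_der a != 0 /\ (ford (fps_der a)).+1 = ford a.
Proof.
move=> a0 a00; have [ao al] := fordP a0.
case E : (ford a) ao al => [|n] ao al; first by rewrite a00 eqxx in ao.
have dn : fps_der a n != 0 by rewrite /= mulrn_eq0 negb_or.
split; first exact: ford_neq0 dn.
by congr _.+1; apply: ford_eq => // i il; rewrite /= al ?mul0rn.
Qed.

End Valuation.

(** * The valuation ring of convergent series in one variable *)

Section OneVariableRing.
Variable K : numClosedFieldType.
Local Notation R := (cps K).
Local Notation A := (cps1 K).
Implicit Types (f g h : cps K) (a b : cps1 K).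

Fact cps1_val_is_zmod_morphism : zmod_morphism (@cps1_val K). Proof. by []. Qed.
Fact cps1_val_is_monoid_morphism : monoid_morphism (@cps1_val K). Proof. by []. Qed.
HB.instance Definition _ := GRing.isZmodMorphism.Build A (fps K) (@cps1_val K)
  cps1_val_is_zmod_morphism.
HB.instance Definition _ := GRing.isMonoidMorphism.Build A (fps K) (@cps1_val K)
  cps1_val_is_monoid_morphism.

Lemma cps1_val_eq0 a : (cps1_val a == 0) = (a == 0).
Proof. by apply/eqP/eqP => [a0|->//]; apply: val_inj. Qed.

Lemma cps1_mul_neq0 a b : a != 0 -> b != 0 -> a * b != 0.
Proof. by rewrite -!cps1_val_eq0 cps1M_val; apply: fps1_mul_neq0. Qed.

Lemma cps1_expf_neq0 a n : a != 0 -> a ^+ n != 0.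
Proof. by rewrite -!cps1_val_eq0 cps1X_val; apply: fps1_expf_neq0. Qed.

Lemma cps1_mulI a b c : a != 0 -> a * b = a * c -> b = c.
Proof.
rewrite -cps1_val_eq0 => a0 /(congr1 (@cps1_val K)); rewrite !cps1M_val.
by move/(fps1_mulI a0)/val_inj.
Qed.

Lemma cps1_tXE n a k : (cps1_t ^+ n * a : A) k = if (k < n)%N then 0 else a (k - n)%N.
Proof. by rewrite cps1M_val cps1X_val fps_varXE. Qed.

Lemma cps1_t_neq0 : cps1_t != 0 :> A.
Proof. by rewrite -cps1_val_eq0; apply: (@ford_neq0 _ _ 1%N); rewrite /= oner_neq0. Qed.

Lemma ford_t : ford (cps1_t : A) = 1%N.
Proof. by apply: ford_eq => [|[]] //; rewrite /= oner_neq0. Qed.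

(* The quotient map to [C{x,y} / (f)], identified with [C{x}], for [f] smooth *)
(* and transversal to [x = 0].                                                 *)
Lemma smooth_morphism f : yregular 1 f -> exists phi : {rmorphism R -> A},
  [/\ forall t, phi (cps_const t) = cps1_const t, forall h, phi h = 0 <-> divides f h &
      forall a, phi (cps_ofx a) = a].
Proof.
move=> fr; have ex h : exists a, divides f (h - cps_ofx a).
  (* Division by a series regular of order one leaves a remainder free of [y], which is the class of
     [h] in [C{x}]. *)
  have [q [r [E rl]]] := cps_weierstrass h fr; exists (cps_col 0 r).
  exists q; rewrite E {1}(ylow_decomp rl) big_ord1 expr0 mulr1; ring.
pose fn h := projT1 (cid (ex h)).
have fnP h : divides f (h - cps_ofx (fn h)) by rewrite /fn; case: cid.
have uq a b : divides f (cps_ofx a - cps_ofx b) -> a = b.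
  move=> [g E]; have [||_ /eqP] := @cps_weierstrass_uniq K 1 f (- g) (cps_ofx (a - b)) fr.
  - by move=> i j j0; rewrite cps_ofxE; case: eqP => // j00; rewrite j00 in j0.
  - by rewrite rmorphB /= E; ring.
  move=> /eqP /(congr1 (fun h : R => cps_col 0 h)) E0; apply/eqP; rewrite -subr_eq0.
  by apply/eqP; apply: cps1_eqP => i; have := congr1 (fun c : A => c i) E0; rewrite /= => ->.
have fnE h a : divides f (h - cps_ofx a) -> fn h = a.
  move=> H; apply: uq; have := dividesB H (fnP h); apply: divides_eq; ring.
have fnB : zmod_morphism fn.
  move=> g h; apply: fnE; have := dividesB (fnP g) (fnP h); apply: divides_eq.
  by rewrite rmorphB /=; ring.
have fnM : monoid_morphism fn.
  split=> [|g h]; apply: fnE; first by rewrite rmorph1 subrr; exists 0; rewrite mul0r.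
  have := dividesD (divides_mulr h (fnP g)) (divides_mulr (cps_ofx (fn g)) (fnP h)).
  by apply: divides_eq; rewrite rmorphM /=; ring.
pose m1 := GRing.isZmodMorphism.Build R A fn fnB.
pose m2 := GRing.isMonoidMorphism.Build R A fn fnM.
pose phi : {rmorphism R -> A} := HB.pack fn m1 m2.
exists phi; split=> [t|h|a].
- apply: fnE; rewrite (_ : cps_ofx _ = cps_const t) ?subrr; first by exists 0; rewrite mul0r.
  by apply: cps_eqP => -[|i] [|j].
- split=> [h0|fh]; last by apply: fnE; rewrite rmorph0 subr0.
  by have := fnP h; rewrite (h0 : fn h = 0) rmorph0 subr0.
by apply: fnE; rewrite subrr; exists 0; rewrite mul0r.
Qed.

Lemma cps_ofx_t : cps_ofx cps1_t = cps_x :> R.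
Proof. by apply: cps_eqP => -[|[|i]] [|j]. Qed.

(** Inversion is imported from two variables through the quotient by [y]; the factorization that
    follows uses the same device. *)
Lemma cps1_invertible a : a 0%N != 0 -> invertible a.
Proof.
move=> a0; have [phi [_ _ phiE]] := smooth_morphism (@yregular_y K).
have [g E] : invertible (cps_ofx a) by apply/cps_invertible; rewrite cps_ofxE.
by exists (phi g); rewrite -(rmorph1 phi) E rmorphM phiE.
Qed.

Lemma cps1_factor a : a != 0 -> exists2 u, invertible u & a = cps1_t ^+ ford a * u.
Proof.
rewrite -cps1_val_eq0 => /fordP[ao al].
have [phi [_ _ phiE]] := smooth_morphism (@yregular_y K).
have [|g E] := @cps_divxX K (ford a) (cps_ofx a).
  by move=> i [|j] il; rewrite cps_ofxE //= al.
have E2 : a = cps1_t ^+ ford a * phi g.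
  by rewrite -{1}(phiE a) E rmorphM rmorphXn /= -cps_ofx_t phiE.
exists (phi g) => //; apply: cps1_invertible.
by move: ao; rewrite {1}E2 cps1_tXE ltnn subnn.
Qed.

Lemma cps1_divides a b : a != 0 -> (forall i, (i < ford a)%N -> b i = 0) -> divides a b.
Proof.
move=> a0 bl; have [u [v uv] aE] := cps1_factor a0.
have [->|b0] := eqVneq b 0; first by exists 0; rewrite mul0r.
have [u' _ bE] := cps1_factor b0.
have ab : (ford a <= ford b)%N.
  rewrite -cps1_val_eq0 in b0; have [bo _] := fordP b0.
  by rewrite leqNgt; apply: contra bo => /bl ->.
exists (cps1_t ^+ (ford b - ford a) * u' * v).
have av : v * a = cps1_t ^+ ford a by rewrite {1}aE mulrCA -uv mulr1.
rewrite -[RHS]mulrA av [LHS]bE -[in LHS](subnKC ab) exprD.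
by rewrite -[LHS]mulrA [LHS]mulrC.
Qed.

Lemma quotient_dim_cps1 a : a != 0 -> quotient_dim [set: A] [set b | divides a b] (ford a).
Proof.
move=> a0; rewrite -[X in quotient_dim _ _ X](size_iota 0).
apply: (@quotient_dim_forms _ _ _ _ _ _ (fun i (b : A) => b i)).
- exact: iota_uniq.
- exact: subspaceT.
- by move=> i t b c; rewrite -[LHS]/((fps_const t * b) i + c i) fps_constME.
- move=> i _; exists (cps1_t ^+ i) => // j _.
  rewrite -[cps1_t ^+ i]mulr1 cps1_tXE -[(1 : A) _]/((1 : fps K) (j - i)%N) fps1E subn_eq0.
  by case: ltnP => ij; [rewrite ltn_eqF|rewrite eqn_leq ij andbT].
move=> b; split=> [[g ->]|[_ H]].
  split=> // i; rewrite mem_iota add0n => /andP[_ il].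
  have /fordP[_ al] : cps1_val a != 0 by rewrite cps1_val_eq0.
  by rewrite mulrC cps1M_val; apply: (fps_low_mul (n := ford a) (m := 0)); rewrite ?addn0.
by apply: cps1_divides => // i il; apply: H; rewrite mem_iota.
Qed.

Lemma chain_rule1 (phi : {rmorphism R -> A}) :
  (forall t, phi (cps_const t) = cps1_const t) -> forall h,
  fps_der (phi h) = cps1_val (phi (cps_dx h)) * fps_der (phi cps_x) +
    cps1_val (phi (cps_dy h)) * fps_der (phi cps_y).
Proof.
move=> phiC h; pose psi : {rmorphism R -> fps K} := (@cps1_val K \o phi)%FUN.
by apply: (@chain_rule _ psi) => t; rewrite /= phiC.
Qed.

Lemma morph1_local (phi : {rmorphism R -> A}) :
  (forall t, phi (cps_const t) = cps1_const t) ->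
  forall h, h 0%N 0%N = 0 -> phi h 0%N = 0.
Proof.
move=> phiC h; pose psi : {rmorphism R -> fps K} := (@cps1_val K \o phi)%FUN.
by apply: (@morph_local _ psi) => t; rewrite /= phiC.
Qed.

Lemma morph1_origin (phi : {rmorphism R -> A}) :
  (forall t, phi (cps_const t) = cps1_const t) ->
  forall h, phi h 0%N = h 0%N 0%N.
Proof.
move=> phiC h; have := morph1_local phiC (h := h - cps_const (h 0%N 0%N)).
rewrite cpsBE subrr rmorphB phiC => /(_ erefl) /eqP.
rewrite -[X in X == 0]/(phi h 0%N - h 0%N 0%N) subr_eq0; exact/eqP.
Qed.

End OneVariableRing.

(** * Parametrized curves *)

Section Parametrization.
Variable K : numClosedFieldType.
Local Notation R := (cps K).
Local Notation A := (cps1 K).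
Implicit Types (f g h : cps K).

(* The normalization of [R / (f)] is [I -> A], through the branches [phi i];  *)
(* it has dimension [d] over [R / (f)]. The regular differential form         *)
(* [dx / f_y = - dy / f_x] is [(w i)^-1 dt] on the branch [i], and [ord w i]  *)
(* is the exponent of the conductor.                                          *)
Definition parametrized f d (I : finType) (phi : I -> {rmorphism R -> A})
    (w : I -> fps K) : Prop :=
  [/\ forall i t, phi i (cps_const t) = cps1_const t,
    forall h, (forall i, phi i h = 0) <-> divides f h,
    quotient_dim [set: I -> A] [set n | exists h, forall i, n i = phi i h] d,
    exists k, forall n : I -> A, exists h, forall i, phi i h = cps1_t ^+ k * n i &
    [/\ forall i, w i != 0,
      forall i, cps1_val (phi i (cps_dy f)) = w i * fps_der (phi i cps_x),
      forall i, cps1_val (phi i (cps_dx f)) = - (w i * fps_der (phi i cps_y)) &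
      (\sum_i ford (w i) = d.*2)%N]].

Definition resolved f d := exists (I : finType) phi w, @parametrized f d I phi w.

Lemma subspace_image (I : finType) (phi : I -> {rmorphism R -> A}) (S : set R) :
  (forall i t, phi i (cps_const t) = cps1_const t) -> subspace S ->
  subspace [set n : I -> A | exists2 h, S h & forall i, n i = phi i h].
Proof.
move=> phiC sS; split=> [|a u v [h Sh hE] [g Sg gE]].
  by exists 0; [exact: sS.1|move=> i; rewrite rmorph0].
exists (a *: h + g); first exact: sS.2.
move=> i; rewrite -[a *: h]/(cps_const a * h) rmorphD rmorphM phiC -hE -gE.
by [].
Qed.

Lemma subspace_range (I : finType) (phi : I -> {rmorphism R -> A}) :
  (forall i t, phi i (cps_const t) = cps1_const t) ->
  subspace [set n : I -> A | exists h, forall i, n i = phi i h].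
Proof.
move=> phiC; rewrite (_ : [set n | _] = [set n : I -> A | exists2 h, [set: R] h & forall i, n i = phi i h]).
  by apply: subspace_image => //; exact: subspaceT.
by apply/seteqP; split=> n [h]; [exists h|exists h].
Qed.

Lemma resolved_unit f : f 0%N 0%N != 0 -> resolved f 0.
Proof.
move=> /cps_invertible[g E].
exists void, (fun i : void => match i return {rmorphism R -> A} with end),
  (fun i : void => match i return fps K with end).
split; [by case| |  |by exists 0%N => n; exists 0; case|split; try by case].
- move=> h; split=> // _; exists (h * g); by rewrite -mulrA -E mulr1.
- rewrite (_ : [set n | _] = [set: void -> A]); first exact/quotient_dim_refl/subspaceT.
  by apply/seteqP; split=> // n _; exists 0; case.
- by rewrite big1 // => -[].
Qed.

(** With [x] as parameter, [dx = dt], so [w] is the unit [f_y]. *)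
Lemma resolved_smooth f : f 0%N 0%N = 0 -> f 0%N 1%N != 0 -> resolved f 0.
Proof.
move=> f0 f1; have fr : yregular 1 f by split=> // -[].
have [phi [phiC phik phiE]] := smooth_morphism fr.
have phx : phi cps_x = cps1_t by rewrite -cps_ofx_t phiE.
have dt : fps_der (cps1_t : A) = 1 by apply/fpsP => -[|i] //=; rewrite mul0rn.
have w0 : cps1_val (phi (cps_dy f)) 0%N != 0.
  by rewrite morph1_origin.
exists unit, (fun=> phi), (fun=> cps1_val (phi (cps_dy f))).
split=> //.
- move=> h; rewrite -phik; split=> [/(_ tt)//|h0 _]; exact: h0.
- rewrite (_ : [set n | _] = [set: unit -> A]); first exact/quotient_dim_refl/subspaceT.
  by apply/seteqP; split=> // n _; exists (cps_ofx (n tt)) => -[]; rewrite phiE.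
- by exists 0%N => n; exists (cps_ofx (n tt)) => -[]; rewrite phiE expr0 mul1r.
split=> [_|_|_|].
- exact: ford_neq0 w0.
- by rewrite phx dt mulr1.
- have := chain_rule1 phiC f; rewrite phx dt mulr1.
  have -> : phi f = 0 by apply/phik; exists 1; rewrite mul1r.
  rewrite (_ : fps_der (0 : A) = 0); last by apply/fpsP => i; rewrite /= mul0rn.
  by move/eqP; rewrite eq_sym addr_eq0 => /eqP.
- by rewrite big1 // => _ _; apply: ford_0.
Qed.

(** Exchanging the coordinates changes the sign of [dx / f_y], hence of [w]. *)
Lemma resolved_swap f d : resolved f d -> resolved (cps_swap f) d.
Proof.
move=> [I [phi [w [phiC phik phid [k phic] [w0 wy wx sw]]]]].
exists I, (fun i => phi i \o @cps_swap K)%FUN, (fun i => - w i); split.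
- by move=> i t; rewrite /= cps_swap_const phiC.
- move=> h; rewrite -[h in X in _ <-> X]cps_swapK /=; split.
    by move=> /phik[g ->]; exists (cps_swap g); rewrite rmorphM.
  move=> [g /(congr1 (@cps_swap K))]; rewrite rmorphM /= !cps_swapK => E; apply/phik.
  by rewrite E; exists (cps_swap g).
- rewrite (_ : [set n | _] = [set n | exists h, forall i, n i = phi i h]) //.
  apply/seteqP; split=> n [h hE]; first by exists (cps_swap h).
  by exists (cps_swap h) => i; rewrite /= cps_swapK.
- by exists k => n; have [h hE] := phic n; exists (cps_swap h) => i; rewrite /= cps_swapK.
split=> [i|i|i|].
- by rewrite oppr_eq0.
- by rewrite /= cps_dy_swap' cps_swapK wx cps_swap_x mulNr.
- by rewrite /= cps_dx_swap cps_swapK wy cps_swap_y mulNr opprK.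
- by rewrite -sw; apply: eq_bigr => i _; rewrite fordN.
Qed.

Lemma vanish_dx k f : vanish k.+1 f -> vanish k (cps_dx f).
Proof. by move=> fk i j ij; rewrite /= (fk i.+1 j) ?mul0rn. Qed.

Lemma vanish_dy k f : vanish k.+1 f -> vanish k (cps_dy f).
Proof. by move=> fk i j ij; rewrite /= (fk i j.+1) ?mul0rn // addnS. Qed.

Lemma derivation_ext (sg : {rmorphism R -> R}) (S T : R -> R) :
  zmod_morphism S -> zmod_morphism T ->
  (forall k f, vanish k.+1 f -> vanish k (S f)) ->
  (forall k f, vanish k.+1 f -> vanish k (T f)) ->
  (forall f g, S (f * g) = S f * sg g + sg f * S g) ->
  (forall f g, T (f * g) = T f * sg g + sg f * T g) ->
  (forall s, S (cps_const s) = 0) -> (forall s, T (cps_const s) = 0) ->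
  S cps_x = T cps_x -> S cps_y = T cps_y -> S =1 T.
Proof.
move=> SB TB Sv Tv SM TM Sc Tc Sx Sy; apply: vanish_ext1 => // s i j.
have X f n : S f = T f -> S (f ^+ n) = T (f ^+ n).
  move=> f0; elim: n => [|n IH]; last by rewrite exprS SM TM f0 IH.
  by rewrite expr0 -(rmorph1 (@cps_const K)) Sc Tc.
rewrite (SM (cps_const s)) (TM (cps_const s)) Sc Tc.
rewrite (SM (cps_x ^+ i)) (TM (cps_x ^+ i)) (X cps_x) // (X cps_y) //.
Qed.

Lemma cps_der_shear t f : cps_dx (shear t f) = shear t (cps_dx f) /\
  cps_dy (shear t f) = shear t (cps_const t * cps_dx f + cps_dy f).
Proof.
pose T := fun h => shear t (cps_const t * cps_dx h + cps_dy h).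
have sv k h : vanish k h -> vanish k (shear t h) by exact: cps_comp_vanish.
split; move: f.
  apply: (@derivation_ext (shear t) (fun h => cps_dx (shear t h)) (fun h => shear t (cps_dx h))).
  - by move=> f g; rewrite raddfB cps_dxB.
  - by move=> f g; rewrite cps_dxB raddfB.
  - by move=> k f fk; apply/vanish_dx/sv.
  - by move=> k f fk; apply/sv/vanish_dx.
  - by move=> f g; rewrite rmorphM cps_dxM.
  - by move=> f g; rewrite cps_dxM rmorphD !rmorphM.
  - by move=> s; rewrite shear_const cps_dx_const.
  - by move=> s; rewrite cps_dx_const rmorph0.
  - rewrite shear_x cps_dx_x rmorph1 -[cps_const t * cps_y]opprK cps_dxB cps_dx_x -mulrN cps_dxM.
    by rewrite cps_dx_const -[- cps_y]sub0r cps_dxB cps_dx_y -(rmorph0 (@cps_const K)) cps_dx_const rmorph0; ring.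
  - by rewrite shear_y cps_dx_y rmorph0.
apply: (@derivation_ext (shear t) (fun h => cps_dy (shear t h)) T).
- by move=> f g; rewrite raddfB cps_dyB.
- by move=> f g; rewrite /T cps_dxB cps_dyB -raddfB; congr (shear t _); ring.
- by move=> k f fk; apply/vanish_dy/sv.
- move=> k f fk; apply/sv/vanishD; last exact: vanish_dy.
  by apply: vanishMl; apply: vanish_dx.
- by move=> f g; rewrite rmorphM cps_dyM.
- move=> f g; rewrite /T cps_dxM cps_dyM -!rmorphM -rmorphD; congr (shear t _); ring.
- by move=> s; rewrite shear_const cps_dy_const.
- by move=> s; rewrite /T cps_dx_const cps_dy_const mulr0 addr0 rmorph0.
- rewrite /T shear_x cps_dx_x cps_dy_x addr0 mulr1 shear_const -[cps_const t * cps_y]opprK cps_dyB.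
  rewrite cps_dy_x -mulrN cps_dyM cps_dy_const -[- cps_y]sub0r cps_dyB cps_dy_y.
  by rewrite -(rmorph0 (@cps_const K)) cps_dy_const rmorph0; ring.
- by rewrite /T shear_y cps_dx_y cps_dy_y mulr0 add0r rmorph1.
Qed.

(** A shear has Jacobian one, so the differential form and its [w] are unchanged. *)
Lemma parametrized_shear t f d (I : finType) (phi : I -> {rmorphism R -> A}) w :
  parametrized f d phi w -> parametrized (shear t f) d (fun i => phi i \o shear (- t))%FUN w.
Proof.
move=> [phiC phik phid [k phic] [w0 wy wx sw]]; split.
- by move=> i s; rewrite /= shear_const phiC.
- move=> h; split.
    move=> /phik[g E]; exists (shear t g); rewrite -{1}(shearK t h) E; exact: rmorphM.
  move=> [g E]; apply/phik; exists (shear (- t) g).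
  by rewrite E; apply: etrans (rmorphM _ _ _) _; congr (_ * _); apply: shearNK.
- rewrite (_ : [set n | _] = [set n | exists h, forall i, n i = phi i h]) //.
  apply/seteqP; split=> n [h hE]; first by exists (shear (- t) h).
  by exists (shear t h) => i; rewrite /= shearNK.
- by exists k => n; have [h hE] := phic n; exists (shear t h) => i; rewrite /= shearNK.
have [Ex Ey] := cps_der_shear t f.
have der (a b : A) s : fps_der (a + cps1_const s * b : A) = fps_der a + fps_const s * fps_der b.
  apply/fpsP => i; rewrite fpsDE fps_constME /= mulrnAr -mulrnDl; congr (_ *+ _).
  by rewrite -(fps_constME s b).
have xE i : phi i (shear (- t) cps_x) = phi i cps_x + cps1_const (- t) * phi i cps_y.
  by rewrite shear_x rmorphD rmorphM phiC.
split=> // i.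
- rewrite Ey /= shearNK rmorphD rmorphM phiC xE der mulrDr -wy.
  rewrite -[cps1_val _]/(fps_const t * cps1_val (phi i (cps_dx f)) + cps1_val (phi i (cps_dy f))).
  by rewrite wx rmorphN; ring.
- by rewrite Ex /= shearNK shear_y wx.
Qed.

End Parametrization.

(** * Intersection numbers and the inductive step *)

Section Intersection.
Variable K : numClosedFieldType.
Local Notation R := (cps K).
Local Notation A := (cps1 K).
Implicit Types (f g h : cps K).

Lemma subspace_ideal1 (a : A) : subspace [set b : A | divides a b].
Proof.
split=> [|t u v [x ->] [y ->]]; first by exists 0; rewrite mul0r.
exists (cps1_const t * x + y); rewrite -[t *: _]/(cps1_const t * _); ring.
Qed.

(** Let [N] be the normalization and [O] the local ring. Multiplication by [g] identifies [N / O]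
    with [gN / gO]; in the codimension of [gO] in [N], computed through [gN] and through [O], the
    two copies of [d] cancel. *)
Lemma intersection f d (I : finType) (phi : I -> {rmorphism R -> A}) w g :
  parametrized f d phi w -> (forall i, phi i g != 0) ->
  quotient_dim [set: R] [set h | exists a b, h = a * f + g * b] (\sum_i ford (phi i g)).
Proof.
move=> [phiC phik phid _ _] g0.
pose O := [set n : I -> A | exists h, forall i, n i = phi i h].
pose gN := [set n : I -> A | forall i, divides (phi i g) (n i)].
pose gO := [set n : I -> A | exists h, forall i, n i = phi i (g * h)].
have sO : subspace O by exact: subspace_range.
have sgN : subspace gN.
  split=> [i|t u v ug vg i]; first by exists 0; rewrite mul0r.
  exact: (subspace_ideal1 (phi i g)).2 (ug i) (vg i).
have sgO : subspace gO.
  split=> [|t u v [a aE] [b bE]]; first by exists 0 => i; rewrite mulr0 rmorph0.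
  exists (t *: a + b) => i; rewrite -[(t *: u + v) i]/(cps1_const t * u i + v i) aE bE.
  by rewrite -[t *: a]/(cps_const t * a) !rmorphM rmorphD rmorphM phiC; ring.
have gON : gO `<=` gN.
  by move=> n [h hE] i; rewrite hE rmorphM mulrC; exists (phi i h).
have gOO : gO `<=` O by move=> n [h hE]; exists (g * h).
have q1 : quotient_dim [set: I -> A] gN (\sum_i ford (phi i g)).
  have := @quotient_dim_joint K (I -> A) I (fun=> A) (index_enum I) [set: I -> A] (fun=> setT)
    (fun i => [set b : A | divides (phi i g) b]) (fun i (n : I -> A) => n i)
    (fun i => ford (phi i g)) (index_enum_uniq I) (@subspaceT _ _) (fun=> @subspaceT _ _)
    (fun i => subspace_ideal1 (phi i g)).
  rewrite (_ : [set v | setT v /\ _] = gN); last first.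
    apply/seteqP; split=> [n [_ nP] i|n nP]; first by apply: nP; rewrite mem_index_enum.
    by split=> // i _; apply: nP.
  apply=> // [i _|i u _ _]; first exact: quotient_dim_cps1.
  exists (fun j => if j == i then u else 0); split=> //.
    by rewrite /= eqxx subrr; exists 0; rewrite mul0r.
  by move=> j _ /negPf ji; rewrite /= ji; exists 0; rewrite mul0r.
have q2 : quotient_dim gN gO d.
  have lg : linear (fun n : I -> A => (fun i => phi i g * n i) : I -> A).
    move=> t u v; apply/funext => i.
    rewrite -[LHS]/(phi i g * (cps1_const t * u i + v i)).
    by rewrite -[RHS]/(cps1_const t * (phi i g * u i) + phi i g * v i); ring.
  apply/(quotient_dim_map d lg (@subspaceT _ _) sO sgN sgO) => //.
  - by move=> n _ i; exists (n i); rewrite mulrC.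
  - move=> n _; split=> [[h hE]|[h hE]]; exists h => i; first by rewrite rmorphM hE.
    by apply: (cps1_mulI (g0 i)); rewrite hE rmorphM.
  - move=> n ng; exists (fun i => projT1 (cid (ng i))) => //.
    exists 0 => i; rewrite mulr0 rmorph0.
    rewrite -[LHS]/(n i - phi i g * projT1 (cid (ng i))); case: cid => b /= ->; ring.
have q3 := quotient_dim_add (@subspaceT _ _) sgN sgO gON (@subsetT _ _) q1 q2.
have [m [k [hm hk E]]] := quotient_dim_split (@subspaceT _ _) sO sgO gOO (@subsetT _ _) q3.
have md : m = d by exact: (quotient_dim_uniq (@subspaceT _ _) sO hm phid).
have -> : (\sum_i ford (phi i g) = k)%N by apply: (@addIn d); rewrite E md addnC.
have lp : linear (fun h => (fun i => phi i h) : I -> A).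
  move=> t u v; apply/funext => i; rewrite -[t *: u]/(cps_const t * u) rmorphD rmorphM phiC.
  by [].
apply: (iffRL (quotient_dim_map k lp (@subspaceT _ _) (subspace_ideal2 f g) sO sgO _ _ _)) hk.
- by move=> h _; exists h.
- move=> h _; split=> [[a [b ->]]|[b bE]].
    exists b => i; rewrite rmorphD (_ : phi i (a * f) = 0) ?add0r //.
    by apply: (iffRL (phik (a * f))); exists a.
  have /phik[a E'] : forall i, phi i (h - g * b) = 0.
    by move=> i; rewrite rmorphB -bE subrr.
  by exists a, b; rewrite -E' subrK.
move=> n [h hE]; exists h => //; exists 0 => i; rewrite mulr0 rmorph0.
by rewrite -[LHS]/(n i - phi i h) hE subrr.
Qed.

(** If both coordinates vanished on the branch, only constants would occur there, whereas some
    function takes the value [t^(k+1)]. *)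
Lemma parametrized_xy_neq0 f d (I : finType) (phi : I -> {rmorphism R -> A}) w i :
  parametrized f d phi w -> phi i cps_x != 0 \/ phi i cps_y != 0.
Proof.
move=> [phiC phik _ [k phic] _]; have [x0|] := eqVneq (phi i cps_x) 0; last by left.
right; apply/eqP => y0.
have [h hE] := phic (fun=> cps1_t); have := hE i.
have [a [b E]] : exists a b, h - cps_const (h 0%N 0%N) = a * cps_x + b * cps_y.
  have v1 : vanish 1 (h - cps_const (h 0%N 0%N) : R) by apply: vanish1; rewrite cpsBE subrr.
  apply: (@vanish_ideal _ _ _ v1 (fun u => exists a b, u = a * cps_x + b * cps_y)).
  - by move=> u v [a [b ->]] [a' [b' ->]]; exists (a + a'), (b + b'); ring.
  - by move=> u v [a [b ->]]; exists (u * a), (u * b); ring.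
  - by move=> [|[|//]] _; [exists 0, 1|exists 1, 0]; rewrite ?expr0 ?expr1; ring.
have -> : h = cps_const (h 0%N 0%N) + (a * cps_x + b * cps_y) by rewrite -E addrC subrK.
rewrite rmorphD rmorphD !rmorphM x0 y0 !mulr0 !addr0 phiC -exprSr.
move=> /(congr1 (fun a : A => a k.+1)); rewrite -[cps1_t ^+ _]mulr1 cps1_tXE ltnn subnn.
by move=> /esym/eqP; rewrite /= oner_eq0.
Qed.

Lemma parametrized_x_neq0 m f d (I : finType) (phi : I -> {rmorphism R -> A}) w :
  yregular m f -> (0 < m)%N -> parametrized f d phi w -> forall i, phi i cps_x != 0.
Proof.
move=> fr m0 par i; have [//|] := parametrized_xy_neq0 i par.
have [_ phik _ _ _] := par => y0; apply/eqP => x0.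
have [|a [b E]] := @regular_remainder_x K m f (cps_y ^+ m) fr.
  by move=> j jm; rewrite -[cps_y ^+ m]mulr1 cps_yXE jm.
have : phi i (cps_y ^+ m) = 0.
  rewrite E rmorphD rmorphM [phi i (_ * b)]rmorphM x0 mul0r addr0.
  by rewrite (iffRL (phik f)) ?mulr0 //; exists 1; rewrite mul1r.
by rewrite rmorphXn => /eqP; rewrite (negPf (cps1_expf_neq0 m y0)).
Qed.

Section Step.
Variables (f : R) (e : nat) (T : seq (option K)) (ml d : option K -> nat) (fc : option K -> R).
Hypotheses (e0 : (0 < e)%N) (uT : uniq T) (TE : forall c, (c \in T) = (0 < ml c)%N).
Hypothesis sT : (\sum_(c <- T) ml c = e)%N.
Hypothesis fcE : forall c, pc c f = cps_x ^+ e * fc c.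
Hypothesis fcr : forall c, yregular (ml c) (fc c).
Hypothesis inj : forall h, (forall c, c \in T -> divides (fc c) (pc c h)) -> divides f h.
Hypothesis sur : forall g : option K -> R, exists h, forall c, c \in T ->
      divides (fc c) (cps_x ^+ e.-1 * g c - pc c h).
Hypothesis codim : quotient_dim [set: option K -> R]
      [set g : option K -> R | exists h, forall c, c \in T -> divides (fc c) (g c - pc c h)]
      'C(e, 2).
Hypothesis res : forall c, c \in T -> resolved (fc c) (d c).

Let J := 'I_(size T).
Let cj (j : J) : option K := nth None T j.
Let cjT j : cj j \in T. Proof. exact: mem_nth. Qed.
Let cjI j j' : cj j = cj j' -> j = j'.
Proof. by move/eqP; rewrite nth_uniq // => /eqP/val_inj. Qed.
Let cjS c : c \in T -> exists j, cj j = c.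
Proof.
move=> cT; have lt : (index c T < size T)%N by rewrite index_mem.
by exists (Ordinal lt); rewrite /cj /= nth_index.
Qed.

(** The branches at all points of the blowup are pooled and composed with the charts. The
    codimension grows by ['C(e, 2)] and the total order of [w] by [(e-1) e], because [x] has total
    order [e] on these branches. *)
Lemma resolved_blowup : resolved f ('C(e, 2) + \sum_(c <- T) d c).
Proof.
have resj (j : J) : {I : finType & {phi : I -> {rmorphism R -> A} &
    {w | parametrized (fc (cj j)) (d (cj j)) phi w}}}.
  have /cid[I /cid[phi /cid[w P]]] := res (cjT j).
  by exists I, phi, w.
have [I_ [phi_ [w_ P]]] : exists (I_ : J -> finType) (phi_ : forall j, I_ j -> {rmorphism R -> A})
    (w_ : forall j, I_ j -> fps K),
    forall j, parametrized (fc (cj j)) (d (cj j)) (@phi_ j) (@w_ j).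
  exists (fun j => projT1 (resj j)), (fun j => projT1 (projT2 (resj j))).
  exists (fun j => projT1 (projT2 (projT2 (resj j)))) => j.
  exact: projT2 (projT2 (projT2 (resj j))).
pose I : finType := {j : J & I_ j}.
pose phi (u : I) : {rmorphism R -> A} := (phi_ (tag u) (tagged u) \o pc (cj (tag u)))%FUN.
pose xi (u : I) := phi_ (tag u) (tagged u) cps_x.
have xi0 u : xi u != 0.
  by apply: (parametrized_x_neq0 (fcr (cj (tag u))) _ (P (tag u))); rewrite -TE.
(* [f_y] pulls back to [x^(e-1)] times the derivative of the strict transform. In the exchanged
   coordinates of [None], [f_x] does so instead, and the sign is that of [dx / f_y = - dy / f_x]. *)
pose w (u : I) := let W := cps1_val (xi u) ^+ e.-1 * w_ (tag u) (tagged u) in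
  if cj (tag u) is Some _ then W else - W.
have phiC u t : phi u (cps_const t) = cps1_const t.
  by have [H _ _ _ _] := P (tag u); rewrite /= pc_const H.
have phik h : (forall u, phi u h = 0) <-> divides f h.
  split=> [h0|[g ->] u].
    apply: inj => c /cjS[j <-]; have [_ H _ _ _] := P j; apply/H => i.
    exact: (h0 (Tagged I_ i)).
  have [_ H _ _ _] := P (tag u); rewrite /= rmorphM /= fcE mulrA; apply: (iffRL (H _)).
  by exists (pc (cj (tag u)) g * cps_x ^+ e).
pose O := [set n : I -> A | exists h, forall u, n u = phi u h].
pose M := [set n : I -> A | forall j, exists g, forall i, n (Tagged I_ i) = phi_ j i g].
have sO : subspace O by exact: subspace_range.
have sM_ j : subspace [set n : I_ j -> A | exists g, forall i, n i = phi_ j i g].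
  by apply: subspace_range; have [] := P j.
have sM : subspace M.
  split=> [j|t u v uM vM j]; first by exists 0 => i; rewrite rmorph0.
  have [g gE] := uM j; have [h hE] := vM j; have [C _ _ _ _] := P j.
  exists (cps_const t * g + h) => i; rewrite rmorphD rmorphM C -gE -hE.
  by [].
have OM : O `<=` M by move=> n [h hE] j; exists (pc (cj j) h) => i; rewrite hE.
have sd : (\sum_j d (cj j) = \sum_(c <- T) d c)%N.
  by rewrite (big_nth None) big_mkord.
have q1 : quotient_dim [set: I -> A] M (\sum_j d (cj j)).
  have lp j : linear (fun n : I -> A => (fun i => n (Tagged I_ i)) : I_ j -> A) by [].
  have := @quotient_dim_joint K (I -> A) J (fun j => I_ j -> A) (index_enum J) [set: I -> A]
    (fun=> setT) (fun j => [set n : I_ j -> A | exists g, forall i, n i = phi_ j i g])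
    (fun j (n : I -> A) i => n (Tagged I_ i))
    (fun j => d (cj j)) (index_enum_uniq J) (@subspaceT _ _) (fun=> @subspaceT _ _) sM_ lp.
  rewrite (_ : [set v | setT v /\ _] = M); last first.
    apply/seteqP; split=> [n [_ nP] j|n nP]; first by apply: nP; rewrite mem_index_enum.
    by split=> // j _; apply: nP.
  apply=> // [j _|j u _ _]; first by have [] := P j.
  exists (untag 0 u); split=> // [|j' _ j'j].
    exists 0 => i; rewrite rmorph0 -[LHS]/(u i - untag 0 u (Tagged I_ i)).
    by rewrite (untagE _ _ (erefl j : tag (Tagged I_ i) = j)) subrr.
  by exists 0 => i; rewrite rmorph0 untag_dflt.
have q2 : quotient_dim M O 'C(e, 2).
  pose Phi (g : option K -> R) : I -> A := fun u => phi_ (tag u) (tagged u) (g (cj (tag u))).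
  have lP : linear Phi.
    move=> t g h; apply/funext => u; have [C _ _ _ _] := P (tag u).
    rewrite /Phi -[(t *: g + h) _]/(cps_const t * g (cj (tag u)) + h (cj (tag u))).
    by rewrite rmorphD rmorphM C.
  pose U := [set g : option K -> R | exists h, forall c, c \in T -> divides (fc c) (g c - pc c h)].
  have sU : subspace U.
    split=> [|t g h [a aP] [b bP]]; first by exists 0 => c _; rewrite rmorph0 subr0; exists 0; rewrite mul0r.
    exists (cps_const t * a + b) => c cT.
    have := dividesD (divides_mulr (cps_const t) (aP c cT)) (bP c cT); apply: divides_eq.
    by rewrite rmorphD rmorphM /= pc_const -[(t *: g + h) c]/(cps_const t * g c + h c); ring.
  apply: (iffLR (quotient_dim_map _ lP (@subspaceT _ _) sU sM sO _ _ _)) codim.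
  - by move=> g _ j; exists (g (cj j)).
  - move=> g _; split=> [[h hP]|[h hE]]; exists h; [move=> u|move=> c].
      apply/eqP; rewrite -subr_eq0 -rmorphB; apply/eqP; have [_ H _ _ _] := P (tag u).
      exact: (iffRL (H _)) (hP _ (cjT _)) _.
    move=> /cjS[j <-]; have [_ H _ _ _] := P j; apply/H => i; rewrite rmorphB.
    by have := hE (Tagged I_ i); rewrite /Phi /= => ->; rewrite subrr.
  - move=> n nM; exists (fun c => if pselect (exists j, cj j = c) is left ex
      then projT1 (cid (nM (projT1 (cid ex)))) else 0) => //.
    exists 0 => -[j i]; rewrite rmorph0 -[LHS]/(n (Tagged I_ i) - Phi _ (Tagged I_ i)).
    rewrite /Phi /=; case: pselect => [ex|[]]; last by exists j.
    case: (cid ex) => j' /= /cjI j'j; subst j'.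
    by case: cid => g /= gE; rewrite -gE subrr.
exists I, phi, w; split=> //.
- by rewrite addnC -sd; apply: (quotient_dim_add (@subspaceT _ _) sM sO OM (@subsetT _ _)).
- have kj j : {k | forall n : I_ j -> A, exists h, forall i, phi_ j i h = cps1_t ^+ k * n i}.
    by apply/cid; have [] := P j.
  (* A multiple of [z] descends in two stages: the power of [t] brings it into the local rings of
     the strict transforms, and [x^(e-1)] brings it into the base ring by [sur]. *)
  pose z u := xi u ^+ e.-1 * cps1_t ^+ projT1 (kj (tag u)).
  have z0 u : z u != 0 by rewrite cps1_mul_neq0 ?cps1_expf_neq0 ?cps1_t_neq0.
  exists (\sum_u ford (z u))%N => n.
  have ex u : divides (z u) (cps1_t ^+ (\sum_u ford (z u))%N * n u).
    apply: cps1_divides => // i iz; rewrite cps1_tXE ifT //; apply: leq_trans iz _.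
    by rewrite (bigD1 u) //= leq_addr.
  pose n' u := projT1 (cid (ex u)).
  have n'P u : cps1_t ^+ (\sum_u ford (z u))%N * n u = n' u * z u by rewrite /n'; case: cid.
  have exg c : exists g, forall j i, cj j = c -> phi_ j i g = cps1_t ^+ projT1 (kj j) * n' (Tagged I_ i).
    have [[j jc]|nj] := pselect (exists j, cj j = c); last first.
      by exists 0 => j i jc; case: nj; exists j.
    have [g gE] := projT2 (kj j) (fun i => n' (Tagged I_ i)); exists g => j' i j'c.
    by have jj : j' = j by [apply: cjI; rewrite jc]; subst j'.
  have [h hP] := sur (fun c => projT1 (cid (exg c))); exists h => u.
  have [_ H _ _ _] := P (tag u); have := iffRL (H _) (hP _ (cjT (tag u))) (tagged u).
  rewrite rmorphB => /eqP; rewrite subr_eq0 => /eqP; rewrite /= => <-.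
  rewrite rmorphM rmorphXn; case: cid => g /= /(_ (tag u) (tagged u) erefl) ->.
  by rewrite n'P /z -[Tagged I_ _]/(existT _ _ _) /tagged /tag; case: u {H} => j i /=; ring.
have fder_xi u : cps1_val (xi u) != 0 by rewrite cps1_val_eq0.
have xi00 u : xi u 0%N = 0.
  by have [C _ _ _ _] := P (tag u); rewrite /xi (morph1_origin (C _)).
have dxi u := ford_der (fder_xi u) (xi00 u).
have X0 : (cps_x : R) <> 0 by move/(congr1 (fun h : R => h 1%N 0%N))/eqP; rewrite /= oner_eq0.
have pull a g c : pb (Some a) g = cps_x ^+ e * fc c ->
    pb (Some a) (cps_dy g) = cps_x ^+ e.-1 * cps_dy (fc c).
  move=> E; apply: (cps_mulI X0); rewrite -cps_dy_pb E cps_dy_xX mulrA -exprS prednK //.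
have phif u : phi u f = 0 by apply: (iffRL (phik f)); exists 1; rewrite mul1r.
have chain u : cps1_val (phi u (cps_dx f)) * fps_der (phi u cps_x) +
    cps1_val (phi u (cps_dy f)) * fps_der (phi u cps_y) = 0.
  rewrite -(chain_rule1 (phiC u)) phif; by apply/fpsP => i; rewrite /= mul0rn.
have w0 u : cps1_val (xi u) ^+ e.-1 * w_ (tag u) (tagged u) != 0.
  by have [_ _ _ _ [H _ _ _]] := P (tag u); rewrite fps1_mul_neq0 ?fps1_expf_neq0.
have wxy u : cps1_val (phi u (cps_dy f)) = w u * fps_der (phi u cps_x) /\
    cps1_val (phi u (cps_dx f)) = - (w u * fps_der (phi u cps_y)).
  have [_ _ _ _ [_ wy _ _]] := P (tag u); have [d0 _] := dxi u.
  have phE g : phi u g = phi_ (tag u) (tagged u) (pc (cj (tag u)) g) by [].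
  have := chain u; have := wy (tagged u); have := fcE (cj (tag u)).
  rewrite !phE /w; case: (cj (tag u)) => [a|] E wyu.
    have -> : pc (Some a) cps_x = cps_x :> R by exact: pb_x.
    have -> : cps1_val (phi_ (tag u) (tagged u) (pc (Some a) (cps_dy f))) =
        cps1_val (xi u) ^+ e.-1 * w_ (tag u) (tagged u) * fps_der (xi u).
      rewrite [pc _ _](pull _ _ _ E) rmorphM rmorphXn -mulrA -wyu.
      by rewrite -cps1X_val.
    move=> ch; split=> //; apply: (fps1_mulI d0); apply/eqP.
    rewrite mulrC -subr_eq0 -{}ch; apply/eqP; ring.
  have -> : pc None cps_y = cps_x :> R.
    by rewrite -[LHS]/(pb (Some 0) (cps_swap cps_y)) cps_swap_y pb_x.
  have -> : cps1_val (phi_ (tag u) (tagged u) (pc None (cps_dx f))) =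
      cps1_val (xi u) ^+ e.-1 * w_ (tag u) (tagged u) * fps_der (xi u).
    have -> : pc None (cps_dx f) = cps_x ^+ e.-1 * cps_dy (fc None).
      by rewrite -(pull _ _ _ E) cps_dy_swap'.
    by rewrite rmorphM rmorphXn -mulrA -wyu -cps1X_val.
  move=> ch; split; last by ring.
  apply: (fps1_mulI d0); apply/eqP.
  rewrite mulrC -subr_eq0 -{}ch; apply/eqP; ring.
split=> [u|u|u|].
- by rewrite /w; case: (cj (tag u)); rewrite ?oppr_eq0.
- exact: (wxy u).1.
- exact: (wxy u).2.
have wE u : ford (w u) = (e.-1 * ford (xi u) + ford (w_ (tag u) (tagged u)))%N.
  have [_ _ _ _ [H _ _ _]] := P (tag u).
  rewrite /w; transitivity (ford (cps1_val (xi u) ^+ e.-1 * w_ (tag u) (tagged u))).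
    by case: (cj (tag u)); rewrite ?fordN.
  by rewrite fordM ?fps1_expf_neq0 // fordX.
(* The intersection number of the strict transform with the exceptional curve, computed on the
   branches and by Weierstrass division. *)
have mlE j : (\sum_i ford (phi_ j i cps_x) = ml (cj j))%N.
  have xj i : phi_ j i cps_x != 0 by exact: (xi0 (Tagged I_ i)).
  have := intersection (P j) xj; have := quotient_dim_weierstrass 1 (fcr (cj j)).
  rewrite mul1n expr1 => H1 H2.
  exact: (quotient_dim_uniq (@subspaceT _ _) (subspace_ideal2 _ _) H2 H1).
under eq_bigr do rewrite wE.
rewrite big_split -big_distrr /=.
rewrite -(sig_big_dep xpredT (fun _ => xpredT) (fun j i => ford (phi_ j i cps_x))) /=.
rewrite -(sig_big_dep xpredT (fun _ => xpredT) (fun j i => ford (w_ j i))) /=.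
under eq_bigr do rewrite mlE.
under [X in (_ + X)%N]eq_bigr => j _ do [have [_ _ _ _ [_ _ _ H]] := P j; rewrite H].
have -> : (\sum_j ml (cj j) = e)%N by rewrite -sT [RHS](big_nth None) big_mkord.
have -> : (\sum_j (d (cj j)).*2 = (\sum_(c <- T) d c).*2)%N.
  by rewrite -sd -muln2 big_distrl /=; apply: eq_bigr => j _; rewrite muln2.
have E := mul_bin_diag e 1; rewrite bin1 in E.
by rewrite doubleD mulnC E mul2n.
Qed.

End Step.
End Intersection.

(** * The tree of infinitely near points *)

Section Trees.
Variable K : numClosedFieldType.
Local Notation R := (cps K).
Local Notation A := (cps1 K).
Implicit Types (f g h u v p : cps K) (c : option K) (P Q : Defs.point K) (B : set (Defs.point K)).

Lemma hform_ex f : f <> 0 -> exists e, vanish e f /\ hform e f != 0.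
Proof.
move=> f0; pose N n := `[< exists2 i, (i <= n)%N & f (n - i)%N i != 0 >].
have ex : exists n, N n.
  apply: contrapT => nN; apply: f0; apply: cps_eqP => i j; rewrite cps0E; apply/eqP.
  apply: contrapT => fij; apply: nN; exists (i + j)%N; apply/asboolP.
  by exists j; rewrite ?leq_addl // addnK; apply/negP.
case: (ex_minnP ex) => e /asboolP[i ie fi] emin; exists e; split.
  move=> j k jk; apply/eqP; apply: contraTT jk => fjk; rewrite -leqNgt; apply: emin.
  by apply/asboolP; exists k; rewrite ?leq_addl // addnK.
by apply: contra_neq fi => /polyP/(_ i); rewrite hform_coef ie coef0.
Qed.

Lemma orderE e f : vanish e f -> hform e f != 0 -> Defs.order f = e.
Proof.
move=> fv f0.
have [i ie fi] : exists2 i, (i <= e)%N & f (e - i)%N i <> 0.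
  apply: contrapT => nf; case/eqP: f0; apply/polyP => i; rewrite hform_coef coef0.
  case: leqP => // ie; apply: contrapT => fi; apply: nf; by exists i.
apply: xget_unique => [|n [nv [j [k [jk fjk]]]]].
  by split=> //; exists (e - i)%N, i; split=> //; apply: subnK.
apply/eqP; rewrite eqn_leq; apply/andP; split.
  by rewrite leqNgt; apply/negP => en; apply: fi; apply: nv; rewrite subnK.
by rewrite leqNgt; apply/negP => ne; apply: fjk; apply: fv; rewrite jk.
Qed.

(** It passes between the coordinates of [pc], where the exceptional curve is always [x = 0], and
    those of [chart]. *)
Definition uncross c h : R := if c is Some _ then h else cps_swap h.

Lemma uncrossK c : involutive (uncross c).
Proof. by case: c => [a|] h //=; rewrite cps_swapK. Qed.

Lemma uncrossM c f g : uncross c (f * g) = uncross c f * uncross c g.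
Proof. by case: c => [a|] //=; apply: rmorphM. Qed.

Lemma uncrossX c f n : uncross c (f ^+ n) = uncross c f ^+ n.
Proof. by case: c => [a|] //=; apply: rmorphXn. Qed.

Lemma uncross00 c h : uncross c h 0%N 0%N = h 0%N 0%N.
Proof. by case: c. Qed.

Lemma pullback1_pc f c : pullback1 f c = uncross c (pc c f).
Proof. by case: c => [a|] //; apply: pb_None. Qed.

Lemma exceptional_uncross c : exceptional c = uncross c cps_x.
Proof. by case: c => [a|] //=; rewrite cps_swap_x. Qed.

Lemma cps_x_neq0 : (cps_x : R) <> 0.
Proof. by move/(congr1 (fun h : R => h 1%N 0%N))/eqP; rewrite /= oner_eq0. Qed.

Lemma regular_ndivides_x m u : yregular m u -> ~ divides cps_x u.
Proof.
move=> [_ um] [g E]; case/eqP: um.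
by rewrite E mulrC -[cps_x]expr1 cps_xXE.
Qed.

(** The choice made in [strict1] is forced: a [y]-regular series is not divisible by [x], which
    determines the power of [x] and the cofactor. *)
Lemma strict1E f c e m g : pc c f = cps_x ^+ e * g -> yregular m g ->
  strict1 f c = uncross c g.
Proof.
move=> E gr; have nx := regular_ndivides_x gr.
have dv h : divides (exceptional c) h <-> divides cps_x (uncross c h).
  rewrite exceptional_uncross; split=> [[k ->]|[k hk]].
    by exists (uncross c k); rewrite uncrossM uncrossK.
  by exists (uncross c k); rewrite -(uncrossK c h) hk uncrossM.
apply: xget_unique; first split.
- by move/dv; rewrite uncrossK.
- by exists e; rewrite pullback1_pc E uncrossM uncrossX exceptional_uncross.
move=> h [/dv nh [k]]; rewrite pullback1_pc E exceptional_uncross => /(congr1 (uncross c)).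
rewrite uncrossK uncrossM uncrossX uncrossK => Eh.
rewrite -(uncrossK c h); congr (uncross c _); move: nh Eh; set h' := uncross c h => nh Eh.
have xX n := @cps_expf_neq0 K cps_x n cps_x_neq0.
have [ek|ke|ek] := ltngtP e k; last by apply: (cps_mulI (xX k)); rewrite -Eh ek.
  case: nx; exists (cps_x ^+ (k - e).-1 * h'); apply: (cps_mulI (xX e)).
  by rewrite Eh mulrAC -exprSr prednK ?subn_gt0 // mulrA -exprD subnKC // ltnW.
case: nh; exists (cps_x ^+ (e - k).-1 * g); apply: (cps_mulI (xX k)).
by rewrite -Eh mulrAC -exprSr prednK ?subn_gt0 // mulrA -exprD subnKC // ltnW.
Qed.

Lemma strict1_unit f c : f 0%N 0%N != 0 -> strict1 f c 0%N 0%N != 0.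
Proof.
move=> f0; have E0 : pc c f 0%N 0%N = f 0%N 0%N.
  rewrite pcE (_ : hform 0 f = (f 0%N 0%N)%:P); last first.
    by apply/polyP => -[|j]; rewrite hform_coef coefC.
  by case: c => [a|] /=; rewrite ?comp_polyC ?coefC // coef_poly coefC.
have r0 : yregular 0 (pc c f) by split=> //; rewrite E0.
by rewrite (strict1E (e := 0) _ r0) ?expr0 ?mul1r // uncross00 E0.
Qed.

Lemma strict_transformE P f : strict_transform [::] P f = foldl (@strict1 K) f P.
Proof. by rewrite /strict_transform drop0. Qed.

Lemma strict_transform_unit P f : f 0%N 0%N != 0 -> strict_transform [::] P f 0%N 0%N != 0.
Proof.
rewrite strict_transformE; elim: P f => //= c P IH f f0.
by apply: IH; apply: strict1_unit.
Qed.

Definition reduced f := forall g n, divides f (g ^+ n) -> divides f g.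

Definition smooth u := u 0%N 0%N = 0 /\ (u 0%N 1%N != 0 \/ u 1%N 0%N != 0).

(** The quotient by a smooth germ is [C{t}], a domain. *)
Lemma smooth_prime u g h : smooth u -> divides u (g * h) -> divides u g \/ divides u h.
Proof.
have main (w g' h' : R) : w 0%N 0%N = 0 -> w 0%N 1%N != 0 -> divides w (g' * h') ->
    divides w g' \/ divides w h'.
  move=> w0 w1; have [|phi [_ phik _]] := @smooth_morphism K w; first by split=> // -[].
  move=> /phik; rewrite rmorphM => gh0.
  have [g0|g0] := eqVneq (phi g') 0; first by left; apply/phik.
  by right; apply/phik; apply: (cps1_mulI g0); rewrite gh0 mulr0.
move=> [u0 [u1|u1]] gh; first exact: main gh.
have dv (w : R) : divides (cps_swap u) (cps_swap w) -> divides u w.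
  move=> [k E]; exists (cps_swap k); rewrite -(cps_swapK w) E rmorphM /= cps_swapK.
  by [].
have [||||] := main (cps_swap u) (cps_swap g) (cps_swap h) => //.
- by case: gh => k E; exists (cps_swap k); rewrite -!rmorphM E.
- by move=> /dv; left.
- by move=> /dv; right.
Qed.

Lemma resolved_smooth' f : smooth f -> resolved f 'C(Defs.order f, 2).
Proof.
move=> [f0 f1]; have -> : Defs.order f = 1%N.
  apply: orderE; first exact: vanish1.
  apply/eqP => /polyP H; have := H 0%N; have := H 1%N.
  rewrite !hform_coef !coef0 subn0 subnn /= => H1 H0.
  by case: f1; rewrite ?H0 ?H1 eqxx.
case: f1 => f1; first exact: resolved_smooth.
by rewrite -(cps_swapK f); apply: resolved_swap; apply: resolved_smooth.
Qed.

Lemma cps_mul01 f g : (f * g) 0%N 1%N = f 0%N 0%N * g 0%N 1%N + f 0%N 1%N * g 0%N 0%N.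
Proof. by rewrite cpsM_val fps2ME big_ord1 big_ord_recl big_ord1. Qed.

Lemma cps_mul10 f g : (f * g) 1%N 0%N = f 0%N 0%N * g 1%N 0%N + f 1%N 0%N * g 0%N 0%N.
Proof. by rewrite cpsM_val fps2ME big_ord_recl !big_ord1. Qed.

Lemma smooth_unit_mul (eps w : R) : eps 0%N 0%N != 0 -> smooth w -> smooth (eps * w).
Proof.
move=> e0 [w0 w1]; split; first by rewrite cpsM00 w0 mulr0.
by rewrite cps_mul01 cps_mul10 w0 !mulr0 !addr0 !mulf_eq0 !negb_or e0.
Qed.

(** An embedded resolution may stop at a node of the curve. One more blowup separates its branches
    into smooth germs, which contribute nothing, so the node contributes ['C(2, 2) = 1]. *)
Lemma resolved_node (eps u v : R) : eps 0%N 0%N != 0 -> local_coordinates u v ->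
  resolved (eps * u * v) 'C(Defs.order (eps * u * v), 2).
Proof.
move=> e0 [u0 v0 jac]; set f := eps * u * v.
have vu := vanish1 u0; have vv := vanish1 v0.
have nz (w : R) : (w 1%N 0%N != 0) || (w 0%N 1%N != 0) -> hform 1 w != 0.
  move=> w0; apply/eqP => /polyP H; have := H 0%N; have := H 1%N.
  by rewrite !hform_coef !coef0 subn0 subnn /= => H1 H0; rewrite H0 H1 eqxx in w0.
have hu : hform 1 u != 0.
  apply: nz; apply: contraPT jac; rewrite negb_or !negbK => /andP[/eqP-> /eqP->].
  by rewrite !mul0r subrr.
have hv : hform 1 v != 0.
  apply: nz; apply: contraPT jac; rewrite negb_or !negbK => /andP[/eqP-> /eqP->].
  by rewrite !mulr0 subrr.
have fv : vanish 2 f by apply: (vanishM (k := 1) (l := 1)) => //; apply: vanishMl.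
have he : hform 0 eps != 0.
  by apply: contra_neq e0 => /polyP/(_ 0%N); rewrite hform_coef coef0.
have f0 : hform 2 f != 0.
  rewrite (@hform_lead K 1 1 (eps * u)) //; last exact: vanishMl.
  by rewrite (@hform_lead K 0 1) // !mulf_neq0.
rewrite (orderE fv f0).
have [T [ml [fc [[uT TE sT] fcP inj sur codim]]]] := blowup fv f0.
suff : resolved f ('C(2, 2) + \sum_(c <- T) 0) by rewrite big1.
apply: (@resolved_blowup _ f 2 T ml (fun=> 0%N) fc) => //; try by move=> c; have [] := fcP c.
move=> c; rewrite TE => mc.
have [fcE [fc0 _]] := fcP c.
have [u' [uE u'0]] := pc_vanish c vu; have [v' [vE v'0]] := pc_vanish c vv.
have {}fcE : fc c = pc c eps * u' * v'.
  apply: (cps_mulI (@cps_expf_neq0 K cps_x 2 cps_x_neq0)); rewrite -fcE !rmorphM /= uE vE.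
  by rewrite !expr1; ring.
have pe0 : pc c eps 0%N 0%N != 0.
  by apply/cps_invertible; have /cps_invertible[k E] := e0; exists (pc c k); rewrite -rmorphM -E rmorph1.
(* The tangents of [u] and [v] are distinct, so their transforms do not meet on the exceptional
   curve, and the one passing through the point is smooth there. *)
have f00 := fc0 0%N mc; have J : u' 0%N 0%N * v' 0%N 1%N - u' 0%N 1%N * v' 0%N 0%N != 0.
  have D (w : R) : hform 1 w = (w 1%N 0%N)%:P + (w 0%N 1%N) *: 'X.
    apply/polyP => j; rewrite hform_coef coefD coefZ coefC coefX.
    by case: j => [|[|j]] /=; rewrite ?mulr0 ?mulr1 ?addr0 ?add0r.
  rewrite !u'0 !v'0 !D; case: (c) => [a|] /=.
    rewrite !comp_polyD !comp_polyZ !comp_polyC !comp_polyX.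
    rewrite !coefD !coefZ !coefD !coefC !coefX /= !add0r !addr0 !mulr1.
    by apply/eqP => E; apply: jac; rewrite -E; ring.
  rewrite !coef_poly /= !coefD !coefZ !coefC !coefX /= !mulr0 !mulr1 !addr0 !add0r.
  by apply/eqP => E; apply: jac; rewrite -[LHS]opprK -[RHS]oppr0 -E; congr (- _); ring.
apply: resolved_smooth => //.
move: f00; rewrite fcE !cps_mul01 !cpsM00 => /eqP; rewrite !mulf_eq0 (negPf pe0) /=.
case/orP => /eqP E0; rewrite E0 in J *.
  rewrite mul0r sub0r oppr_eq0 in J; rewrite !mulr0 mul0r add0r addr0 -mulrA mulf_neq0 //.
rewrite mulr0 subr0 in J; rewrite !mulr0 addr0 -mulrA mulf_neq0 //.
Qed.

Lemma smooth_coordinates u v : local_coordinates u v -> smooth u /\ smooth v.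
Proof.
move=> [u0 v0 jac]; split; split=> //; apply: contraPP jac => /not_orP[/negP/negPn/eqP a /negP/negPn/eqP b];
  rewrite a b ?mul0r ?mulr0 ?mul0r subrr; exact.
Qed.

(* A reduced curve whose equation divides that of a normal crossings divisor *)
(* is smooth or a node.                                                       *)
Lemma resolved_normal_crossings f nc : reduced f -> f 0%N 0%N = 0 ->
  normal_crossings nc -> divides f nc -> resolved f 'C(Defs.order f, 2).
Proof.
move=> fred f00 [u [v [eps [a [b [uv epsu ->]]]]]] [g E].
have [su sv] := smooth_coordinates uv.
have [k kE] := epsu.
(* [f] divides a power of [u * v], and reducedness removes the exponents; [u] and [v] being prime,
   [f] is then a unit times [u], [v] or [u * v]. *)
have [h hE] : divides f (u * v).
  apply: (fred _ (a + b)%N); exists (k * (u ^+ b * v ^+ a) * g).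
  have -> : k * (u ^+ b * v ^+ a) * g * f = k * (u ^+ b * v ^+ a) * (g * f) by ring.
  rewrite -E exprMn_comm; last exact: mulrC.
  have -> : k * (u ^+ b * v ^+ a) * (eps * u ^+ a * v ^+ b) =
    k * eps * (u ^+ a * u ^+ b) * (v ^+ a * v ^+ b) by ring.
  by rewrite -kE mul1r -!exprD.
have unitl (x y : R) : x * y = 1 -> x 0%N 0%N != 0.
  by move=> xy; apply/cps_invertible; exists y; rewrite -xy mulrC.
have fnu (x : R) : f * x <> 1.
  by move/unitl; rewrite f00 eqxx.
have nz (w : R) : smooth w -> w <> 0.
  by move=> [_ w1] w0; rewrite w0 !cps0E eqxx in w1; case: w1.
have u0 := nz _ su; have v0 := nz _ sv.
have sm (x y w : R) : smooth w -> f = x * w -> x * y = 1 -> resolved f 'C(Defs.order f, 2).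
  move=> sw -> /unitl x0; apply: resolved_smooth'; exact: smooth_unit_mul.
have [[h1 h1E]|[f1 f1E]] : divides u h \/ divides u f.
  by apply: smooth_prime => //; exists v; rewrite -hE mulrC.
  have vE : v = h1 * f by apply: (cps_mulI u0); rewrite hE h1E; ring.
  have [[h2 h2E]|[f2 f2E]] : divides v h1 \/ divides v f.
    by apply: smooth_prime => //; exists 1; rewrite mul1r -vE.
    case: (fnu h2); apply: (cps_mulI v0); rewrite mulr1 {2}vE h2E; ring.
  apply: (sm f2 h1 v) => //; apply: (cps_mulI v0); rewrite mulr1 {2}vE f2E; ring.
have vE : v = h * f1 by apply: (cps_mulI u0); rewrite hE f1E; ring.
have [[h2 h2E]|[f2 f2E]] : divides v h \/ divides v f1.
  by apply: smooth_prime => //; exists 1; rewrite mul1r -vE.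
  apply: (sm f1 h2 u) => //; apply: (cps_mulI v0); rewrite mulr1 {2}vE h2E; ring.
have f2u : f2 0%N 0%N != 0.
  apply: (unitl _ h); apply: (cps_mulI v0); rewrite mulr1 {2}vE f2E; ring.
have -> : f = f2 * u * v by rewrite f1E f2E; ring.
exact: resolved_node.
Qed.

(** Extend [x^(e-1) g] by zero at the other points and lift it to the base ring: a power of the lift
    is divisible by [f], hence so is the lift. The factor [x^(e-1)] is then cancelled, since [x] is
    regular modulo [fc c]. *)
Lemma reduced_strict f c e (T : seq (option K)) ml (fc : option K -> R) :
  (forall c, pc c f = cps_x ^+ e * fc c /\ yregular (ml c) (fc c)) ->
  (forall g : option K -> R, exists h, forall c, c \in T ->
      divides (fc c) (cps_x ^+ e.-1 * g c - pc c h)) ->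
  (forall h, (forall c, c \in T -> divides (fc c) (pc c h)) -> divides f h) ->
  c \in T -> reduced f -> reduced (fc c).
Proof.
move=> fcP sur inj cT fred g [|n] gn.
  rewrite expr0 in gn; case: gn => k E; exists (g * k); by rewrite -mulrA -E mulr1.
have [h hP] := sur (fun c' => if c' == c then g else 0).
have [a aE] : divides f h.
  apply: (fred _ n.+1); apply: inj => c' c'T; have := hP c' c'T; case: eqP => [->|_].
    move=> [b bE]; rewrite rmorphXn /=.
    have -> : pc c h = cps_x ^+ e.-1 * g - b * fc c by rewrite -bE; ring.
    have powB (X Y : R) m : divides (fc c) Y -> divides (fc c) ((X - Y) ^+ m - X ^+ m).
      move=> [y ->]; elim: m => [|m [z zE]]; first by exists 0; rewrite !expr0; ring.
      exists ((X - y * fc c) * z - y * X ^+ m).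
      rewrite mulrBl -mulrA -zE !exprS; ring.
    have dg : divides (fc c) ((cps_x ^+ e.-1 * g) ^+ n.+1).
      by rewrite exprMn_comm; [exact: divides_mulr|exact: mulrC].
    have bf : divides (fc c) (b * fc c) by exists b.
    by have := dividesD (powB (cps_x ^+ e.-1 * g) _ n.+1 bf) dg; rewrite subrK.
  rewrite mulr0 sub0r => /dividesN; rewrite opprK => [[b bE]].
  by exists (b * pc c' h ^+ n); rewrite rmorphXn /= exprS {1}bE; ring.
have [b bE] := hP c cT; rewrite eqxx in bE.
have [k kE] : exists k, b + pc c a * cps_x ^+ e = cps_x ^+ e.-1 * k.
  apply: (divides_xX_regular (fcP c).2 (b := g)).
  rewrite mulrDl -bE -mulrA -(fcP c).1 -rmorphM -aE; ring.
exists k; apply: (cps_mulI (@cps_expf_neq0 K cps_x e.-1 cps_x_neq0)).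
rewrite mulrA -kE mulrDl -bE -mulrA -(fcP c).1 -rmorphM -aE; ring.
Qed.

Lemma resolved_uncross c f d : resolved (uncross c f) d -> resolved f d.
Proof. by case: c => [a|] //= /resolved_swap; rewrite cps_swapK. Qed.

Lemma reduced_uncross c f : reduced f -> reduced (uncross c f).
Proof.
move=> fred g n [k E]; have [|h hE] := fred (uncross c g) n.
  by exists (uncross c k); rewrite -uncrossX E uncrossM uncrossK.
by exists (uncross c h); rewrite -(uncrossK c g) hE uncrossM.
Qed.

(** Only the points strictly preceding [P] have to be in [B], so the ends of the tree, which are not
    blown up, are included. *)
Definition infinitely_near f B : set (Defs.point K) :=
  [set P | strict_transform [::] P f 0%N 0%N = 0 /\ forall P', strictly_precedes P' P -> B P'].

Lemma strictly_precedes_nil P : ~ strictly_precedes P [::].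
Proof. by case: P => [|c P] []. Qed.

Lemma strictly_precedes_cons c P Q : strictly_precedes (c :: P) (c :: Q) <-> strictly_precedes P Q.
Proof.
rewrite /strictly_precedes /= eqxx /=; split=> -[pq PQ]; split=> //; first by move=> E; rewrite E in PQ.
by case.
Qed.

Definition tree_resolved f B := exists L : seq (Defs.point K),
  [/\ uniq L, forall P, P \in L <-> infinitely_near f B P &
    resolved f (\sum_(P <- L) 'C(Defs.order (strict_transform [::] P f), 2))].

Lemma tree_resolved_unit f B : f 0%N 0%N != 0 -> tree_resolved f B.
Proof.
move=> f0; exists [::]; split=> // [P|]; last by rewrite big_nil; apply: resolved_unit.
by split=> // -[]; have := strict_transform_unit P f0 => /eqP.
Qed.

Lemma tree_resolved_leaf f B : f 0%N 0%N = 0 -> reduced f -> ~ B [::] ->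
  (exists2 nc, normal_crossings nc & divides f nc) -> tree_resolved f B.
Proof.
move=> f00 fred B0 [nc ncn fnc]; exists [:: [::]]; split=> // [P|].
  rewrite inE; split=> [/eqP ->|[_ PB]].
    by split=> [|P' /strictly_precedes_nil] //; rewrite strict_transformE.
  by case: P PB => // c P PB; case: B0; apply: PB; split.
by rewrite big_seq1 strict_transformE; apply: resolved_normal_crossings ncn fnc.
Qed.

(** Induction on a bound for the length of the points of [B]. The hypothesis at the ends is that the
    strict transform divides some normal crossings divisor: in this form it passes from [f] to the
    strict transforms of its first blowup. *)
Lemma tree_resolvedP D f B : f <> 0 -> reduced f ->
  (forall P Q, B Q -> prefix P Q -> B P) -> (forall P, B P -> (size P < D)%N) ->
  (forall Q, model_points B Q -> exists2 nc, normal_crossings nc &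
    divides (strict_transform [::] Q f) nc) -> tree_resolved f B.
Proof.
elim: D f B => [|D IH] f B f0 fred Bcl BD leaf;
  (have [f00|] := eqVneq (f 0%N 0%N) 0; last exact: tree_resolved_unit);
  (have [B0|B0] := pselect (B [::]); last first).
- apply: tree_resolved_leaf => //; have [|nc ncn fnc] := leaf [::].
    by split=> // P /strictly_precedes_nil.
  by exists nc; rewrite // -[f](strict_transformE [::]).
- by have := BD _ B0.
- apply: tree_resolved_leaf => //; have [|nc ncn fnc] := leaf [::].
    by split=> // P /strictly_precedes_nil.
  by exists nc; rewrite // -[f](strict_transformE [::]).
have [e [fv fe]] := hform_ex f0.
have e0 : (0 < e)%N.
  by case: e fv fe => // _ /eqP[]; apply/polyP => -[|j]; rewrite hform_coef coef0.
have [T [ml [fc [[uT TE sT] fcP inj sur codim]]]] := blowup fv fe.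
have sE c : strict1 f c = uncross c (fc c) := strict1E (fcP c).1 (fcP c).2.
have IHc c : exists L : seq (Defs.point K), c \in T -> [/\ uniq L,
    forall P, P \in L <-> infinitely_near (strict1 f c) [set P | B (c :: P)] P &
    resolved (strict1 f c)
      (\sum_(P <- L) 'C(Defs.order (strict_transform [::] P (strict1 f c)), 2))].
  have [cT|] := boolP (c \in T); last by exists [::].
  have [|||||L LP] := IH (strict1 f c) [set P | B (c :: P)]; last by exists L.
  - rewrite sE => /(congr1 (uncross c)); rewrite uncrossK => E.
    have [_] := (fcP c).2; rewrite E; case: (c) => [a|]; rewrite ?cps_swapE cps0E eqxx //.
  - by rewrite sE; apply/reduced_uncross/(reduced_strict fcP sur inj).
  - by move=> P Q /= BQ PQ; apply: Bcl BQ _; rewrite /= eqxx.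
  - by move=> P /= /BD.
  move=> Q [/= BQ BP]; have [|nc ncn] := leaf (c :: Q).
    split=> // -[//|c' P] cPQ; have E : c' = c by case: cPQ => /= /andP[/eqP].
    rewrite E in cPQ *; exact: (BP P (iffLR (strictly_precedes_cons c P Q) cPQ)).
  by rewrite !strict_transformE /=; exists nc.
have {}IHc : exists Lc, forall c, c \in T -> [/\ uniq (Lc c),
    forall P, P \in Lc c <-> infinitely_near (strict1 f c) [set P | B (c :: P)] P &
    resolved (strict1 f c)
      (\sum_(P <- Lc c) 'C(Defs.order (strict_transform [::] P (strict1 f c)), 2))].
  exists (fun c => projT1 (cid (IHc c))) => c; by case: cid.
have [Lc LcP] := IHc.
pose L := [::] :: [seq c :: P | c <- T, P <- Lc c] : seq (Defs.point K).
have LE c P : (c :: P \in L) = (c \in T) && (P \in Lc c).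
  rewrite /L inE /=; apply/allpairsPdep/andP => [[c' [P' [c'T P'L [-> ->]]]]//|[cT PL]].
  by exists c, P.
exists L; split.
- rewrite /L /=; apply/andP; split; first by apply/negP => /allpairsPdep[c [P [_ _]]].
  apply: allpairs_uniq_dep => // [c cT|[c P] [c' P'] _ _ /= [-> ->]//].
  by have [] := LcP c cT.
- case=> [|c P].
    rewrite inE eqxx; split=> // _; rewrite /infinitely_near /= strict_transformE.
    by split=> // P' /strictly_precedes_nil.
  rewrite LE /infinitely_near /= strict_transformE /=; split=> [/andP[cT PL]|[sP PB]].
    have [_ /(_ P) H _] := LcP c cT; have [sP PB] := iffLR H PL.
    rewrite strict_transformE in sP; split=> // -[|c' P'] c'P //.
    have E : c' = c by case: c'P => /= /andP[/eqP].
    rewrite E in c'P *; exact: (PB P' (iffLR (strictly_precedes_cons c P' P) c'P)).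
  (* Off the tangent directions the strict transform is a unit, and remains one at all the points
     above. *)
  have cT : c \in T.
    rewrite TE lt0n; apply/negP => /eqP m0.
    have [_ g0] := (fcP c).2; rewrite m0 in g0.
    have := @strict_transform_unit P (strict1 f c).
    by rewrite strict_transformE sP sE uncross00 => /(_ g0); rewrite eqxx.
  rewrite cT; have [_ /(_ P) H _] := LcP c cT; apply/H; split.
    by rewrite strict_transformE.
  by move=> P' P'P; apply: PB; apply/strictly_precedes_cons.
rewrite /L big_cons strict_transformE /= (orderE fv fe) big_allpairs_dep /=.
apply: (@resolved_blowup _ f e T ml _ fc) => //; try by move=> c; have [] := fcP c.
move=> c cT; have [_ _] := LcP c cT; rewrite sE => /resolved_uncross.
have -> // : (\sum_(P <- Lc c) 'C(Defs.order (strict_transform [::] P (uncross c (fc c))), 2) =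
  \sum_(P <- Lc c) 'C(Defs.order (strict_transform [::] (c :: P) f), 2))%N.
by apply: eq_bigr => P _; rewrite !strict_transformE /= sE.
Qed.

End Trees.

(** * The normalization as a product of series rings *)

Section NormalizationTheory.
Variables (K : numClosedFieldType) (X : curve K).
Local Notation R := (cps K).
Local Notation A := (cps1 K).
Local Notation Q := (total_fractions X).
Local Notation pi := (\pi_Q)%qT.
Local Notation tf := (@tf_of K X).

Let fracE := ((fun f g rg => erefl : num (@mkfrac K X f g rg) = f),
  (fun f g rg => erefl : den (@mkfrac K X f g rg) = g)).

Let piP (x y : fraction X) : divides (Defs.eqn X) (num x * den y - num y * den x) <-> pi x = pi y.
Proof.
split=> [xy|/eqP]; first by apply/eqP; rewrite eqmodE; apply/asboolP.
by rewrite eqmodE => /asboolP.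
Qed.

Let mulE (x y : fraction X) : pi x * pi y = pi (frac_mul x y).
Proof.
rewrite -[LHS]/(tf_mul (pi x) (pi y)); apply/piP.
have /piP xx := reprK (pi x); have /piP yy := reprK (pi y).
set x' := repr (pi x) in xx *; set y' := repr (pi y) in yy *.
have := dividesD (divides_mulr (num y' * den y) xx) (divides_mulr (num x * den x') yy).
by apply: divides_eq; rewrite /num /den /=; ring.
Qed.

Lemma tf_of_eq0 h : tf h = 0 <-> divides (Defs.eqn X) h.
Proof.
rewrite -[0 : Q]/(tf 0); split=> [/piP|hX]; last apply/piP;
  by rewrite /num /den /= mul0r subr0 mulr1.
Qed.

Lemma tf_fraction (q : Q) : exists f g, regular X g /\ q * tf g = tf f.
Proof.
rewrite -(reprK q); set x := repr q; exists (num x), (den x).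
split; first exact: regular_den.
by rewrite mulE; apply/piP; exists 0; rewrite !fracE; ring.
Qed.

Lemma tf_mkfrac f g : regular X g -> exists q : Q, q * tf g = tf f.
Proof.
move=> rg; exists (pi (mkfrac f rg)); rewrite mulE; apply/piP.
by exists 0; rewrite !fracE; ring.
Qed.

Lemma tf_cancel g (q q' : Q) : regular X g -> q * tf g = q' * tf g -> q = q'.
Proof.
move=> rg /eqP; rewrite -subr_eq0 -mulrBl => E; apply/eqP; rewrite -subr_eq0.
move: (q - q') E => {q'}q /eqP; have [f [g' [rg' E]]] := tf_fraction q => qg.
rewrite -(reprK q) in qg *; set x := repr q in qg *.
move: qg; rewrite mulE -[0 : Q]/(tf 0) => /piP H; apply/eqP/piP; apply: rg.
by move: H; apply: divides_eq; rewrite !fracE; ring.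
Qed.

Variables (d : nat) (I : finType) (phi : I -> {rmorphism R -> A}) (w : I -> fps K).
Hypothesis par : parametrized (Defs.eqn X) d phi w.

Let phiC i t : phi i (cps_const t) = cps1_const t. Proof. by have [H] := par. Qed.
Let phik h : (forall i, phi i h = 0) <-> divides (Defs.eqn X) h.
Proof. by have [_ H] := par. Qed.

Lemma conductor_at (i0 : I) : exists h, phi i0 h != 0 /\ forall i, i != i0 -> phi i h = 0.
Proof.
have [_ _ _ [k phic] _] := par; have [h hE] := phic (fun i => (i == i0)%:R).
exists h; split=> [|i /negPf ii]; rewrite hE ?eqxx ?ii ?mulr0 // mulr1.
exact/cps1_expf_neq0/cps1_t_neq0.
Qed.

(** A function vanishing on a branch is killed by one supported on that branch alone. *)
Lemma parametrized_regular g : regular X g <-> forall i, phi i g != 0.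
Proof.
split=> [rg i|g0 h /phik gh].
  have [h [hi hj]] := conductor_at i; apply: contra_neq hi => gi.
  apply: (iffRL (phik h)); apply: rg; apply/phik => j.
  by rewrite rmorphM; have [->|/hj ->] := eqVneq j i; rewrite ?gi ?mul0r ?mulr0.
by apply/phik => i; apply: (cps1_mulI (g0 i)); rewrite mulr0 -rmorphM gh.
Qed.

(** A relation rather than a map: a fraction has values in [C{t}] only if its denominator divides
    its numerator on each branch. *)
Definition branch_values (q : Q) (n : I -> A) : Prop := exists f g,
  [/\ regular X g, q * tf g = tf f & forall i, phi i f = phi i g * n i].

Lemma branch_values_uniq q q' n : branch_values q n -> branch_values q' n -> q = q'.
Proof.
move=> [f [g [rg qE n1]]] [f' [g' [rg' qE' n2]]].
apply: (tf_cancel (regularM rg rg')); rewrite rmorphM mulrA qE mulrCA qE' -!rmorphM.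
apply/eqP; rewrite -subr_eq0 -rmorphB; apply/eqP/tf_of_eq0/phik => i.
by rewrite rmorphB !rmorphM n1 n2; ring.
Qed.

Lemma branch_values_eq q n n' : branch_values q n -> n =1 n' -> branch_values q n'.
Proof.
by move=> [f [g [rg qE n1]]] nn'; exists f, g; split=> // i; rewrite n1 nn'.
Qed.

Lemma branch_valuesD q q' n n' : branch_values q n -> branch_values q' n' ->
  branch_values (q + q') (fun i => n i + n' i).
Proof.
move=> [f [g [rg qE n1]]] [f' [g' [rg' qE' n2]]].
exists (f * g' + f' * g), (g * g'); split=> [||i]; first exact: regularM.
  by rewrite rmorphM rmorphD !rmorphM /= -qE -qE'; ring.
by rewrite rmorphD !rmorphM n1 n2; ring.
Qed.

Lemma branch_valuesM q q' n n' : branch_values q n -> branch_values q' n' ->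
  branch_values (q * q') (fun i => n i * n' i).
Proof.
move=> [f [g [rg qE n1]]] [f' [g' [rg' qE' n2]]].
exists (f * f'), (g * g'); split=> [||i]; first exact: regularM.
  by rewrite !rmorphM /= -qE -qE'; ring.
by rewrite !rmorphM n1 n2; ring.
Qed.

Lemma branch_values_tf h : branch_values (tf h) (fun i => phi i h).
Proof.
exists h, 1; split=> [||i]; first exact: regular1.
  by rewrite rmorph1 mulr1.
by rewrite rmorph1 mul1r.
Qed.

Lemma branch_values_ex n : exists q, branch_values q n.
Proof.
have [_ _ _ [k phic] _] := par.
have [g gE] := phic (fun=> 1); have [f fE] := phic n.
have rg : regular X g.
  by apply/parametrized_regular => i; rewrite gE mulr1 cps1_expf_neq0 ?cps1_t_neq0.
have [q qE] := tf_mkfrac f rg; exists q, f, g; split=> // i.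
by rewrite fE gE mulr1.
Qed.

Lemma branch_values_range q n : branch_values q n ->
  (exists h, forall i, n i = phi i h) <-> range tf q.
Proof.
move=> qn; split=> [[h hE]|[h _ hE]].
  exists h => //; apply: branch_values_uniq qn; have := branch_values_tf h.
  by rewrite (_ : (fun i => phi i h) = n) //; apply/funext => i; rewrite hE.
exists h => i; move: qn; rewrite -hE => -[f [g [rg qE n1]]].
have /parametrized_regular g0 := rg; apply: (cps1_mulI (g0 i)).
rewrite -n1 -rmorphM; apply/eqP; rewrite -subr_eq0 -rmorphB; apply/eqP.
apply: (iffRL (phik _)); apply/tf_of_eq0.
by rewrite rmorphB rmorphM /= mulrC qE subrr.
Qed.

Lemma branches_inhabited : exists i0 : I, True.
Proof.
apply: contrapT => nI; apply: (@eqn_dvd1 K X); apply/phik => i; case: nI.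
by exists i.
Qed.

(* If [m] vanishes at all the points of the normalization, a power of [m]    *)
(* is in the conductor.                                                      *)
Lemma branch_values_integral q n : branch_values q n -> integralOver tf q.
Proof.
move=> qn; have [_ _ _ [k phic] _] := par.
pose c i : R := cps_const (n i 0%N).
pose m i : A := \prod_j (n i - cps1_const (n j 0%N)).
have mt i : exists b, m i ^+ k.+1 = cps1_t ^+ k * b.
  have [b bE] : divides cps1_t (n i - cps1_const (n i 0%N)).
    apply: cps1_divides; first exact: cps1_t_neq0.
    by rewrite ford_t => -[|//] _; rewrite -[LHS]/(n i 0%N - n i 0%N) subrr.
  have [b' b'E] : exists b', m i = cps1_t * b'.
    by rewrite /m (bigD1 i) //= bE mulrAC mulrC; eexists.
  by rewrite b'E exprMn_comm ?exprSr; [rewrite -mulrA; eexists|exact: mulrC].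
have [h hE] := phic (fun i => projT1 (cid (mt i))).
have {}hE i : phi i h = m i ^+ k.+1 by rewrite hE; case: cid.
(* The roots are the values of [n] at the origins of the branches. The exponent [k.+1] keeps the
   degree positive when [k = 0]. *)
pose p0 : {poly R} := (\prod_j ('X - (c j)%:P)) ^+ k.+1.
have p0m : p0 \is monic by apply/monic_exp/monic_prod_XsubC.
have sp0 : (1 < size p0)%N.
  have [i0 _] := branches_inhabited.
  have mon : \prod_j ('X - (c j)%:P) \is monic by apply: monic_prod_XsubC.
  rewrite /p0 exprSr size_Mmonic ?monic_neq0 ?monic_exp //.
  have -> : size (\prod_j ('X - (c j)%:P)) = #|I|.+1.
    by rewrite size_prod_XsubC -sum1_size sum1_card.
  rewrite addnS /= -[1%N]add0n -addSn leq_add ?size_poly_gt0 ?monic_neq0 ?monic_exp //.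
  by apply/card_gt0P; exists i0.
exists (p0 - h%:P).
  rewrite monicE lead_coefDl ?(monicP p0m) // size_polyN.
  by apply: leq_ltn_trans (size_polyC_leq1 _) sp0.
apply/rootP; rewrite rmorphB /= map_polyC hornerD hornerN hornerC /= rmorphXn rmorph_prod.
rewrite horner_exp horner_prod.
under eq_bigr do rewrite rmorphB /= map_polyX map_polyC /= hornerXsubC.
apply/eqP; rewrite subr_eq0; apply/eqP.
have b1 : branch_values 1 (fun=> 1).
  by rewrite -(rmorph1 tf); apply: branch_values_eq (branch_values_tf 1) _ => i; rewrite rmorph1.
have bX r N v : branch_values r v -> branch_values (r ^+ N) (fun i => v i ^+ N).
  move=> rv; elim: N => [|N IH]; first by rewrite expr0; apply: branch_values_eq b1 _.
  by rewrite exprS; apply: branch_values_eq (branch_valuesM rv IH) _ => i; rewrite exprS.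
have bP : branch_values (\prod_j (q - tf (c j))) m.
  rewrite /m; elim: (index_enum I) => [|j s IH].
    by rewrite big_nil; apply: branch_values_eq b1 _ => i; rewrite big_nil.
  rewrite big_cons -(rmorphN tf).
  apply: branch_values_eq (branch_valuesM (branch_valuesD qn (branch_values_tf (- c j))) IH) _.
  by move=> i; rewrite big_cons rmorphN phiC.
apply: branch_values_uniq (bX _ k.+1 _ bP) _.
by apply: branch_values_eq (branch_values_tf h) _ => i; rewrite hE.
Qed.

(** The equation is the integral equation of [a / b] cleared of denominators. If [ord a < ord b],
    dividing it by [t^(N ord a)] and setting [t = 0] leaves only the [N]-th power of a nonzero
    constant. *)
Lemma cps1_integrally_closed (N : nat) (c : nat -> A) (a b : A) : b != 0 -> c N = 1 ->
  \sum_(l < N.+1) c l * (a ^+ l * b ^+ (N - l)) = 0 -> divides b a.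
Proof.
move=> b0 cN S0; have [->|a0] := eqVneq a 0; first by exists 0; rewrite mul0r.
have [u [v uv] aE] := cps1_factor a0; have [u' _ bE] := cps1_factor b0.
have [ba|ab] := leqP (ford b) (ford a).
  apply: cps1_divides => // i ib; have ca : cps1_val a != 0 by rewrite cps1_val_eq0.
  by have [_ al] := fordP ca; apply: al; apply: leq_trans ba.
exfalso; have u0 : u 0%N != 0.
  have : (v * u) 0%N != 0 by rewrite -uv oner_neq0.
  by rewrite cps1M_val fpsME big_ord1 mulf_eq0 negb_or => /andP[].
pose b' := cps1_t ^+ (ford b - ford a) * u'.
have bE' : b = cps1_t ^+ ford a * b' by rewrite /b' mulrA -exprD subnKC ?(ltnW ab).
have b'0 : b' 0%N = 0 by rewrite cps1_tXE subn_gt0 ab.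
have : cps1_t ^+ (ford a * N) * (\sum_(l < N.+1) c l * (u ^+ l * b' ^+ (N - l))) = 0.
  rewrite -[RHS]S0 mulr_sumr; apply: eq_bigr => l _.
  have lN : (l <= N)%N by rewrite -ltnS.
  rewrite [in RHS]aE [in RHS]bE' !exprMn_comm; try exact: mulrC.
  have -> : cps1_t ^+ (ford a * N) = (cps1_t ^+ ford a) ^+ l * (cps1_t ^+ ford a) ^+ (N - l) :> A.
    by rewrite -exprD subnKC // exprM.
  ring.
rewrite -[RHS](mulr0 (cps1_t ^+ (ford a * N))) => /(cps1_mulI _).
move=> /(_ (cps1_expf_neq0 _ (cps1_t_neq0 K))) /(congr1 (fun z : A => z 0%N)).
have ev (z z' : A) : (z * z') 0%N = z 0%N * z' 0%N.
  by rewrite cps1M_val fpsME big_ord1.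
have evX (z : A) l : (z ^+ l) 0%N = z 0%N ^+ l.
  by elim: l => [|l IH]; rewrite ?expr0 // !exprS ev IH.
have evS (F : 'I_N.+1 -> A) : (\sum_l F l) 0%N = \sum_l F l 0%N.
  by elim/big_rec2: _ => //= l y y2 _ <-.
have sumE (F : 'I_N.+1 -> K) : (forall l : 'I_N.+1, (l < N)%N -> F l = 0) -> \sum_l F l = F ord_max.
  by move=> F0; rewrite big_ord_recr /= big1 ?add0r // => l _; apply: F0 => /=.
rewrite evS sumE => [|l lN]; last first.
  by rewrite !ev !evX b'0 expr0n subn_eq0 leqNgt lN !mulr0.
rewrite !ev !evX cN subnn expr0 mulr1 => /eqP.
by rewrite mul1r expf_eq0 (negPf u0) andbF.
Qed.

(** The integral equation of a fraction [f / g] holds on each branch, where integral closedness of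
    [C{t}] lets [g] divide [f]. *)
Lemma normalization_branch_values q : integralOver tf q -> exists n, branch_values q n.
Proof.
move=> [p pm /rootP pq]; have [f [g [rg qE]]] := tf_fraction q.
have /parametrized_regular g0 := rg.
pose N := (size p).-1.
have sp : size p = N.+1 by rewrite /N prednK // size_poly_gt0 monic_neq0.
have S0 : tf (\sum_(l < N.+1) p`_l * (f ^+ l * g ^+ (N - l))) = 0.
  have := congr1 (fun z : Q => z * tf g ^+ N) pq; rewrite mul0r => <-.
  rewrite horner_coef size_map_poly_id0; last by rewrite (monicP pm) rmorph1 oner_neq0.
  rewrite sp mulr_suml rmorph_sum; apply: eq_bigr => l _.
  have lN : (l <= N)%N by rewrite -ltnS.
  rewrite coef_map /= !rmorphM !rmorphXn /= -qE.
  have -> : tf g ^+ N = tf g ^+ l * tf g ^+ (N - l) by rewrite -exprD subnKC.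
  by rewrite exprMn_comm; [ring|exact: mulrC].
have dv i : divides (phi i g) (phi i f).
  apply: (@cps1_integrally_closed N (fun l => phi i p`_l)) => //.
    by rewrite (_ : p`_N = 1) ?rmorph1 // -(monicP pm) lead_coefE.
  move/tf_of_eq0/phik/(_ i): S0; rewrite rmorph_sum => S0; rewrite -[RHS]S0.
  by apply: eq_bigr => l _; rewrite !rmorphM !rmorphXn.
exists (fun i => projT1 (cid (dv i))), f, g; split=> // i.
by case: cid => b /= ->; rewrite mulrC.
Qed.

Lemma delta_invariant : is_delta_invariant X d.
Proof.
have [_ _ phid _ _] := par.
pose theta n := projT1 (cid (branch_values_ex n)).
have thetaP n : branch_values (theta n) n by rewrite /theta; case: cid.
have lt : linear theta.
  move=> a n m; apply: branch_values_uniq (thetaP _) _.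
  apply: branch_values_eq (branch_valuesD (branch_valuesM (branch_values_tf (cps_const a))
    (thetaP n)) (thetaP m)) _.
  by move=> i; rewrite phiC.
have sN : subspace (normalization (A := X)).
  split=> [|a u v /normalization_branch_values[n un] /normalization_branch_values[m vm]].
    by have := branch_values_integral (branch_values_tf 0); rewrite rmorph0.
  apply: branch_values_integral.
  exact: branch_valuesD (branch_valuesM (branch_values_tf (cps_const a)) un) vm.
have sR : subspace (range tf).
  split=> [|a u v [f _ <-] [g _ <-]]; first by exists 0; rewrite ?rmorph0.
  by exists (cps_const a * f + g) => //; rewrite rmorphD rmorphM.
apply: (iffLR (quotient_dim_map d lt (@subspaceT _ _) (subspace_range phiC) sN sR _ _ _)) phid.
- by move=> n _; apply: branch_values_integral (thetaP n).
- by move=> n _; apply: branch_values_range.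
move=> q /normalization_branch_values[n qn]; exists n => //.
by rewrite (branch_values_uniq qn (thetaP n)) subrr; exists 0; rewrite ?rmorph0.
Qed.

End NormalizationTheory.

(** * Branches as kernels *)

Section Branches.
Variable K : numClosedFieldType.
Local Notation R := (cps K).
Local Notation A := (cps1 K).

Lemma yregular_factor (f : R) : f <> 0 -> exists s m (g : R), f = cps_x ^+ s * g /\ yregular m g.
Proof.
move=> f0; have f1 : (f : fps (fps K)) != 0.
  by apply/eqP => E; apply: f0; apply: val_inj.
have [s [fs fl]] := fps_order_ex f1.
have [i j il|g fE] := @cps_divxX K s f; first by rewrite fl.
have [m [gm gl]] := fps_order_ex fs.
exists s, m, g; split=> //; have gE j : g 0%N j = (f : fps (fps K)) s j.
  by rewrite fE cps_xXE ltnn subnn.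
by split=> [j jm|]; rewrite gE // gl.
Qed.

(* The kernel is generated by its [y]-regular elements of least order. *)
Lemma kernel_principal (phi : {rmorphism R -> A}) f : f <> 0 -> phi f = 0 ->
  phi cps_x != 0 -> exists p, p <> 0 /\ forall h, phi h = 0 <-> divides p h.
Proof.
move=> f0 pf x0.
have red h : h <> 0 -> phi h = 0 -> exists s m (g : R), [/\ h = cps_x ^+ s * g, yregular m g & phi g = 0].
  move=> h0 ph; have [s [m [g [hE gr]]]] := yregular_factor h0; exists s, m, g; split=> //.
  by apply: (cps1_mulI (cps1_expf_neq0 s x0)); rewrite mulr0 -rmorphXn -rmorphM -hE.
have ex : exists m, `[< exists g : R, yregular m g /\ phi g = 0 >].
  by have [s [m [g [_ gr pg]]]] := red f f0 pf; exists m; apply/asboolP; exists g.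
have [m /asboolP[p [pr pp]] mmin] := ex_minnP ex.
exists p; split=> [p0|h]; first by move: pr => [_]; rewrite p0 eqxx.
split=> [ph|[g ->]]; last by rewrite rmorphM pp mulr0.
have [q [r [hE rl]]] := cps_weierstrass h pr.
exists q; rewrite hE; have [->|/eqP r0] := eqVneq r 0; first by rewrite addr0.
have pr0 : phi r = 0 by move: ph; rewrite hE rmorphD rmorphM pp mulr0 add0r.
have [s [m' [g [rE gr pg]]]] := red r r0 pr0.
have : (m <= m')%N by apply: mmin; apply/asboolP; exists g.
move=> mm; have := rl s m' mm; rewrite rE cps_xXE ltnn subnn.
by move: gr => [_ /negP gm] E; case: gm; rewrite E.
Qed.

Variables (X : curve K) (d : nat) (I : finType) (phi : I -> {rmorphism R -> A}) (w : I -> fps K).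
Hypothesis par : parametrized (Defs.eqn X) d phi w.

Let phik h : (forall i, phi i h = 0) <-> divides (Defs.eqn X) h.
Proof. by have [_ H] := par. Qed.

Let phiX i : phi i (Defs.eqn X) = 0.
Proof. by apply: (iffRL (phik _)); exists 1; rewrite mul1r. Qed.

(** The kernel is principal and, the target being a domain, prime; so its generator is irreducible.
    If [x] vanishes on the branch, the coordinates are exchanged. *)
Lemma branch_kernel i : exists p, [/\ irreducible p, divides p (Defs.eqn X) &
  forall h, phi i h = 0 <-> divides p h].
Proof.
have [p [p0 pk]] : exists p, p <> 0 /\ forall h, phi i h = 0 <-> divides p h.
  have [x0|y0] := parametrized_xy_neq0 i par.
    exact: kernel_principal (@eqn_neq0 _ X) (phiX i) x0.
  have [||| p [p0 pk]] := @kernel_principal (phi i \o @cps_swap K)%FUN (cps_swap X).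
  - by move=> E; apply: (@eqn_neq0 _ X); rewrite -[LHS]cps_swapK E rmorph0.
  - by rewrite /= cps_swapK.
  - by rewrite /= cps_swap_x.
  exists (cps_swap p); split=> [E|h].
    by apply: p0; rewrite -[LHS]cps_swapK E rmorph0.
  rewrite -{1}[h]cps_swapK; split=> [/pk[g E]|[g E]].
    by exists (cps_swap g); rewrite -(rmorphM (@cps_swap K)) /= -E cps_swapK.
  by apply/pk; exists (cps_swap g); rewrite E rmorphM /= cps_swapK.
exists p; split=> //; last by apply/pk.
split=> [//|/pk/eqP|g h pE]; first by rewrite rmorph1 oner_eq0.
have pp : phi i p = 0 by apply/pk; exists 1; rewrite mul1r.
have [g0 h0] : g <> 0 /\ h <> 0.
  by split=> E; apply: p0; rewrite pE E ?mul0r ?mulr0.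
have [g1|h1] : phi i g = 0 \/ phi i h = 0.
- move: pp; rewrite pE rmorphM; have [->|g1 E] := eqVneq (phi i g) 0; first by left.
  by right; apply: (cps1_mulI g1); rewrite mulr0.
- have /pk[a gE] := g1; right; exists a; apply: (@cps_mulI _ g) => //.
  by rewrite mulr1 {1}gE pE; ring.
have /pk[a hE] := h1; left; exists a; apply: (@cps_mulI _ h) => //.
by rewrite mulr1 {1}hE pE; ring.
Qed.

(** An irreducible factor vanishes on some branch, since otherwise its cofactor would vanish on all
    of them and be a multiple of the equation. It is then associated with the generator of that
    kernel. *)
Lemma branchesE : branches X = [set J | exists i, J = [set h | phi i h = 0]].
Proof.
apply/seteqP; split=> [J [q [[q0 qn qirr] [g XE] ->]]|J [i ->]]; last first.
  have [p [pirr pX pk]] := branch_kernel i; exists p; split=> //.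
  by apply/seteqP; split=> h /pk.
have [i qi] : exists i, phi i q = 0.
  apply: contrapT => H; apply: qn.
  have /phik[a gE] : forall i, phi i g = 0.
    move=> i; apply: (@cps1_mulI _ (phi i q)); first by apply/eqP => E; apply: H; exists i.
    by rewrite mulr0 -rmorphM mulrC -XE.
  exists a; apply: (@cps_mulI _ g); last by rewrite mulr1 {1}gE XE; ring.
  by move=> E; apply: (@eqn_neq0 _ X); rewrite XE E mul0r.
exists i; have [p [[p0 pn _] _ pk]] := branch_kernel i.
have /pk[a qE] := qi; have [[b ba]|//] := qirr _ _ qE.
apply/seteqP; split=> h; first by move=> [c ->]; apply/pk; rewrite qE; exists (c * a); ring.
move=> /pk[c ->]; exists (c * b); rewrite qE.
by rewrite -[c in LHS]mulr1 ba; ring.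
Qed.

(** The functions of [conductor_at] separate the kernels of distinct branches. *)
Lemma branch_numberE : branch_number X = #|I|.
Proof.
pose k i : set R := [set h | phi i h = 0].
have kI : injective k.
  move=> i j kij; apply: contrapT => /eqP ij.
  have [h [hi hj]] := conductor_at par i; move/eqP: hi; apply.
  have : k j h by apply: hj; rewrite eq_sym.
  by rewrite -kij.
rewrite /branch_number (_ : branches X = [set` [fset k i | i in I]%fset]).
  by rewrite set_fsetK card_imfset //= cardE.
rewrite branchesE; apply/seteqP; split=> [J [i ->]|J /=].
  by apply/imfsetP; exists i.
by move/imfsetP => [i _ ->]; exists i.
Qed.

End Branches.

(** * Determinants and codimension over the valuation ring *)

Section RowSpace.
Variable K : numClosedFieldType.
Local Notation R := (cps K).
Local Notation A := (cps1 K).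

Definition ev0 (a : A) : K := a 0%N.
Fact ev0_is_zmod_morphism : zmod_morphism ev0. Proof. by []. Qed.
Fact ev0_is_monoid_morphism : monoid_morphism ev0.
Proof. by split=> // a b; rewrite /ev0 cps1M_val fpsME big_ord1. Qed.
HB.instance Definition _ := GRing.isZmodMorphism.Build A K ev0 ev0_is_zmod_morphism.
HB.instance Definition _ := GRing.isMonoidMorphism.Build A K ev0 ev0_is_monoid_morphism.

Definition row_space k (M : 'M[A]_k) : set ('I_k -> A) :=
  [set u | exists v : 'rV[A]_k, \row_j u j = v *m M].

Lemma cps1_scaleE (t : K) (a : A) : t *: a = cps1_const t * a.
Proof. by []. Qed.

Lemma subspace_row_space k (M : 'M[A]_k) : subspace (row_space M).
Proof.
split=> [|a u v [u' uE] [v' vE]].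
  by exists 0; rewrite mul0mx; apply/rowP => j; rewrite !mxE.
exists (cps1_const a *: u' + v'); rewrite mulmxDl -scalemxAl -uE -vE.
by apply/rowP => j; rewrite !mxE.
Qed.

Lemma row_space_unit k (U V M : 'M[A]_k) : V *m U = 1%:M -> row_space (U *m M) = row_space M.
Proof.
move=> VU; apply/seteqP; split=> u [v uE]; first by exists (v *m U); rewrite uE mulmxA.
by exists (v *m V); rewrite uE mulmxA -(mulmxA v) VU mulmx1.
Qed.

(** The row spaces differ by the factor [t] on the row [i0], so the quotient is [C{t} / (t)]; the
    nonzero determinant makes coordinates unique. *)
Lemma quotient_dim_row_step k (i0 : 'I_k) (M M' : 'M[A]_k) : \det M' != 0 ->
  M = diag_mx (\row_i if i == i0 then cps1_t else 1) *m M' ->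
  quotient_dim (row_space M') (row_space M) 1.
Proof.
set D := diag_mx _ => M'0 ME.
pose lphi (a : A) : 'I_k -> A := fun j => a * M' i0 j.
have lE a : \row_j lphi a j = (a *: delta_mx 0 i0) *m M'.
  by rewrite -scalemxAl -rowE; apply/rowP => j; rewrite !mxE.
have ll : linear lphi.
  move=> t a b; apply/funext => j.
  by rewrite -[RHS]/(t *: (a * M' i0 j) + b * M' i0 j) /lphi !cps1_scaleE mulrDl mulrA.
have DE (v : 'rV[A]_k) j : (v *m D) 0 j = v 0 j * (if j == i0 then cps1_t else 1).
  by rewrite mul_mx_diag !mxE.
have inj (v v' : 'rV[A]_k) : v *m M' = v' *m M' -> v = v'.
  move=> /(congr1 (mulmx^~ (\adj M'))); rewrite -!mulmxA mul_mx_adj !mul_mx_scalar => /rowP E.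
  by apply/rowP => j; have := E j; rewrite !mxE; apply: cps1_mulI.
have := @quotient_dim_cps1 K cps1_t (cps1_t_neq0 K); rewrite ford_t.
apply: (iffLR (quotient_dim_map 1 ll (@subspaceT _ _) (subspace_ideal1 cps1_t)
  (subspace_row_space M') (subspace_row_space M) _ _ _)).
- by move=> a _; exists (a *: delta_mx 0 i0).
- move=> a _; split=> [[b ->]|[v]].
    exists (b *: delta_mx 0 i0); rewrite lE ME mulmxA; congr (_ *m _).
    apply/rowP => j; rewrite DE !mxE eqxx /=.
    by case: eqVneq => _; rewrite ?mulr1 // !mulr0 ?mul0r.
  rewrite ME mulmxA lE => /inj /rowP /(_ i0); rewrite DE !mxE !eqxx mulr1 => ->.
  by exists (v 0 i0).
move=> u [v uE]; exists (v 0 i0) => //.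
exists (\row_j if j == i0 then 0 else v 0 j); rewrite ME mulmxA.
have -> : \row_j (u - lphi (v 0 i0)) j = \row_j u j - \row_j lphi (v 0 i0) j.
  by apply/rowP => j; rewrite !mxE.
rewrite uE lE -mulmxBl; congr (_ *m _); apply/rowP => j; rewrite DE !mxE eqxx /=.
by have [->|_] := eqVneq j i0; rewrite ?mulr1 ?subrr ?mul0r // mulr0 subr0.
Qed.

(** Induction on the order of the determinant. If it vanishes at the origin, a constant invertible
    change of rows makes one row divisible by [t]; extracting this factor accounts for one
    dimension. *)
Lemma quotient_dim_row_space k (M : 'M[A]_k) : \det M != 0 ->
  quotient_dim [set: 'I_k -> A] (row_space M) (ford (\det M)).
Proof.
have [n nE] : exists n, ford (\det M) = n by eexists.
elim: n M nE => [|n IH] M nE M0.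
  have [|d0 _] := @fordP _ (cps1_val (\det M)); first by rewrite cps1_val_eq0.
  rewrite nE in d0 *; have [v vE] := cps1_invertible d0.
  rewrite (_ : row_space M = setT); first exact/quotient_dim_refl/subspaceT.
  apply/seteqP; split=> // u _; exists (v *: (\row_j u j *m \adj M)).
  by rewrite -scalemxAl -mulmxA mul_adj_mx mul_mx_scalar scalerA -vE scale1r.
case: k => [|k] in M nE M0 IH *.
  by move: nE; rewrite det_mx00 (@ford_0 _ (1 : A)) // oner_neq0.
have [c c0 cM] : exists2 v : 'rV_k.+1, v != 0 & v *m map_mx ev0 M = 0.
  apply/det0P; rewrite det_map_mx; apply/eqP.
  have [|_ al] := @fordP _ (cps1_val (\det M)); first by rewrite cps1_val_eq0.
  by apply: al; rewrite nE.
(* As [c] has rank one, the first row of [U] is proportional to it and therefore kills [M] at the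
   origin. *)
pose U := row_ebase c; have Uu : U \in unitmx := row_ebase_unit c.
have UM j : (U *m map_mx ev0 M) ord0 j = 0.
  have : c *m map_mx ev0 M = (col_ebase c *m pid_mx (\rank c) *m U) *m map_mx ev0 M.
    by rewrite mulmx_ebase.
  have -> : \rank c = 1%N.
    by apply/eqP; rewrite eqn_leq rank_leq_row lt0n mxrank_eq0.
  rewrite cM -!mulmxA => E.
  have := congr1 (fun N : 'rV_k.+1 => (invmx (col_ebase c) *m N) 0 j) E.
  rewrite mulmx0 mulKmx ?col_ebase_unit // !mxE => /esym; rewrite (bigD1 ord0) //= big1 => [|i i0].
    by rewrite !mxE /= mul1r addr0.
  by case: i i0 => [[|i] il] // _; rewrite !mxE mul0r.
pose Uc := map_mx (@cps1_const K) U.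
pose N := Uc *m M.
have N0 j : exists b, N ord0 j = b * cps1_t.
  apply: cps1_divides; first exact: cps1_t_neq0.
  rewrite ford_t => -[|//] _; rewrite -[LHS]/(ev0 (N ord0 j)).
  have := UM j; rewrite (_ : U = map_mx ev0 Uc); last first.
    by apply/matrixP => a b; rewrite !mxE.
  by rewrite -map_mxM mxE.
pose M' : 'M[A]_k.+1 := \matrix_(i, j) if i == ord0 then projT1 (cid (N0 j)) else N i j.
pose D : 'M[A]_k.+1 := diag_mx (\row_i if i == ord0 then cps1_t else 1).
have NE : N = D *m M'.
  apply/matrixP => i j; rewrite mul_diag_mx [in RHS]mxE [in X in _ = _ * X]mxE [in X in _ = X * _]mxE.
  case: eqP => [->|_]; last by rewrite mul1r.
  by case: cid => b /= ->; rewrite mulrC.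
have dD : \det D = cps1_t.
  rewrite det_diag (bigD1 ord0) //= mxE big1 ?mulr1 // => i i0; by rewrite mxE (negPf i0).
have dN : cps1_const (\det U) * \det M = cps1_t * \det M'.
  by rewrite -det_map_mx -det_mulmx -dD -det_mulmx -NE.
have U0 : (\det U) != 0 by rewrite -unitfE -unitmxE.
have cU : cps1_const (\det U) != 0.
  by apply: contra_neq U0 => /(congr1 (fun a : A => a 0%N)).
have M'0 : \det M' != 0.
  apply: contra_eq_neq dN => ->; rewrite mulr0; exact: cps1_mul_neq0.
have nE' : ford (\det M') = n.
  have := congr1 (fun a : A => ford a) dN.
  rewrite !cps1M_val !fordM ?cps1_val_eq0 ?cps1_t_neq0 //.
  rewrite (@ford_0 _ (cps1_const _)) // ford_t nE => -[] //.
have -> : row_space M = row_space N.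
  rewrite /N (@row_space_unit _ Uc (map_mx (@cps1_const K) (invmx U))) //.
  by rewrite -map_mxM mulVmx // map_mx1.
rewrite nE -[n.+1]addn1; apply: (quotient_dim_add (@subspaceT _ _) (subspace_row_space M')
  (subspace_row_space N)) => //.
- by move=> u [v uE]; exists (v *m D); rewrite uE NE mulmxA.
- by rewrite -[X in quotient_dim _ _ X]nE'; apply: IH.
exact: quotient_dim_row_step NE.
Qed.

Section Multiplication.
Variables (k : nat) (g : R).
Hypothesis gr : yregular k g.

Definition ycomb (u : 'I_k -> A) : R := \sum_j cps_ofx (u j) * cps_y ^+ j.

Lemma ycombE u i (j : 'I_k) : ycomb u i j = u j i.
Proof.
rewrite cps_sumE; under eq_bigr do rewrite mulrC cps_yXE cps_ofxE.
rewrite (bigD1 j) //= ltnn subnn eqxx big1 ?addr0 // => l.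
rewrite -val_eqE /= => lj; case: ltnP => // jl; rewrite subn_eq0.
by rewrite leqNgt ltn_neqAle lj jl.
Qed.

Lemma ylow_ycomb u : ylow k (ycomb u).
Proof.
move=> i j kj; rewrite cps_sumE big1 // => l _; rewrite mulrC cps_yXE cps_ofxE.
case: ltnP => // lj; rewrite subn_eq0 leqNgt (leq_trans (ltn_ord l)) //.
Qed.

Lemma ycomb_linear : linear ycomb.
Proof.
move=> t u v; rewrite -[t *: ycomb u]/(cps_const t * ycomb u) mulr_sumr -big_split /ycomb.
apply: eq_bigr => j _; rewrite -[(t *: u + v) j]/(t *: u j + v j) cps1_scaleE.
have -> : cps_const t = cps_ofx (cps1_const t) by apply: cps_eqP => -[|i] [|l].
by rewrite rmorphD rmorphM mulrDl mulrA.
Qed.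

Lemma ycomb_mulmx (v : 'rV[A]_k) (M : 'M[A]_k) : ycomb (fun j => (v *m M) 0 j) =
  \sum_i cps_ofx (v 0 i) * ycomb (M i).
Proof.
under eq_bigr do rewrite mulr_sumr; rewrite exchange_big; apply: eq_bigr => j _.
rewrite mxE rmorph_sum mulr_suml; apply: eq_bigr => i _.
by rewrite rmorphM mulrA.
Qed.

Lemma ycomb_ex h : exists u a, h = a * g + ycomb u.
Proof.
have [q [r [-> rl]]] := cps_weierstrass h gr.
by exists (fun j => cps_col j r), q; rewrite {1}(ylow_decomp rl).
Qed.

Lemma ycomb_divides u : divides g (ycomb u) -> forall j, u j = 0.
Proof.
move=> [a E] j.
have [|_ u0] := @cps_weierstrass_uniq K k g (- a) (ycomb u) gr (ylow_ycomb u).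
  by rewrite E mulNr addNr.
by apply: val_inj; apply/fpsP => i; rewrite -[LHS]/(u j i) -ycombE u0.
Qed.

(* The matrix of the multiplication by [h] on [R / (g)], which is free over [A] *)
(* with basis [1, y, ..., y^(k-1)].                                           *)
Definition mul_matrix h (M : 'M[A]_k) : Prop :=
  forall i : 'I_k, divides g (h * cps_y ^+ i - ycomb (M i)).

Lemma mul_matrix_ex h : exists M, mul_matrix h M.
Proof.
have ex (i : 'I_k) := cid (ycomb_ex (h * cps_y ^+ i)).
exists (\matrix_(i, j) projT1 (ex i) j) => i.
have -> : ycomb ((\matrix_(i, j) projT1 (ex i) j) i) = ycomb (projT1 (ex i)).
  by apply: eq_bigr => j _; rewrite mxE.
by case: (ex i) => u [a /= ->]; exists a; rewrite addrK.
Qed.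

(** In the quotient by [g], free over [C{x}], the multiples of [h] form the row space of [M]; the
    codimension is the order of the norm of [h]. *)
Lemma quotient_dim_mul_matrix h M : mul_matrix h M -> \det M != 0 ->
  quotient_dim [set: R] [set u | exists a b, u = a * g + h * b] (ford (\det M)).
Proof.
move=> hM M0.
have hv (v : 'rV[A]_k) : divides g (h * ycomb (v 0) - ycomb (fun j => (v *m M) 0 j)).
  rewrite ycomb_mulmx mulr_sumr -sumrB; apply: divides_sum => i _.
  by have := divides_mulr (cps_ofx (v 0 i)) (hM i); apply: divides_eq; ring.
apply: (iffLR (quotient_dim_map (ford (\det M)) ycomb_linear (@subspaceT _ _) (subspace_row_space M)
  (@subspaceT _ _) (subspace_ideal2 g h) _ _ _)) (quotient_dim_row_space M0) => //.
  move=> u _; split=> [[v uE]|[a [b uE]]].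
    have [a E] := hv v; exists (- a), (ycomb (v 0)).
    have -> : ycomb u = ycomb (fun j => (v *m M) 0 j).
      by apply: eq_bigr => j _; rewrite -uE mxE.
    by rewrite mulNr -E opprB subrK.
  have [v [c bE]] := ycomb_ex b; exists (\row_j v j); apply/rowP => j.
  apply/eqP; rewrite -subr_eq0; apply/eqP.
  pose u' : 'I_k -> A := fun j => u j - (\row_j v j *m M) 0 j.
  have -> : (\row_j u j) 0 j - (\row_j v j *m M) 0 j = u' j by rewrite mxE.
  apply: ycomb_divides j.
  have -> : ycomb u' = ycomb u - ycomb (fun j => (\row_j v j *m M) 0 j).
    by rewrite -sumrB; apply: eq_bigr => j _; rewrite rmorphB mulrBl.
  have [a' E] := hv (\row_j v j); have vE : ycomb ((\row_j v j) 0) = ycomb v.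
    by apply: eq_bigr => j _; rewrite mxE.
  rewrite vE in E; exists (a + h * c + a').
  by rewrite uE bE !mulrDl -E; ring.
move=> h' _; have [u [a hE]] := ycomb_ex h'; exists u => //.
by exists a, 0; rewrite mulr0 addr0 hE addrK.
Qed.

End Multiplication.
End RowSpace.

(** * The norm as a product over roots *)

Section MultiplicationDeterminant.
Variable F : comNzRingType.
Implicit Types (P H Q : {poly F}).

Lemma rVpoly_sum k (v : 'rV[F]_k) : rVpoly v = \sum_i (v 0 i)%:P * 'X^i.
Proof.
rewrite {1}[v]row_sum_delta linear_sum; apply: eq_bigr => i _.
by rewrite linearZ /= rVpoly_delta mul_polyC.
Qed.

Lemma rVpoly_multiple_eq0 k P Q (v : 'rV[F]_k) : P \is monic -> size P = k.+1 ->
  rVpoly v = Q * P -> v = 0.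
Proof.
move=> Pm sP E; have [Q0|Q0] := eqVneq Q 0.
  by rewrite -[v]rVpolyK E Q0 mul0r linear0.
have := size_poly k (fun i => if insub i is Some j then v 0 j else 0).
rewrite -[\poly_(_ < _) _]/(rVpoly v) E size_Mmonic // sP addnS /= -{2}[k]add0n leq_add2r.
by rewrite leqn0 size_poly_eq0 (negPf Q0).
Qed.

Definition mul_matrix_mod P H k (N : 'M[F]_k) : Prop :=
  forall i : 'I_k, exists Q, H * 'X^i = Q * P + rVpoly (row i N).

Lemma mul_matrix_mod_ex P H k : P \is monic -> size P = k.+1 ->
  exists N : 'M[F]_k, mul_matrix_mod P H N.
Proof.
move=> Pm sP; exists (\matrix_(i < k) poly_rV (Pdiv.Ring.rmodp (H * 'X^i) P)) => i.
exists (Pdiv.Ring.rdivp (H * 'X^i) P); rewrite rowK poly_rV_K.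
  exact: Pdiv.RingMonic.rdivp_eq.
by rewrite -ltnS -sP Pdiv.Ring.ltn_rmodpN0 // monic_neq0.
Qed.

Lemma mul_matrix_mod_row P H k (N : 'M[F]_k) (v : 'rV[F]_k) : mul_matrix_mod P H N ->
  exists Q, H * rVpoly v = Q * P + rVpoly (v *m N).
Proof.
move=> NE; pose Q i := projT1 (cid (NE i)).
have QE (i : 'I_k) : H * 'X^i = Q i * P + rVpoly (row i N) by rewrite /Q; case: cid.
exists (\sum_i (v 0 i)%:P * Q i); rewrite mulmx_sum_row linear_sum mulr_suml -big_split.
rewrite rVpoly_sum mulr_sumr; apply: eq_bigr => i _.
by rewrite linearZ /= -mul_polyC mulrCA QE; ring.
Qed.

(* In the basis [1, X - y, (X - y) X, ...], the multiplication by [H] modulo  *)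
(* [(X - y) P'] is block triangular, with blocks [H(y)] and the              *)
(* multiplication by [H] modulo [P'].                                        *)
Lemma det_mul_matrix_mod (ys : seq F) H (N : 'M[F]_(size ys)) :
  mul_matrix_mod (\prod_(y <- ys) ('X - y%:P)) H N -> \det N = \prod_(y <- ys) H.[y].
Proof.
elim: ys N => [|y ys IH] /= N NE; first by rewrite big_nil det_mx00.
set k := size ys in N NE IH *.
pose P' := \prod_(y <- ys) ('X - y%:P).
have P'm : P' \is monic by apply: monic_prod_XsubC.
have sP' : size P' = k.+1 by rewrite size_prod_XsubC.
pose P := ('X - y%:P) * P'.
have Pm : P \is monic by rewrite monicMr // monicXsubC.
have sP : size P = k.+2.
  by rewrite size_Mmonic ?monic_neq0 ?monicXsubC // size_XsubC sP'.
have [N' N'E] := mul_matrix_mod_ex H P'm sP'.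
have [S SE] : exists S, H - (H.[y])%:P = ('X - y%:P) * S.
  have /factor_theorem[S E] : root (H - (H.[y])%:P) y by rewrite /root !hornerE subrr.
  by exists S; rewrite E mulrC.
have [s [Q0 sE]] : exists (s : 'rV_k) Q0, S = Q0 * P' + rVpoly s.
  exists (poly_rV (Pdiv.Ring.rmodp S P')), (Pdiv.Ring.rdivp S P').
  rewrite poly_rV_K; first exact: Pdiv.RingMonic.rdivp_eq.
  by rewrite -ltnS -sP' Pdiv.Ring.ltn_rmodpN0 // monic_neq0.
pose ins (a : F) (v : 'rV_k) : 'rV_k.+1 := \row_j if unlift ord0 j is Some j' then v 0 j' else a.
(* [T] is the multiplication in the new basis, and [C] expresses that basis in powers of [X]; [C] is
   unitriangular, so [T] has the determinant of [N]. *)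
pose T : 'M_k.+1 := \matrix_i if unlift ord0 i is Some i' then ins 0 (row i' N') else ins H.[y] s.
pose C : 'M[F]_k.+1 := \matrix_(i, j) ((i == j)%:R - y * (i == j.+1 :> nat)%:R).
have rC (i : 'I_k.+1) : rVpoly (row i C) = if unlift ord0 i is Some i' then ('X - y%:P) * 'X^i' else 1.
  apply/polyP => j; rewrite coef_rVpoly; case: insubP => [j' _ jE|].
    rewrite !mxE -jE; case: unliftP => [i' ->|->].
      rewrite mulrBl coefB -exprS coefXn coefCM coefXn.
      by rewrite -val_eqE /= /bump leq0n add1n eqSS ![nat_of_ord j' == _]eq_sym.
    by rewrite coefC mulr0 subr0 eq_sym -val_eqE; case: eqP.
  rewrite -leqNgt => kj; case: unliftP => [i' _|_]; last by rewrite coefC; case: j kj.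
  have ij : (i'.+1 < j)%N by apply: leq_trans kj; rewrite ltnS.
  by rewrite mulrBl coefB -exprS coefXn coefCM coefXn !gtn_eqF ?(ltnW ij) // mulr0 subr0.
have insC a v : rVpoly (ins a v *m C) = a%:P + ('X - y%:P) * rVpoly v.
  rewrite mulmx_sum_row linear_sum big_ord_recl linearZ /= rC mxE unlift_none -mul_polyC mulr1.
  congr (_ + _); rewrite rVpoly_sum mulr_sumr; apply: eq_bigr => i _.
  by rewrite linearZ /= rC mxE liftK -!mul_polyC mulrCA.
have TC : C *m N = T *m C.
  apply/row_matrixP => i; apply/eqP; rewrite -subr_eq0; apply/eqP.
  have [Q1 E1] := mul_matrix_mod_row (row i C) NE.
  have [Q2 E2] : exists Q2, H * rVpoly (row i C) = Q2 * P + rVpoly (row i (T *m C)).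
    rewrite row_mul rowK rC; case: unliftP => [i' _|_]; rewrite insC.
      have [Q2 E2] := N'E i'; exists Q2.
      by rewrite mulrCA E2 /P; ring.
    exists Q0; rewrite mulr1 -{1}[H](subrK H.[y]%:P) SE sE /P.
    by ring.
  apply: (@rVpoly_multiple_eq0 _ P (Q2 - Q1)) => //.
  move: E1 E2; rewrite big_cons -/P' -/P => -> E2.
  have E : rVpoly (row i C *m N) = Q2 * P + rVpoly (row i (T *m C)) - Q1 * P.
    by rewrite -E2 addrAC subrr add0r.
  by rewrite !linearB /= row_mul E; ring.
have dC : \det C = 1.
  rewrite det_trig; first by rewrite big1 // => i _; rewrite mxE eqxx (ltn_eqF (ltnSn _)) mulr0 subr0.
  apply/is_trig_mxP => i j ij; rewrite mxE -val_eqE !ltn_eqF ?mulr0 ?subrr //.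
  exact: leqW.
have -> : \det N = \det T.
  by have := congr1 determinant TC; rewrite !det_mulmx dC mul1r mulr1.
rewrite (expand_det_col T ord0) big_ord_recl big1 ?addr0 => [|i _]; last first.
  by rewrite !mxE liftK mxE unlift_none mul0r.
rewrite !mxE !unlift_none mxE unlift_none /cofactor expr0 mul1r big_cons -(IH N') //.
congr (_ * \det _); apply/matrixP => i j; rewrite !mxE !liftK !mxE liftK.
by rewrite mxE.
Qed.

Lemma det_mul_matrix k (ys : seq F) H (N : 'M[F]_k) : size ys = k ->
  mul_matrix_mod (\prod_(y <- ys) ('X - y%:P)) H N -> \det N = \prod_(y <- ys) H.[y].
Proof. by move=> sk; move: N; rewrite -sk => N; exact: det_mul_matrix_mod. Qed.

End MultiplicationDeterminant.

(** * Ramification of the variable *)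

Section Ramification.
Variable K : numClosedFieldType.
Local Notation F := (fps K).

(* The substitution of [s^(n+1)] for the variable. *)
Definition ram n (a : F) : F := FPS (fun i => if (n.+1 %| i)%N then a (i %/ n.+1)%N else 0).

Lemma ramE n a i : ram n a (i * n.+1)%N = a i.
Proof. by rewrite /= dvdn_mull // mulnK. Qed.

Lemma ram_ndvd n a i : ~~ (n.+1 %| i)%N -> ram n a i = 0.
Proof. by move=> /negPf /= ->. Qed.

Fact ram_is_zmod_morphism n : zmod_morphism (ram n).
Proof.
by move=> a b; apply/fpsP => i; rewrite fpsDE fpsNE /=; case: ifP; rewrite ?subrr.
Qed.

Let sum_multiples n m (G : nat -> K) :
  \sum_(i < (m * n.+1).+1) (if (n.+1 %| i)%N then G (i %/ n.+1)%N else 0) = \sum_(j < m.+1) G j.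
Proof.
elim: m => [|m IH]; first by rewrite mul0n !big_ord_recl !big_ord0 dvdn0 div0n.
rewrite [RHS]big_ord_recr /= -IH mulSn addnC.
rewrite -(big_mkord xpredT (fun i => if (n.+1 %| i)%N then G (i %/ n.+1)%N else 0)).
rewrite (@big_cat_nat _ _ _ (m * n.+1).+1) //=; last by rewrite ltnS leq_addr.
rewrite big_mkord; congr (_ + _); rewrite addnS big_nat_recr /=; last by rewrite ltnS leq_addr.
rewrite big_nat_cond big1 => [|i]; last first.
  rewrite andbT => /andP[i1 i2]; case: ifP => // /dvdnP[q iE].
  move: i1 i2; rewrite iE ltn_pmul2r // => mq.
  by rewrite -addnS -mulSnr ltn_pmul2r // ltnS leqNgt mq.
by rewrite add0r -addnS -mulSnr dvdn_mull // mulnK.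
Qed.

Fact ram_is_monoid_morphism n : monoid_morphism (ram n).
Proof.
split=> [|a b]; apply/fpsP => i.
  case: i => [|i]; rewrite !fps1E /= ?dvdn0 ?div0n //; case: ifP => // ni.
  by rewrite eqn0Ngt divn_gt0 // dvdn_leq.
have [ni|ni] := boolP (n.+1 %| i)%N; last first.
  rewrite ram_ndvd // fpsME big1 // => j _.
  have [nj|/ram_ndvd->] := boolP (n.+1 %| j)%N; last by rewrite mul0r.
  by rewrite [X in _ * X]ram_ndvd ?mulr0 // dvdn_subl // -ltnS ltn_ord.
have /dvdnP[m ->] := ni; rewrite ramE !fpsME.
rewrite -(sum_multiples n m (fun j => a j * b (m - j)%N)); apply: eq_bigr => j _.
have [nj|/ram_ndvd->] := boolP (n.+1 %| j)%N; last by rewrite mul0r.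
have /dvdnP[q qE] := nj; rewrite qE -mulnBl !ramE mulnK //.
Qed.

HB.instance Definition _ n := GRing.isZmodMorphism.Build F F (ram n) (ram_is_zmod_morphism n).
HB.instance Definition _ n := GRing.isMonoidMorphism.Build F F (ram n) (ram_is_monoid_morphism n).

Lemma ram_comp m n a : ram m (ram n a) = ram (m.+1 * n.+1).-1 a.
Proof.
apply/fpsP => i; have mn : (m.+1 * n.+1).-1.+1 = (m.+1 * n.+1)%N by [].
rewrite /ram /= mn; have [/dvdnP[q ->]|mi] := boolP (m.+1 %| i)%N; last first.
  by case: ifP => // /(dvdn_trans (dvdn_mulr _ (dvdnn _))); rewrite (negPf mi).
by rewrite mulnK // [(m.+1 * _)%N]mulnC dvdn_pmul2r // divnMr.
Qed.

Lemma ram_const n t : ram n (fps_const t) = fps_const t.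
Proof.
apply/fpsP => -[|i] /=; rewrite ?dvdn0 ?div0n //; case: ifP => // ni.
by rewrite eqn0Ngt divn_gt0 // dvdn_leq.
Qed.

Lemma ram_var n : ram n (fps_var K) = fps_var K ^+ n.+1.
Proof.
apply/fpsP => i; rewrite -[fps_var _ ^+ _]mulr1 fps_varXE fps1E.
have -> : (if (i < n.+1)%N then 0 else (i - n.+1 == 0)%N%:R) = (i == n.+1)%:R :> K.
  by rewrite subn_eq0; case: ltngtP => // ->.
have [/dvdnP[q ->]|ni] := boolP (n.+1 %| i)%N.
  by rewrite ramE -[X in _ == X]mul1n eqn_pmul2r.
by rewrite ram_ndvd //; case: eqP ni => // ->; rewrite dvdnn.
Qed.

Lemma ford_ram n a : a != 0 -> ram n a != 0 /\ ford (ram n a) = (ford a * n.+1)%N.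
Proof.
move=> /fordP[a0 al]; have r0 : ram n a (ford a * n.+1)%N != 0 by rewrite ramE.
split; first exact: ford_neq0 r0.
apply: ford_eq => // i il; have [/dvdnP[q iE]|/ram_ndvd//] := boolP (n.+1 %| i)%N.
by move: il; rewrite iE ramE ltn_pmul2r // => /al.
Qed.

End Ramification.

(** * Hensel's lemma *)

Section Hensel.
Variable K : numClosedFieldType.
Local Notation F := (fps K).
Implicit Types (P Q W : {poly F}).

Definition fps2_poly P : fps (fps K) := FPS (fun i => FPS (fun j => P`_j i)).

Fact fps2_poly_is_zmod_morphism : zmod_morphism fps2_poly.
Proof. by move=> P Q; apply: fps2P => i j; rewrite fps2BE /= coefB. Qed.

Fact fps2_poly_is_monoid_morphism : monoid_morphism fps2_poly.
Proof.
split=> [|P Q]; apply: fps2P => i j.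
  by rewrite /= coef1; case: i j => [|i] [|j].
rewrite fps2ME exchange_big -[LHS]/((P * Q)`_j i) coefM fps_sumE.
by apply: eq_bigr => p _; rewrite fpsME.
Qed.

HB.instance Definition _ := GRing.isZmodMorphism.Build {poly F} (fps (fps K)) fps2_poly
  fps2_poly_is_zmod_morphism.
HB.instance Definition _ := GRing.isMonoidMorphism.Build {poly F} (fps (fps K)) fps2_poly
  fps2_poly_is_monoid_morphism.

(** [W] is the Weierstrass polynomial, [y^m] minus its remainder, and is a unit times [P]. The
    Euclidean remainder of [P] by [W] vanishes by uniqueness of Weierstrass division. *)
Lemma hensel P m : P \is monic -> yregular m (fps2_poly P) ->
  exists W Q, [/\ W \is monic, Q \is monic, size W = m.+1 & P = Q * W].
Proof.
move=> Pm Pr; have [q [r [yE rl _]]] := weierstrass_division (fps2_y K ^+ m) Pr.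
pose r' : {poly F} := \poly_(j < m) FPS (fun i => r i j).
have rE : fps2_poly r' = r.
  by apply: fps2P => i j; rewrite /= coef_poly; case: ltnP => // mj; rewrite rl.
have sr : (size r' < size ('X^m : {poly F}))%N by rewrite size_polyXn ltnS size_poly.
pose W := 'X^m - r'.
have Wm : W \is monic by rewrite monicE lead_coefDl ?lead_coefXn // size_polyN.
have sW : size W = m.+1 by rewrite size_polyDl ?size_polyXn // size_polyN -[m.+1](size_polyXn F).
have WE : fps2_poly W = q * fps2_poly P.
  rewrite rmorphB /= rE; apply/eqP; rewrite subr_eq -yE; apply/eqP.
  apply: fps2P => i j; rewrite -[fps2_y K ^+ m]mulr1 fps2_yXE /= coefXn.
  case: ltngtP => [//|mj|->]; last by rewrite subnn; case: i.
  have [l ->] : exists l, (j - m = l.+1)%N by exists (j - m).-1; rewrite prednK // subn_gt0.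
  by case: i.
have [P0 Pn] := Pr.
have qP0 : (q * fps2_poly P) 0%N = q 0%N * fps2_poly P 0%N by rewrite fpsME big_ord1.
have Wr : yregular m (fps2_poly W).
  split=> [j jm|]; last by rewrite /= -[m]/(m.+1.-1) -sW -lead_coefE (monicP Wm) oner_neq0.
  by rewrite WE qP0; apply: (fps_low_mul (n := 0) (m := m)).
have q0 : q 0%N 0%N != 0.
  have := Wr.2; rewrite WE qP0 -[m]add0n (fps_lead_mul (n := 0)) //.
  by apply: contra_neq => ->; rewrite mul0r.
have [v qv _] := fps2_inv q0.
pose Q := Pdiv.Ring.rdivp P W; pose S := Pdiv.Ring.rmodp P W.
have PE : P = Q * W + S by apply: Pdiv.RingMonic.rdivp_eq.
have sS : (size S < m.+1)%N by rewrite -sW Pdiv.Ring.ltn_rmodpN0 // monic_neq0.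
have [||_ S0] := @weierstrass_uniq K m (fps2_poly W) (fps2_poly Q - v) (fps2_poly S) Wr.
- move=> i j mj; rewrite /= nth_default //; exact: leq_trans mj.
- rewrite mulrBl addrAC -rmorphM -rmorphD -PE WE mulrA [v * q]mulrC qv mul1r.
  exact: subrr.
have {}S0 : S = 0.
  apply/polyP => j; rewrite coef0; apply/fpsP => i.
  by rewrite -[LHS]/(fps2_poly S i j) S0.
rewrite S0 addr0 in PE; exists W, Q; split=> //.
by move: Pm; rewrite PE monicMr.
Qed.

End Hensel.

(** * Puiseux's theorem *)

Section Puiseux.
Variable K : numClosedFieldType.
Local Notation F := (fps K).
Implicit Types (P Q : {poly F}).

Lemma map_prod_XsubC (f : {rmorphism F -> F}) (ys : seq F) :
  map_poly f (\prod_(y <- ys) ('X - y%:P)) = \prod_(y <- map f ys) ('X - y%:P).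
Proof.
rewrite big_map rmorph_prod; apply: eq_bigr => y _.
by rewrite rmorphB /= map_polyX map_polyC.
Qed.

Definition splits P := exists n ys, map_poly (ram n) P = \prod_(y <- ys) ('X - y%:P).

Lemma map_ram_comp m n P : map_poly (ram m) (map_poly (ram n) P) = map_poly (ram (m.+1 * n.+1).-1) P.
Proof. by apply/polyP => i; rewrite !coef_map /= -ram_comp. Qed.

Lemma splits_ram n P : splits (map_poly (ram n) P) -> splits P.
Proof. by move=> [m [ys]]; rewrite map_ram_comp => E; exists (m.+1 * n.+1).-1, ys. Qed.

Lemma splitsM P Q : splits P -> splits Q -> splits (P * Q).
Proof.
move=> [n [ys yE]] [m [zs zE]].
exists (m.+1 * n.+1).-1, (map (ram m) ys ++ map (ram n) zs).
by rewrite rmorphM big_cat /= -!map_prod_XsubC -yE -zE !map_ram_comp [(n.+1 * _)%N]mulnC.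
Qed.

Lemma splits1 : splits 1.
Proof. by exists 0%N, [::]; rewrite rmorph1 big_nil. Qed.

Lemma splits_Xn d : splits 'X^d.
Proof.
elim: d => [|d IH]; first by rewrite expr0; exact: splits1.
rewrite exprS; apply: splitsM IH.
by exists 0%N, [:: 0]; rewrite map_polyX big_seq1 subr0.
Qed.

Lemma splits_shift c P : splits (P \Po ('X + c%:P)) -> splits P.
Proof.
move=> [n [ys yE]]; exists n, [seq y + ram n c | y <- ys].
rewrite -[P](comp_polyXaddC_K P c) map_comp_poly yE rmorphB /= map_polyX map_polyC /= big_map.
elim: ys {yE} => [|y ys IH]; first by rewrite !big_nil comp_polyC.
by rewrite !big_cons comp_polyM IH comp_polyB comp_polyX comp_polyC polyCD opprD addrAC addrA.
Qed.

Lemma coef_prod_scale (s : F) (ys : seq F) i : (i <= size ys)%N ->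
  (\prod_(y <- ys) ('X - (s * y)%:P))`_i = s ^+ (size ys - i) * (\prod_(y <- ys) ('X - y%:P))`_i.
Proof.
elim: ys i => [|y ys IH] i /=; first by rewrite leqn0 !big_nil => /eqP ->; rewrite mul1r.
move=> il; rewrite !big_cons !mulrBl !coefB !coefCM !coefXM mulrBr.
have top : (\prod_(y <- ys) ('X - (s * y)%:P))`_(size ys).+1 = 0 /\
    (\prod_(y <- ys) ('X - y%:P))`_(size ys).+1 = 0.
  by split; rewrite nth_default // (size_prod_XsubC _ (fun y => _)).
congr (_ - _).
  by case: i il => [|i] il; rewrite ?mulr0 // subSS; apply: IH.
move: il; rewrite leq_eqVlt => /orP[/eqP->|il]; first by rewrite !top.1 !top.2 !mulr0.
by rewrite IH // subSn // exprS; ring.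
Qed.

(** Homogeneity of the symmetric functions: multiplying all roots by [S] multiplies the coefficient
    of [X^i] by [S^(d - i)]. *)
Lemma splits_scale d (S : F) P Q : Q \is monic -> size Q = d.+1 -> (size P <= d.+1)%N ->
  (forall i, (i <= d)%N -> P`_i = S ^+ (d - i) * Q`_i) -> splits Q -> splits P.
Proof.
move=> Qm sQ sP PE [n [ys yE]]; exists n, [seq ram n S * y | y <- ys].
have sys : size ys = d.
  apply: succn_inj; rewrite -(size_prod_XsubC ys id) -yE -sQ size_map_poly_id0 //.
  by rewrite (monicP Qm) rmorph1 oner_neq0.
rewrite big_map; apply/polyP => i; have [id|di] := leqP i d.
  by rewrite coef_prod_scale sys // -yE !coef_map /= PE // rmorphM rmorphXn.
rewrite coef_map /= !nth_default ?rmorph0 //; last exact: leq_trans di.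
by rewrite (size_prod_XsubC _ (fun y => ram n S * y)) sys.
Qed.

Lemma coef_exp_XaddC (T : comNzRingType) (c : T) n : (('X + c%:P) ^+ n.+1)`_n = c *+ n.+1.
Proof.
have m k : (('X + c%:P) ^+ k)`_k = 1.
  have := monic_exp k (monicXaddC c).
  by rewrite monicE lead_coefE -[c]opprK polyCN size_exp_XsubC => /eqP.
elim: n => [|n IH]; first by rewrite expr1 coefD coefX coefC add0r.
by rewrite exprSr mulrDr coefD coefMX coefMC /= IH m mul1r -mulrSr.
Qed.

Definition fev0 (a : F) : K := a 0%N.
Fact fev0_is_zmod_morphism : zmod_morphism fev0. Proof. by []. Qed.
Fact fev0_is_monoid_morphism : monoid_morphism fev0.
Proof. by split=> // a b; rewrite /fev0 fpsME big_ord1. Qed.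
HB.instance Definition _ := GRing.isZmodMorphism.Build F K fev0 fev0_is_zmod_morphism.
HB.instance Definition _ := GRing.isMonoidMorphism.Build F K fev0 fev0_is_monoid_morphism.

Lemma monic_shift (T : comNzRingType) (P : {poly T}) c n : P \is monic -> size P = n.+2 ->
  [/\ P \Po ('X + c%:P) \is monic, size (P \Po ('X + c%:P)) = n.+2 &
    (P \Po ('X + c%:P))`_n = P`_n + c *+ n.+1].
Proof.
move=> Pm sP; pose R := \poly_(i < n) P`_i.
have PE : P = 'X^(n.+1) + (P`_n)%:P * 'X^n + R.
  apply/polyP => i; rewrite !coefD coefCM !coefXn coef_poly.
  case: (ltngtP i n) => [il|il|->].
  - by rewrite ltn_eqF 1?ltnW // mulr0 !add0r.
  - case: (ltngtP i n.+1) => [|il'|->]; [by rewrite ltnNge il| |].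
      by rewrite nth_default ?sP // mulr0 !addr0.
    have -> : n.+1 = (size P).-1 by rewrite sP.
    by rewrite -lead_coefE (monicP Pm) mulr0 !addr0.
  by rewrite ltn_eqF // mulr1 add0r addr0.
have sR : (size (R \Po ('X + c%:P)) <= n)%N.
  have [R0|R0] := eqVneq R 0; first by rewrite R0 comp_poly0 size_poly0.
  apply: leq_trans (size_comp_poly_leq _ _) _; rewrite size_XaddC muln1.
  by rewrite prednK ?size_poly_gt0 // size_poly.
have sX k : size (('X + c%:P) ^+ k) = k.+1 by rewrite -[c]opprK polyCN size_exp_XsubC.
pose L := (P`_n)%:P * ('X + c%:P) ^+ n + (R \Po ('X + c%:P)).
have sL : (size L <= n.+1)%N.
  apply: leq_trans (size_polyD _ _) _; rewrite geq_max mul_polyC.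
  by rewrite (leq_trans (size_scale_leq _ _)) ?sX //= (leq_trans sR).
have -> : P \Po ('X + c%:P) = ('X + c%:P) ^+ n.+1 + L.
  by rewrite {1}PE !comp_polyD comp_polyM comp_polyC !comp_Xn_poly addrA.
split.
- by rewrite monicE lead_coefDl ?sX // (monicP (monic_exp _ (monicXaddC c))).
- by rewrite size_polyDl ?sX.
have m k : (('X + c%:P) ^+ k)`_k = 1.
  have := monic_exp k (monicXaddC c).
  by rewrite monicE lead_coefE sX => /eqP.
by rewrite !coefD coefCM coef_exp_XaddC m mulr1 [_`_n in X in _ + (_ + X)]nth_default // addr0 addrC.
Qed.

(* [Q (0)] has vanishing trace, hence two distinct roots, which Hensel's lemma *)
(* separates.                                                                *)
Lemma splits_hensel n Q i0 :
  (forall P, P \is monic -> (size P <= n.+1)%N -> splits P) ->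
  Q \is monic -> size Q = n.+2 -> Q`_n = 0 -> (i0 < n.+1)%N -> Q`_i0 0%N != 0 -> splits Q.
Proof.
move=> IH Qm sQ Qn i0n Qi0.
pose q := map_poly fev0 Q; have qE i : q`_i = Q`_i 0%N by rewrite coef_map.
have sq : size q = n.+2.
  by rewrite size_map_poly_id0 // (monicP Qm) rmorph1 oner_neq0.
have qm : q \is monic by apply: monic_map.
have [c qc] : exists c, root q c by apply/closed_rootP; rewrite sq.
pose P := Q \Po ('X + (fps_const c)%:P).
suff: splits P by exact: splits_shift.
have [Pm sP _] : [/\ P \is monic, size P = n.+2 & P`_n = _] := monic_shift (fps_const c) Qm sQ.
have PE : map_poly fev0 P = q \Po ('X + c%:P).
  by rewrite map_comp_poly rmorphD /= map_polyX map_polyC.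
have PE' i : (q \Po ('X + c%:P))`_i = P`_i 0%N by rewrite -PE coef_map.
have [p1 sp1 _] := monic_shift c qm sq.
have ex : exists j, (q \Po ('X + c%:P))`_j != 0.
  exists n.+1; have -> : n.+1 = (size (q \Po ('X + c%:P))).-1 by rewrite sp1.
  by rewrite -lead_coefE (monicP p1) oner_neq0.
have [m pm mmin] := ex_minnP ex.
have low j : (j < m)%N -> (q \Po ('X + c%:P))`_j = 0.
  by move=> jm; apply/eqP; apply: contraTT jm => /mmin; rewrite -leqNgt.
have m0 : (0 < m)%N.
  rewrite lt0n; apply: contraNneq pm => ->.
  by rewrite -horner_coef0 horner_comp !hornerE (rootP qc).
(* Otherwise [q = (X - c)^(n+1)]; the zero coefficient of [X^n] forces [c = 0], against the nonzero
   coefficient at [i0]. *)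
have mn : (m < n.+1)%N.
  rewrite ltnNge; apply: contraNN Qi0 => nm.
  have E : q \Po ('X + c%:P) = 'X^(n.+1).
    apply/polyP => i; rewrite coefXn; case: (ltngtP i n.+1) => [il|il|->].
    - by rewrite low // (leq_trans il).
    - by rewrite nth_default // sp1.
    have -> : n.+1 = (size (q \Po ('X + c%:P))).-1 by rewrite sp1.
    by rewrite -lead_coefE (monicP p1).
  have E' : q = ('X - c%:P) ^+ n.+1.
    by rewrite -[q](comp_polyXaddC_K _ c) E comp_Xn_poly.
  have c0 : c = 0.
    have := qE n; rewrite Qn E' -polyCN coef_exp_XaddC mulNrn fps0E => /eqP.
    by rewrite oppr_eq0 mulrn_eq0 => /eqP.
  by rewrite -qE E' c0 subr0 coefXn ltn_eqF.
have Pr : yregular m (fps2_poly P).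
  split=> [j jm|]; rewrite -[fps2_poly P _ _]/(P`__ 0%N) -PE'; [exact: low|exact: pm].
have [W [R [Wm Rm sW PR]]] := hensel Pm Pr.
rewrite PR; apply: splitsM; apply: IH; rewrite ?sW //.
have := sP; rewrite PR size_Mmonic ?monic_neq0 // sW addnS /=.
by have [r ->] : exists r, size R = r by [eexists]; move: m0; clear; lia.
Qed.

(* The substitution [X := s^p X] for the smallest slope [p] of the Newton     *)
(* polygon, which is integral after ramification of order [n.+1`!].          *)
Lemma puiseux_step n P :
  (forall P, P \is monic -> (size P <= n.+1)%N -> splits P) ->
  P \is monic -> size P = n.+2 -> P`_n = 0 -> splits P.
Proof.
move=> IH Pm sP Pn; have Pd : P`_n.+1 = 1.
  by have /monicP := Pm; rewrite lead_coefE sP.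
have [/existsP[i0 Pi0]|] := boolP [exists i : 'I_n.+1, P`_i != 0]; last first.
  rewrite negb_exists => /forallP P0; rewrite (_ : P = 'X^(n.+1)); first exact: splits_Xn.
  apply/polyP => i; rewrite coefXn; case: (ltngtP i n.+1) => [il|il|-> //].
    by have := P0 (Ordinal il); rewrite negbK => /eqP.
  by rewrite nth_default // sP.
(* The slopes have denominators [n.+1 - i], which divide the ramification order; [v i] is the slope
   after ramification. *)
pose a i : F := P`_i; pose N := (n.+1)`!.-1; have NE : N.+1 = (n.+1)`! by rewrite prednK // fact_gt0.
pose v (i : 'I_n.+1) := (ford (a i) * (N.+1 %/ (n.+1 - i)))%N.
have vE (i : 'I_n.+1) : (v i * (n.+1 - i) = ford (a i) * N.+1)%N.
  rewrite /v -mulnA divnK // NE dvdn_fact // subn_gt0 ltn_ord leq_subr //.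
case: (@arg_minnP _ i0 (fun i => P`_i != 0) v Pi0) => {Pi0}i0 Pi0 vmin; set p := v i0.
have low (i : 'I_n.+1) j : (j < p * (n.+1 - i))%N -> ram N (a i) j = 0.
  have [->|Pi] := eqVneq (a i) 0; first by rewrite rmorph0.
  move=> jp; have [r0 rE] := ford_ram N Pi; have [_ al] := fordP r0.
  by apply: al; rewrite rE -vE (leq_trans jp) // leq_mul2r vmin ?orbT.
pose b := fun i : nat => fps_shift (p * (n.+1 - i)) (ram N (a i)).
have bE : forall l : 'I_n.+1, fps_var K ^+ (p * (n.+1 - l)) * b l = ram N (a l).
  by move=> l; apply: fps_shiftK; exact: low.
(* [Q] is [P] with its coefficients divided by powers of the variable; where the slope is least, the
   coefficient becomes a unit, as [splits_hensel] requires. *)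
apply: (@splits_ram N); pose Q : {poly F} := 'X^(n.+1) + \poly_(i < n.+1) b i.
have sB : (size (\poly_(i < n.+1) b i) < size ('X^(n.+1) : {poly F}))%N.
  by rewrite size_polyXn ltnS size_poly.
have Qm : Q \is monic by rewrite monicE lead_coefDl // lead_coefXn.
have sQ : size Q = n.+2 by rewrite size_polyDl // size_polyXn.
have QE i : (i < n.+1)%N -> Q`_i = b i.
  by move=> il; rewrite coefD coefXn coef_poly il ltn_eqF // add0r.
apply: (@splits_scale n.+1 (fps_var K ^+ p) _ Q) => //.
- by rewrite (leq_trans (size_poly _ _)) // sP.
- move=> i; rewrite leq_eqVlt coef_map => /orP[/eqP->|il].
    rewrite Pd /= (rmorph1 (ram N)) subnn expr0 mul1r.
    by have /monicP := Qm; rewrite lead_coefE sQ.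
  by rewrite QE // -exprM; apply/esym/(bE (Ordinal il)).
apply: (@splits_hensel n Q i0) => //.
  by rewrite QE // /b /a Pn rmorph0; apply/fpsP.
rewrite QE // -[b i0 0%N]/(ram N (a i0) (0 + p * (n.+1 - i0))%N) add0n /p vE ramE.
by have [] := fordP (Pi0 : a i0 != 0).
Qed.

(** Induction on the degree; in characteristic zero a Tschirnhaus shift cancels the coefficient
    below the leading one. *)
Lemma puiseux P : P \is monic -> splits P.
Proof.
have [n] : exists n, (size P <= n.+1)%N by exists (size P).
elim: n P => [|n IH] P sP Pm.
  move: Pm; rewrite (size1_polyC sP) monicE lead_coefC => /eqP->; exact: splits1.
have [sn|ns] := leqP (size P) n.+1; first exact: IH.
have {}sP : size P = n.+2 by apply/eqP; rewrite eqn_leq sP.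
pose c := fps_const (n.+1%:R^-1) * - P`_n.
have [Qm sQ Qn] := monic_shift c Pm sP.
apply: (@splits_shift c); apply: (@puiseux_step n) => //.
  by move=> Q Qm' sQ'; apply: IH.
rewrite Qn -mulrnAl -rmorphMn /= -mulr_natr mulVf ?pnatr_eq0 //.
by rewrite rmorph1 mul1r subrr.
Qed.

End Puiseux.

(** * Teissier's formula along the polar curve *)

Section Teissier.
Variable K : numClosedFieldType.
Local Notation R := (cps K).
Local Notation A := (cps1 K).
Local Notation F := (fps K).

Definition eval_y : {rmorphism {poly A} -> R} :=
  (horner_eval cps_y \o map_poly (@cps_ofx K))%FUN.

Lemma eval_yE k (U : {poly A}) : (size U <= k)%N -> eval_y U = ycomb (fun j : 'I_k => U`_j).
Proof.
move=> sU; rewrite /= /horner_eval (@horner_coef_wide _ k).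
  by apply: eq_bigr => j _; rewrite coef_map.
exact: leq_trans (size_poly _ _) sU.
Qed.

Lemma eval_y_rVpoly k (v : 'rV[A]_k) : eval_y (rVpoly v) = ycomb (v 0).
Proof.
rewrite (@eval_yE k) ?size_poly //; congr ycomb; apply/funext => j.
by rewrite coef_rVpoly_ord.
Qed.

Lemma eval_yC a : eval_y a%:P = cps_ofx a.
Proof. by rewrite /= /horner_eval map_polyC hornerC. Qed.

Lemma eval_yX : eval_y 'X = cps_y.
Proof. by rewrite /= /horner_eval map_polyX hornerX. Qed.

Section Regular.
Variables (k : nat) (g : R).
Hypothesis gr : yregular k g.

(** The quotient by [g] is [A[y] / (P)], with [P] equal to [y^k] minus its remainder: the Euclidean
    remainder of a polynomial multiple of [g] is zero by uniqueness of division. *)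
Lemma weierstrass_polynomial : exists P : {poly A}, [/\ P \is monic, size P = k.+1 &
  forall U, divides g (eval_y U) <-> exists Q, U = Q * P].
Proof.
have [u [a yE]] := ycomb_ex gr (cps_y ^+ k).
pose r : {poly A} := rVpoly (\row_j u j).
have rE : eval_y r = ycomb u.
  by rewrite eval_y_rVpoly; congr ycomb; apply/funext => j; rewrite mxE.
have sr : (size r < size ('X^k : {poly A}))%N by rewrite size_polyXn ltnS size_poly.
pose P := 'X^k - r.
have Pm : P \is monic by rewrite monicE lead_coefDl ?size_polyN // lead_coefXn.
have sP : size P = k.+1 by rewrite size_polyDl ?size_polyN // size_polyXn.
have PE : eval_y P = a * g.
  by rewrite rmorphB rmorphXn eval_yX rE yE addrK.
exists P; split=> // U; split=> [gU|[Q ->]]; last first.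
  by exists (eval_y Q * a); rewrite rmorphM PE mulrA.
have UE := Pdiv.RingMonic.rdivp_eq Pm U.
set Q := Pdiv.Ring.rdivp U P in UE; set S := Pdiv.Ring.rmodp U P in UE.
have sS : (size S <= k)%N.
  by rewrite -ltnS -sP Pdiv.Ring.ltn_rmodpN0 // monic_neq0.
exists Q; rewrite UE; suff -> : S = 0 by rewrite addr0.
apply/polyP => j; rewrite coef0; have [jk|kj] := ltnP j k; last first.
  by rewrite nth_default // (leq_trans sS).
apply: (ycomb_divides gr (u := fun j : 'I_k => S`_j)) (Ordinal jk).
rewrite -eval_yE //; have -> : S = U - Q * P by rewrite UE addrAC subrr add0r.
rewrite rmorphB; apply: dividesB => //.
by exists (eval_y Q * a); rewrite rmorphM PE mulrA.
Qed.

Lemma eval_y_ex h : exists U, divides g (h - eval_y U).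
Proof.
have [u [a ->]] := ycomb_ex gr h; exists (rVpoly (\row_j u j)), a.
rewrite eval_y_rVpoly (_ : ycomb _ = ycomb u) ?addrK //.
by congr ycomb; apply/funext => j; rewrite mxE.
Qed.

(** Evaluation at a root of [P], computed on polynomial representatives modulo [g], which turns
    substitution into evaluation of a polynomial. *)
Lemma root_morphism (th : {rmorphism A -> F}) (P : {poly A}) (y : F) :
  (forall U, divides g (eval_y U) <-> exists Q, U = Q * P) -> root (map_poly th P) y ->
  exists psi : {rmorphism R -> F},
    forall h U, divides g (h - eval_y U) -> psi h = (map_poly th U).[y].
Proof.
move=> PE /rootP Py; pose U h := projT1 (cid (eval_y_ex h)).
have UE h : divides g (h - eval_y (U h)) by rewrite /U; case: cid.
pose psi h := (map_poly th (U h)).[y].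
have psiE h V : divides g (h - eval_y V) -> psi h = (map_poly th V).[y].
  move=> hV; have /PE[Q E] : divides g (eval_y (U h - V)).
    by rewrite rmorphB; apply: divides_eq (dividesB hV (UE h)); ring.
  apply/eqP; rewrite -subr_eq0 -hornerN -hornerD -rmorphB E rmorphM hornerM Py.
  by rewrite mulr0.
have psiB : zmod_morphism psi.
  move=> a b; rewrite (psiE _ (U a - U b)); first by rewrite rmorphB hornerD hornerN.
  by rewrite rmorphB; apply: divides_eq (dividesB (UE a) (UE b)); ring.
have psiM : monoid_morphism psi.
  split=> [|a b].
    by rewrite (psiE _ 1) ?rmorph1 ?hornerC //; exists 0; rewrite subrr mul0r.
  rewrite (psiE _ (U a * U b)); first by rewrite rmorphM hornerM.
  rewrite rmorphM.
  apply: divides_eq (dividesD (divides_mulr b (UE a)) (divides_mulr (eval_y (U a)) (UE b))).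
  ring.
pose m1 := GRing.isZmodMorphism.Build _ _ psi psiB.
pose m2 := GRing.isMonoidMorphism.Build _ _ psi psiM.
pose psi' : {rmorphism R -> F} := HB.pack psi m1 m2.
by exists psi'.
Qed.

End Regular.

Lemma ford_prod (I : eqType) (s : seq I) (G : I -> F) : (forall i, i \in s -> G i != 0) ->
  \prod_(i <- s) G i != 0 /\ ford (\prod_(i <- s) G i) = (\sum_(i <- s) ford (G i))%N.
Proof.
elim: s => [|i s IH] G0; first by rewrite !big_nil oner_neq0 ford_0 // oner_neq0.
have [|IH1 IH2] := IH; first by move=> j js; apply: G0; rewrite inE js orbT.
have Gi : G i != 0 by apply: G0; rewrite mem_head.
by rewrite !big_cons fps1_mul_neq0 // fordM // IH2.
Qed.

(** [psi] kills the ideal and sends the powers of [x] to distinct powers of the variable, so these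
    are independent modulo the ideal. *)
Lemma common_zero_dim (psi : {rmorphism R -> F}) n (f g : R) m :
  (forall t, psi (cps_const t) = fps_const t) -> psi cps_x = fps_var K ^+ n.+1 ->
  psi f = 0 -> psi g = 0 ->
  ~ quotient_dim [set: R] [set u | exists a b, u = a * g + f * b] m.
Proof.
move=> psiC psix f0 g0 hm.
have sI := subspace_ideal2 g f.
suff : (m.+1 <= m)%N by rewrite ltnn.
apply: (independent_mod_le (c := fun i : 'I_m.+1 => cps_x ^+ i) (@subspaceT _ _) sI hm) => //.
move=> t [a [b /(congr1 psi)]]; rewrite rmorphD !rmorphM f0 g0 mulr0 mul0r addr0 rmorph_sum => E i.
have := congr1 (fun z : F => z (n.+1 * i)%N) E; rewrite fps_sumE (bigD1 i) //= big1 => [|j ji].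
  rewrite -[t i *: _]/(cps_const (t i) * _) rmorphM rmorphXn psiC psix -exprM fps_constME addr0.
  by rewrite -[fps_var _ ^+ _]mulr1 fps_varXE ltnn subnn fps1E mulr1.
rewrite -[t j *: _]/(cps_const (t j) * _) rmorphM rmorphXn psiC psix -exprM fps_constME.
rewrite -[fps_var _ ^+ _]mulr1 fps_varXE; case: ltnP => [_|ij]; rewrite ?mulr0 // fps1E subn_eq0.
by rewrite leq_pmul2l // leqNgt ltn_neqAle -(leq_pmul2l (ltn0Sn n)) ij andbT val_eqE ji mulr0.
Qed.

(** Along the arc the derivative of [f] is [f_x x'] with [x = s^(n+1)]; differentiation lowers the
    orders of [f] and of [x] by one each. *)
Lemma ford_chain (psi : {rmorphism R -> F}) n (f : R) :
  (forall t, psi (cps_const t) = fps_const t) -> psi cps_x = fps_var K ^+ n.+1 ->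
  f 0%N 0%N = 0 -> psi f != 0 -> psi (cps_dy f) = 0 ->
  psi (cps_dx f) != 0 /\ ford (psi f) = (ford (psi (cps_dx f)) + n.+1)%N.
Proof.
move=> psiC psix f00 f0 dy0.
have [df0 dfE] := ford_der f0 (morph_local psiC f00).
have x0 : fps_var K ^+ n.+1 != 0 /\ ford (fps_var K ^+ n.+1) = n.+1.
  have c : (fps_var K ^+ n.+1) n.+1 != 0.
    by rewrite -[fps_var _ ^+ _]mulr1 fps_varXE ltnn subnn fps1E oner_neq0.
  split; first exact: ford_neq0 c.
  by apply: ford_eq => // i il; rewrite -[fps_var _ ^+ _]mulr1 fps_varXE il.
have [x1 x2] := x0.
have xn : (fps_var K ^+ n.+1) 0%N = 0 by rewrite -[fps_var _ ^+ _]mulr1 fps_varXE.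
have [dx0 dxE] := ford_der x1 xn.
have := chain_rule psiC f; rewrite dy0 mul0r addr0 psix => E.
have fx0 : psi (cps_dx f) != 0 by apply: contra_neq df0; rewrite E => ->; rewrite mul0r.
by split=> //; rewrite -dfE E fordM // -addnS dxE x2.
Qed.

(* On each branch of the polar curve [f_y = 0], the chain rule reduces to     *)
(* [df = f_x dx].                                                            *)
Lemma teissier (f : R) k m : f 0%N 0%N = 0 -> yregular k (cps_dy f) ->
  quotient_dim [set: R] [set u | exists a b, u = a * cps_dy f + f * b] m ->
  exists mu, quotient_dim [set: R] [set u | exists a b, u = a * cps_dy f + cps_dx f * b] mu /\
    m = (mu + k)%N.
Proof.
set g := cps_dy f => f00 gr hm.
have [P [Pm sP PE]] := weierstrass_polynomial gr.
have [n [ys yE]] := puiseux (monic_map (@cps1_val K) Pm).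
pose th : {rmorphism A -> F} := (ram n \o @cps1_val K)%FUN.
have thP : map_poly th P = \prod_(y <- ys) ('X - y%:P).
  by rewrite -yE; apply/polyP => i; rewrite !coef_map.
have thE a : th a != 0 -> a != 0 /\ ford (th a) = (ford a * n.+1)%N.
  move=> ta; have a0 : cps1_val a != 0 by apply: contra_neq ta; rewrite /= => ->; rewrite rmorph0.
  by split; [rewrite -cps1_val_eq0|have [] := ford_ram n a0].
have sys : size ys = k.
  apply: succn_inj; rewrite -(size_prod_XsubC ys id) -thP -sP size_map_poly_id0 //.
  by rewrite (monicP Pm) rmorph1 oner_neq0.
have psi_ex y : exists psi : {rmorphism R -> F}, y \in ys ->
    forall h U, divides g (h - eval_y U) -> psi h = (map_poly th U).[y].
  (* Evaluation at the origin is the default morphism outside the list of roots. *)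
  have [yy|_] := boolP (y \in ys); last by exists (th \o @cps1_const K \o @ev00 K)%FUN.
  have [|psi psiE] := @root_morphism _ _ gr th P y PE; first by rewrite thP (big_rem y yy) /= /root hornerM hornerXsubC subrr mul0r.
  by exists psi.
pose psi y := projT1 (cid (psi_ex y)).
have psiE y : y \in ys -> forall h U, divides g (h - eval_y U) -> psi y h = (map_poly th U).[y].
  by rewrite /psi; case: cid.
have psiC y : y \in ys -> forall t, psi y (cps_const t) = fps_const t.
  move=> yy t; rewrite (psiE y yy _ (cps1_const t)%:P).
    by rewrite map_polyC hornerC; apply: ram_const.
  exists 0; rewrite eval_yC mul0r; apply/eqP; rewrite subr_eq0; apply/eqP.
  by apply: cps_eqP => -[|i] [|j].
have psix y : y \in ys -> psi y cps_x = fps_var K ^+ n.+1.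
  move=> yy; rewrite (psiE y yy _ (cps1_t)%:P).
    by rewrite map_polyC hornerC -ram_var.
  by exists 0; rewrite eval_yC cps_ofx_t subrr mul0r.
have psig y : y \in ys -> psi y g = 0.
  move=> yy; rewrite (psiE y yy _ 0) ?rmorph0 ?horner0 //.
  by exists 1; rewrite subr0 mul1r.
have norm h (M : 'M[A]_k) : mul_matrix g h M -> th (\det M) = \prod_(y <- ys) psi y h.
  move=> hM; have [U UE] := eval_y_ex gr h.
  have -> : \prod_(y <- ys) psi y h = \prod_(y <- ys) (map_poly th U).[y].
    by apply: eq_big_seq => y yy; apply: psiE.
  rewrite -det_map_mx; apply: det_mul_matrix sys _ => i; rewrite -thP.
  have /PE[Q QE] : divides g (eval_y (U * 'X^i - rVpoly (row i M))).
    rewrite rmorphB rmorphM rmorphXn eval_yX eval_y_rVpoly.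
    have -> : ycomb ((row i M) 0) = ycomb (M i) by congr ycomb; apply/funext => j; rewrite mxE.
    apply: divides_eq (dividesB (hM i) (divides_mulr (cps_y ^+ i) UE)); ring.
  exists (map_poly th Q); rewrite -rmorphM -QE rmorphB rmorphM /= map_polyXn.
  have -> : rVpoly (row i (map_mx th M)) = map_poly th (rVpoly (row i M)).
    by rewrite map_rVpoly map_row.
  by rewrite subrK.
have psif y : y \in ys -> psi y f != 0.
  move=> yy; apply/eqP => f0.
  exact: (common_zero_dim (psiC y yy) (psix y yy) f0 (psig y yy) hm).
have psifx y : y \in ys -> psi y (cps_dx f) != 0 /\
    ford (psi y f) = (ford (psi y (cps_dx f)) + n.+1)%N.
  by move=> yy; apply: (ford_chain (psiC y yy) (psix y yy) f00 (psif y yy) (psig y yy)).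
have [M hM] := mul_matrix_ex gr f; have [N hN] := mul_matrix_ex gr (cps_dx f).
have [M0 ME] := ford_prod psif; have [|N0 NE] := @ford_prod _ ys (fun y => psi y (cps_dx f)).
  by move=> y /psifx[].
rewrite -(norm _ _ hM) in M0 ME; rewrite -(norm _ _ hN) in N0 NE.
have [dM fM] := thE _ M0; have [dN fN] := thE _ N0.
have qM := quotient_dim_mul_matrix gr hM dM; have qN := quotient_dim_mul_matrix gr hN dN.
exists (ford (\det N)); split=> //.
have -> := quotient_dim_uniq (@subspaceT _ _) (subspace_ideal2 g f) hm qM.
(* Ramification multiplies all orders by [n + 1]; each of the [k] roots contributes the excess
   [n + 1] of [ford_chain], hence [k] after division. *)
apply/eqP; rewrite -(eqn_pmul2r (ltn0Sn n)) -fM ME mulnDl -fN NE; apply/eqP.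
rewrite (eq_big_seq (fun y => ford (psi y (cps_dx f)) + n.+1)%N) => [|y /psifx[]//].
by rewrite big_split /= big_const_seq count_predT sys iter_addn_0 mulnC.
Qed.

End Teissier.

(** * The Milnor number *)

Section MilnorNumber.
Variable K : numClosedFieldType.
Local Notation R := (cps K).
Local Notation A := (cps1 K).

(** The number [(f, f_y)] is [2 d + (n + 1) - r] on the branches and [mu + n] along the polar curve,
    with [r] the cardinal of [I]. *)
Lemma milnor_regular n (f : R) d (I : finType) (phi : I -> {rmorphism R -> A}) w :
  yregular n.+1 f -> parametrized f d phi w ->
  exists mu, quotient_dim [set: R] [set u | exists a b, u = a * cps_dx f + b * cps_dy f] mu /\
    (mu + #|I| = d.*2.+1)%N.
Proof.
move=> fr par; have x0 := parametrized_x_neq0 fr (ltn0Sn n) par.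
have [phiC phik _ _ [w0 wy wx sw]] := par.
have xo i : phi i cps_x 0%N = 0 by apply: (morph1_local (phiC i)); rewrite -[cps_x]mulr1 -[cps_x]expr1 cps_xXE.
have f00 : f 0%N 0%N = 0 by have [fl _] := fr; exact: fl.
have dfr : yregular n (cps_dy f).
  have [fl fn] := fr; split=> [j jn|]; first by rewrite -[LHS]/(f 0%N j.+1 *+ j.+1) fl ?mul0rn.
  by rewrite -[X in X != _]/(f 0%N n.+1 *+ n.+1) mulrn_eq0.
have dx i : fps_der (phi i cps_x) != 0 /\ (ford (fps_der (phi i cps_x))).+1 = ford (phi i cps_x).
  by apply: ford_der => //; rewrite cps1_val_eq0.
have dy i : phi i (cps_dy f) != 0.
  by rewrite -cps1_val_eq0 wy fps1_mul_neq0 //; have [] := dx i.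
have hx := intersection par x0.
have hy := intersection par dy.
have hx' := quotient_dim_weierstrass 1 fr.
have E1 : (\sum_i ford (phi i cps_x) = n.+1)%N.
  apply: quotient_dim_uniq (@subspaceT _ _) (subspace_ideal2 f cps_x) hx _.
  by move: hx'; rewrite mul1n expr1.
have hy' : quotient_dim [set: R] [set u | exists a b, u = a * cps_dy f + f * b]
    (\sum_i ford (phi i (cps_dy f))).
  rewrite (_ : [set u | _] = [set u | exists a b, u = a * f + cps_dy f * b]) //.
  by apply/seteqP; split=> u [a [b ->]]; exists b, a; ring.
have [mu [hmu muE]] := teissier f00 dfr hy'.
exists mu; split.
  rewrite (_ : [set u | _] = [set u | exists a b, u = a * cps_dy f + cps_dx f * b]) //.
  by apply/seteqP; split=> u [a [b ->]]; exists b, a; ring.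
(* The unit added on each branch compensates the order lost in differentiating [x]; these units
   count the branches. *)
have E2 : (\sum_i (ford (phi i (cps_dy f)) + 1) = \sum_i (ford (w i) + ford (phi i cps_x)))%N.
  apply: eq_bigr => i _; have [dx0 dxE] := dx i.
  by rewrite addn1 wy fordM // -dxE addnS.
move: E2; rewrite !big_split /= muE sw E1 sum1_card => E2.
by apply/eqP; rewrite -(eqn_add2r n) addnAC E2 addnS addSn.
Qed.

(* A linear change of coordinates makes [f] [y]-regular. *)
Lemma milnor_number (f : R) d (I : finType) (phi : I -> {rmorphism R -> A}) w :
  f <> 0 -> f 0%N 0%N = 0 -> parametrized f d phi w ->
  exists mu, quotient_dim [set: R] [set u | exists a b, u = a * cps_dx f + b * cps_dy f] mu /\
    (mu + #|I| = d.*2.+1)%N.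
Proof.
move=> f0 f00 par; have [e [fv fe]] := hform_ex f0.
case: e fv fe => [|e] fv fe.
  case/eqP: fe; apply/polyP => j; rewrite hform_coef coef0 leqn0.
  by case: eqP => // ->.
have [t ft] := shear_regular fv fe.
have [mu [hmu muE]] := milnor_regular ft (parametrized_shear t par).
exists mu; split=> //.
have lsh : linear (shear t : R -> R).
  move=> a u v; rewrite -[a *: u]/(cps_const a * u) rmorphD rmorphM /= shear_const.
  by [].
have [Ex Ey] := cps_der_shear t f.
have sJ u v : subspace [set h : R | exists a b, h = a * u + b * v].
  rewrite (_ : [set h | _] = [set h | exists a b, h = a * u + v * b]); first exact: subspace_ideal2.
  by apply/seteqP; split=> h [a [b ->]]; exists a, b; ring.
apply: (iffRL (quotient_dim_map mu lsh (@subspaceT _ _) (sJ _ _) (@subspaceT _ _) (sJ _ _) _ _ _)) hmu => //.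
  move=> u _; rewrite Ex Ey; split=> [[a [b ->]]|[a [b E]]].
    exists (shear t a - cps_const t * shear t b), (shear t b).
    by rewrite !rmorphD !rmorphM /= shear_const; ring.
  exists (shear (- t) a + cps_const t * shear (- t) b), (shear (- t) b).
  rewrite -[u](shearNK t) E !rmorphD !rmorphM !rmorphD !rmorphM /= !shearNK ?shear_const.
  by ring.
by move=> u _; exists (shear (- t) u) => //; rewrite shearK subrr; exists 0, 0; rewrite !mul0r addr0.
Qed.

End MilnorNumber.

(** * From strict transforms to the constellation *)

Section StrictTransforms.
Variable K : numClosedFieldType.
Local Notation R := (cps K).

Lemma pc_neq0 c (f : R) : f <> 0 -> pc c f <> 0.
Proof.
move=> /hform_ex[e [_ /eqP fe]] p0; apply: fe.
have E : dform c e (hform e f) = 0.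
  by apply/polyP => m; rewrite -pcE p0 coef0.
case: c E {p0} => [a|] /=; first by move/eqP; rewrite comp_poly_eq0 ?size_XaddC // => /eqP.
move=> E; apply/polyP => j; rewrite coef0; have [je|ej] := leqP j e.
  have := congr1 (fun p : {poly K} => p`_(e - j)) E.
  by rewrite coef_poly ltnS leq_subr subKn // coef0.
by rewrite hform_coef leqNgt ej.
Qed.

Lemma strict1_divides c (f : R) : f <> 0 -> strict1 f c <> 0 /\ divides (strict1 f c) (pullback1 f c).
Proof.
move=> f0; have [s [m [g [E gr]]]] := yregular_factor (pc_neq0 (c := c) f0).
rewrite (strict1E E gr); split.
  move=> /(congr1 (uncross c)); rewrite uncrossK => g0; case: gr => _; rewrite g0.
  by case: c {E g0} => [a|] /=; rewrite ?rmorph0 eqxx.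
by exists (uncross c (cps_x ^+ s)); rewrite -uncrossM -E pullback1_pc.
Qed.

(** Each step divides out a power of the exceptional equation only. The normal crossings total
    transform thus serves as the divisor at the ends of the tree. *)
Lemma strict_transform_divides Q (f : R) : f <> 0 ->
  divides (strict_transform [::] Q f) (pullback [::] Q f).
Proof.
rewrite /strict_transform /pullback drop0.
suff H (g h : R) : g <> 0 -> divides g h -> divides (foldl (@strict1 K) g Q) (foldl (@pullback1 K) h Q).
  by move=> f0; apply: H => //; exists 1; rewrite mul1r.
elim: Q {f} g h => [//|c Q IH] g f /= g0 [h fE].
have [s0 sd] := strict1_divides c g0; apply: IH => //.
have -> : pullback1 f c = pullback1 h c * pullback1 g c by rewrite fE !pullback1E rmorphM.
exact: divides_mulr.
Qed.

Lemma embedded_resolution_bounded (A : curve K) B : embedded_resolution A B ->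
  exists D, forall P, B P -> (size P < D)%N.
Proof.
move=> [[Bfin _] _]; exists (\max_(P <- fset_set B) size P).+1 => P BP.
rewrite ltnS; apply: (@leq_bigmax_seq _ _ xpredT (fun P : Defs.point K => size P)) => //.
by rewrite in_fset_set // inE.
Qed.

Lemma infinitely_nearE (A : curve K) (B : set (Defs.point K)) : is_model B ->
  infinitely_near A B = [set P | passes A P /\
      exists B', [/\ is_model B', B' `<=` B & model_points B' P]].
Proof.
move=> [Bfin Bcl]; apply/seteqP; split=> P [PA]; last first.
  by move=> [B' [_ BB' [_ PB']]]; split=> // P' /PB' /BB'.
(* The minimal model containing [P] blows up exactly the points strictly preceding it. *)
move=> PB; split=> //; exists [set P' | strictly_precedes P' P].
have sB : [set P' | strictly_precedes P' P] `<=` B by move=> P' /PB.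
split=> //; last by split=> // -[].
split; first exact: sub_finite_set Bfin.
move=> P' P'' [P''P nP] P'P''; split; first exact: prefix_trans P''P.
move=> E; apply: nP; move: P'P''; rewrite E => PP''.
have /prefixP[s Es] := P''P; have /prefixP[s' Es'] := PP''.
have := congr1 size Es; rewrite Es' !size_cat -addnA -[LHS]addn0 => /addnI/esym/eqP.
by rewrite addn_eq0 => /andP[/nilP-> _]; rewrite cats0.
Qed.

End StrictTransforms.

Theorem corollary15p10 (R : realType) (A : curve R[i])
    (C : constellation_of_crosses R[i]) (hC : adapted C A)
    (Lambda : set (set (label R[i]))) (hLambda : Lambda = lotus C) :
  exists delta mu : nat,
    [/\ is_delta_invariant A delta, is_milnor_number A mu,
        delta = \sum_(P \in pts C)
          ((multiplicity A P * (multiplicity A P - 1)) %/ 2)%N,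
        mu%:Z = 2 * delta%:Z - (branch_number A)%:Z + 1 &
        forall m : set (label R[i]) -> nat,
          multiplicity_decoration C A Lambda m ->
          delta = \sum_(P \in pts C)
            ((m (dual_segment C P) * (m (dual_segment C P) - 1)) %/ 2)%N].
Proof.
have [B [hB ptsE _ _]] := hC; have [Bm Bnc] := hB.
have [D BD] := embedded_resolution_bounded hB.
have Ared : reduced (Defs.eqn A) by move=> g n; apply: eqn_reduced.
have [||L [uL LE [I [phi [w par]]]]] := tree_resolvedP (@eqn_neq0 _ A) Ared _ BD.
- by move=> P Q; apply: Bm.2.
- move=> Q /Bnc nc; exists (pullback [::] Q A) => //.
  exact/strict_transform_divides/eqn_neq0.
have [mu [hmu muE]] := milnor_number (@eqn_neq0 _ A) (@eqn_origin _ A) par.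
(* The constellation is the finite tree listed by [L], which turns the sums over a set into sums
   over a list. *)
have pE : pts C = [set` L].
  by rewrite ptsE -infinitely_nearE //; apply/seteqP; split=> P /LE.
have sumE (F : Defs.point R[i] -> nat) : \sum_(P \in pts C) F P = (\sum_(P <- L) F P)%N.
  by rewrite pE -fsbig_seq.
have binE e : ('C(e, 2) = (e * (e - 1)) %/ 2)%N by rewrite bin2 divn2 subn1.
exists (\sum_(P <- L) 'C(Defs.order (strict_transform [::] P A), 2))%N, mu; split.
- exact: delta_invariant par.
- exact: hmu.
- by rewrite sumE; apply: eq_bigr => P _; rewrite binE.
- rewrite (branch_numberE par).
  set d := (\sum_(_ <- _) _)%N in muE *; move: muE; lia.
move=> m hm; rewrite sumE; apply: eq_big_seq => P PL; rewrite binE.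
have [|_ ->//] := hm P _; by rewrite pE.
Qed.
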